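(* For any even positive integer $p$, the $\ell_p$ necklace alignment problem on two necklaces with $n$ beads each can be solved in $O(p^2 n\lg n)$ time on a real RAM.
   Context: Necklace alignment problem: given $p\in[1,\infty]$ and two sorted vectors $\vec x=\langle x_0,\dots,x_{n-1}\rangle$, $\vec y=\langle y_0,\dots,y_{n-1}\rangle$ of reals in $[0,1)$, find an offset $c\in[0,1)$ and a shift $s\in\{0,1,\dots,n-1\}$ minimizing $\sum_{i=0}^{n-1}\big(d^\circ((x_i+c)\bmod 1,\,y_{(i+s)\bmod n})\big)^p$, where $d^\circ(a,b)=\min\{|a-b|,1-|a-b|\}$; ''solving'' means computing the optimal value and an optimal pair $(c,s)$. The real RAM is the model with unit-cost arithmetic operations and comparisons on real numbers.
   Formalization: The real RAM is extended by a primitive returning all real roots of a degree-d polynomial in d+1 steps, because for even p ≥ 4 the optimal offset can be irrational for rational inputs and so is not computable by arithmetic operations and comparisons alone. *)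

(* Defs.v *)
From HB Require Import structures.
From mathcomp Require Import all_boot all_order all_algebra.
From mathcomp Require Import polyrcf.
From mathcomp Require Import reals.
Set Implicit Arguments. Unset Strict Implicit. Unset Printing Implicit Defensive.
Import Order.TTheory GRing.Theory Num.Theory.
Local Open Scope ring_scope.

Section Necklace.
Variable R : realType.

Definition dcirc (a b : R) : R := Num.min `|a - b| (1 - `|a - b|).

Definition mod1 (a : R) : R := a - (Num.floor a)%:~R.

Definition necklace_cost (p : nat) (xs ys : seq R) (c : R) (s : nat) : R :=
  \sum_(i < size xs)
     (dcirc (mod1 (nth 0 xs i + c)) (nth 0 ys ((i + s) %% size xs))) ^+ p.

Definition necklace_input (n : nat) (xs : seq R) : Prop :=
  size xs = n /\ sorted <=%R xs /\ all (fun a => (0 <= a) && (a < 1)) xs.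

Definition necklace_optimal (p : nat) (xs ys : seq R) (c : R) (s : nat) (v : R)
  : Prop :=
  [/\ 0 <= c < 1, (s < size xs)%N, necklace_cost p xs ys c s = v &
      forall (c' : R) (s' : nat), 0 <= c' < 1 -> (s' < size xs)%N ->
        v <= necklace_cost p xs ys c' s'].
End Necklace.

(* Real registers R[k] and integer registers I[k], k : nat (unbounded
   memory, indirect addressing via integer registers).  Only integer
   constants may appear in programs.  Operations: +, -, *, / on reals,
   +, - on integers, int->real conversion, comparisons with branching.
   No floor.  In addition a root-finding primitive:
   [Roots i j] with d = |I[i]|, b = |I[j]| computes the sorted list of
   distinct real roots of the polynomial sum_{m<=d} R[b+m] X^m, writes
   them into R[b], R[b+1], ... and their number into I[i] (or -1 if the
   polynomial is zero); it costs d+1 steps. *)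
Inductive instr : Type :=
| RCst of nat & int
| RAdd of nat & nat & nat
| RSub of nat & nat & nat
| RMul of nat & nat & nat
| RDiv of nat & nat & nat    (* R[a] := R[b] / R[c] (x/0 = 0) *)
| RLd of nat & nat
| RSt of nat & nat
| ICst of nat & int
| IAdd of nat & nat & nat
| ISub of nat & nat & nat
| ILd of nat & nat
| ISt of nat & nat
| IToR of nat & nat
| JRLt of nat & nat & nat
| JILt of nat & nat & nat
| Jmp of nat
| Roots of nat & nat
| Halt.

Record ram_state (R : realType) := RamState {
  pc : nat; rreg : nat -> R; ireg : nat -> int }.

Section RAM.
Variable R : realType.
Implicit Types (st : ram_state R) (prog : seq instr).

Definition upd {T : Type} (f : nat -> T) (k : nat) (v : T) : nat -> T :=
  fun m => if m == k then v else f m.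

Definition setR st k v := RamState (pc st).+1 (upd (rreg st) k v) (ireg st).
Definition setI st k v := RamState (pc st).+1 (rreg st) (upd (ireg st) k v).
Definition jump st (b : bool) t :=
  RamState (if b then t else (pc st).+1) (rreg st) (ireg st).

Definition roots_step st (i j : nat) : ram_state R :=
  let d := `|ireg st i|%N in
  let b := `|ireg st j|%N in
  let P : {poly R} := \poly_(m < d.+1) rreg st (b + m) in
  let rs := rootsR P in
  RamState (pc st).+1
    (fun m => if (b <= m < b + size rs)%N then nth 0 rs (m - b) else rreg st m)
    (upd (ireg st) i (if P == 0 then -1 else (size rs)%:Z)).

Definition step prog st : option (ram_state R * nat) :=
  let R_ := rreg st in let I_ := ireg st in
  match nth Halt prog (pc st) with
  | RCst a z => Some (setR st a z%:~R, 1%N)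
  | RAdd a b c => Some (setR st a (R_ b + R_ c), 1%N)
  | RSub a b c => Some (setR st a (R_ b - R_ c), 1%N)
  | RMul a b c => Some (setR st a (R_ b * R_ c), 1%N)
  | RDiv a b c => Some (setR st a (R_ b / R_ c), 1%N)
  | RLd a i => Some (setR st a (R_ `|I_ i|%N), 1%N)
  | RSt i a => Some (setR st `|I_ i|%N (R_ a), 1%N)
  | ICst i z => Some (setI st i z, 1%N)
  | IAdd i j k => Some (setI st i (I_ j + I_ k), 1%N)
  | ISub i j k => Some (setI st i (I_ j - I_ k), 1%N)
  | ILd i j => Some (setI st i (I_ `|I_ j|%N), 1%N)
  | ISt i j => Some (setI st `|I_ i|%N (I_ j), 1%N)
  | IToR a i => Some (setR st a (I_ i)%:~R, 1%N)
  | JRLt a b t => Some (jump st (R_ a < R_ b) t, 1%N)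
  | JILt i j t => Some (jump st (I_ i < I_ j) t, 1%N)
  | Jmp t => Some (jump st true t, 1%N)
  | Roots i j => Some (roots_step st i j, (`|I_ i|%N).+1)
  | Halt => None
  end.

Fixpoint exec prog (fuel : nat) st : option (ram_state R * nat) :=
  match fuel with
  | 0 => None
  | fuel'.+1 =>
    match step prog st with
    | None => Some (st, 0%N)
    | Some (st', c) =>
        match exec prog fuel' st' with
        | None => None
        | Some (fin, k) => Some (fin, (k + c)%N)
        end
    end
  end.

Definition necklace_init (p : nat) (xs ys : seq R) : ram_state R :=
  let n := size xs in
  RamState 0
    (fun k => if (k < n)%N then nth 0 xs k
              else if (k < n + n)%N then nth 0 ys (k - n) else 0)
    (fun k => if k == 0%N then n%:Z else if k == 1%N then p%:Z else 0).

Definition necklace_output_ok (p : nat) (xs ys : seq R) (fin : ram_state R) :=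
  exists s : nat, ireg fin 0 = s%:Z /\
    necklace_optimal p xs ys (rreg fin 0) s (rreg fin 1).
End RAM.

(* Main.v *)
(* Lift both necklaces to the line, y_(j+n) = y_j + 1.  An optimal circular
   matching lifts to a periodic matching, and as t^p is convex it can be
   uncrossed, without increasing its cost, until it is a shift; so one has to
   minimise L_s(c) = sum_i (x_i + c - y_(i+s))^p over 0 <= s < n and all real c.
   Each L_s is a convex polynomial in c, so any root of its derivative is a
   minimiser, and its coefficients are, up to factorials, the moments
   sum_i (x_i - y_(i+s))^m.  With divided powers z^a / a! the binomial theorem
   makes the m-th moments of all shifts the coefficients of a sum of m + 1
   products of two polynomials, computed in time O(n lg n) per transform by a
   fast Fourier transform over the reals (Bruun's factorization, with the
   constant-geometry data layout of Pease); square roots and roots of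
   derivatives come from the root finder.  The program is written in a small
   structured language with a total semantics and compiled to the machine. *)

Require Import Defs.
From HB Require Import structures.
From mathcomp Require Import all_boot all_order perm all_algebra.
From mathcomp Require Import polyrcf complex reals zify ring lra.
Set Implicit Arguments.
Unset Strict Implicit.
Unset Printing Implicit Defensive.
Import Order.TTheory GRing.Theory Num.Theory.
Local Open Scope ring_scope.

(** * Execution of machine code *)

(** Two limits of the machine shape the transform. Registers hold reals and programs contain only
    integer constants, so roots of unity are out of reach; factoring z^(4q) + 1 into real quadratics
    needs only numbers of the form 2 cos t, and the half-angle relation b^2 = 2 - a produces them
    all from 0 by square roots. Integer registers can only be added, subtracted and compared, so
    every address must be a sum of counters and fixed sizes; an access pattern common to all stages
    makes this possible. Here q is a power of two with n <= q < 2 n. The products of polynomials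
    have at most 4 q coefficients, so computing modulo z^(4q) + 1 loses nothing. The root finder is
    always handed p + 1 coefficients, even for a square root: O(p) per call, with O(n) calls for the
    parameters and n for the shifts. There are 2 (p + 1) forward and p + 1 inverse transforms, and
    O(p^2) pointwise products in O(n) each, all within the bound. The machine has no floor, but the
    lifted beads confine each minimiser to (-1, 2), so that two comparisons reduce it modulo 1. *)

Section Machine.
Variable R : realType.
Implicit Types (st : ram_state R) (prog cs : seq instr).

(** The remaining fuel [f] is arbitrary, which makes runs compose. The number [k] of instructions
    and their cost [t] are kept apart because [Roots] costs more than one step; only an upper bound
    [T] of the cost is exposed. *)
Definition runs prog st st' (T : nat) : Prop :=
  exists t k, (t <= T)%N /\ forall f,
    exec prog (k + f) st = omap (fun x => (x.1, (x.2 + t)%N)) (exec prog f st').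

Lemma runs_refl prog st T : runs prog st st T.
Proof.
exists 0%N, 0%N; split=> // f; rewrite add0n.
by case: exec => //= -[a b]; rewrite addn0.
Qed.

Lemma runs_trans prog st1 st2 st3 T1 T2 :
  runs prog st1 st2 T1 -> runs prog st2 st3 T2 -> runs prog st1 st3 (T1 + T2).
Proof.
move=> [t1 [k1 [h1 e1]]] [t2 [k2 [h2 e2]]].
exists (t1 + t2)%N, (k1 + k2)%N; split; first by rewrite leq_add.
move=> f; rewrite -addnA e1 e2; case: exec => //= -[a b] /=.
by rewrite -addnA [(t2 + t1)%N]addnC.
Qed.

Lemma runs_le prog st st' T T' : (T <= T')%N -> runs prog st st' T -> runs prog st st' T'.
Proof. by move=> le [t [k [h e]]]; exists t, k; split=> //; apply: leq_trans le. Qed.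

Lemma runs_step prog st st' c :
  step prog st = Some (st', c) -> runs prog st st' c.
Proof.
move=> e; exists c, 1%N; split=> // f; rewrite add1n /= e.
by case: exec => // -[a b].
Qed.

Definition code_at prog (a : nat) cs : Prop :=
  exists pre post, prog = pre ++ cs ++ post /\ size pre = a.

Lemma code_at_catl prog a c1 c2 : code_at prog a (c1 ++ c2) -> code_at prog a c1.
Proof.
by move=> [pre [post [-> sz]]]; exists pre, (c2 ++ post); rewrite -catA.
Qed.

Lemma code_at_catr prog a b c1 c2 :
  code_at prog a (c1 ++ c2) -> (a + size c1)%N = b -> code_at prog b c2.
Proof.
move=> [pre [post [-> sz]]] <-; exists (pre ++ c1), post.
by rewrite -!catA size_cat sz.
Qed.

Lemma code_at_nth prog a i cs :
  code_at prog a cs -> (i < size cs)%N -> nth Halt prog (a + i) = nth Halt cs i.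
Proof.
move=> [pre [post [-> sz]]] lt; rewrite nth_cat sz ltnNge leq_addr /=.
by rewrite addKn nth_cat lt.
Qed.

Definition straight (i : instr) : bool :=
  match i with JRLt _ _ _ | JILt _ _ _ | Jmp _ | Defs.Roots _ _ | Halt => false
  | _ => true end.

Definition straight_step st (i : instr) : ram_state R :=
  let R_ := rreg st in let I_ := ireg st in
  match i with
  | RCst a z => setR st a z%:~R
  | RAdd a b c => setR st a (R_ b + R_ c)
  | RSub a b c => setR st a (R_ b - R_ c)
  | RMul a b c => setR st a (R_ b * R_ c)
  | RDiv a b c => setR st a (R_ b / R_ c)
  | RLd a i => setR st a (R_ `|I_ i|%N)
  | RSt i a => setR st `|I_ i|%N (R_ a)
  | ICst i z => Defs.setI st i z
  | IAdd i j k => Defs.setI st i (I_ j + I_ k)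
  | ISub i j k => Defs.setI st i (I_ j - I_ k)
  | ILd i j => Defs.setI st i (I_ `|I_ j|%N)
  | ISt i j => Defs.setI st `|I_ i|%N (I_ j)
  | IToR a i => setR st a (I_ i)%:~R
  | _ => st
  end.

Lemma straight_stepE prog st i :
  nth Halt prog (pc st) = i -> straight i ->
  step prog st = Some (straight_step st i, 1%N).
Proof. by rewrite /step => ->; case: i. Qed.

Lemma pc_straight_step st i : straight i -> pc (straight_step st i) = (pc st).+1.
Proof. by case: i. Qed.

Lemma runs_straight prog st cs :
  code_at prog (pc st) cs -> all straight cs ->
  runs prog st (foldl straight_step st cs) (size cs).
Proof.
elim: cs st => [|i cs IH] st hc /=; first by move=> _; apply: runs_refl.
move=> /andP[si scs]; rewrite -add1n; apply: (@runs_trans _ _ (straight_step st i)).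
  apply: runs_step; apply: straight_stepE => //.
  by rewrite -[pc st]addn0 (code_at_nth hc).
apply: IH => //; rewrite pc_straight_step //.
by apply: (code_at_catr (c1 := [:: i]) hc); rewrite /= addn1.
Qed.

Lemma pc_foldl_straight cs st :
  all straight cs -> pc (foldl straight_step st cs) = (pc st + size cs)%N.
Proof.
elim: cs st => [|i cs IH] st /=; first by rewrite addn0.
by move=> /andP[si scs]; rewrite IH // pc_straight_step // addSnnS.
Qed.

Lemma runs_straight_at prog a cs st :
  code_at prog a cs -> pc st = a -> all straight cs ->
  exists st', [/\ st' = foldl straight_step st cs,
    runs prog st st' (size cs) & pc st' = (a + size cs)%N].
Proof.
move=> hc e hs; exists (foldl straight_step st cs); split=> //.
  by apply: runs_straight; rewrite ?e.
by rewrite pc_foldl_straight // e.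
Qed.

Lemma runs_jump prog st i j t (a : nat) :
  nth Halt prog a = JILt i j t -> pc st = a ->
  runs prog st (jump st (ireg st i < ireg st j) t) 1.
Proof. by move=> e h; apply: runs_step; rewrite /step h e. Qed.

Lemma runs_jumpR prog st i j t (a : nat) :
  nth Halt prog a = JRLt i j t -> pc st = a ->
  runs prog st (jump st (rreg st i < rreg st j) t) 1.
Proof. by move=> e h; apply: runs_step; rewrite /step h e. Qed.

Lemma runs_jmp prog st t (a : nat) :
  nth Halt prog a = Jmp t -> pc st = a -> runs prog st (jump st true t) 1.
Proof. by move=> e h; apply: runs_step; rewrite /step h e. Qed.

End Machine.

(** * A structured language with unbounded arrays *)

Inductive iexp : Type :=
| EVar of nat | ENat of nat | EAdd of iexp & iexp | ESub of iexp & iexp.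

Inductive rop : Type := OAdd | OSub | OMul | ODiv.

Inductive rexp : Type :=
| XVar of nat | XNat of nat | XArr of nat & iexp | XOfI of iexp
| XOp of rop & rexp & rexp.

(* [SetRoot a k] stores in [a] a real root of the polynomial whose
   coefficients are the first p+1 entries of array [k]. *)
Inductive cmd : Type :=
| Skip
| SetI of nat & iexp
| SetR of nat & rexp
| SetA of nat & iexp & rexp
| SetRoot of nat & nat
| Seq of cmd & cmd
| IfI of iexp & iexp & cmd & cmd
| IfR of rexp & rexp & cmd & cmd
| For of nat & iexp & cmd.

Section Semantics.
Variable R : realType.

(** Integer variables are natural numbers with truncated subtraction, so an address never has a
    sign; the compiled subtraction has to clamp at 0. *)
Record state := State { sc : nat -> R; ar : nat -> nat -> R; iv : nat -> nat }.
Implicit Types s : state.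

Fixpoint evI s e : nat :=
  match e with
  | EVar v => iv s v
  | ENat m => m
  | EAdd e1 e2 => evI s e1 + evI s e2
  | ESub e1 e2 => evI s e1 - evI s e2
  end.

Definition evop (o : rop) (x y : R) : R :=
  match o with OAdd => x + y | OSub => x - y | OMul => x * y | ODiv => x / y end.

Fixpoint evR s e : R :=
  match e with
  | XVar a => sc s a
  | XNat m => m%:R
  | XArr k ie => ar s k (evI s ie)
  | XOfI ie => (evI s ie)%:R
  | XOp o e1 e2 => evop o (evR s e1) (evR s e2)
  end.

Definition set_iv s v m := State (sc s) (ar s) (upd (iv s) v m).
Definition set_sc s a x := State (upd (sc s) a x) (ar s) (iv s).
Definition set_ar s k u x := State (sc s) (upd (ar s) k (upd (ar s k) u x)) (iv s).

(** The default is the constant coefficient because that is what the machine leaves in the first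
    cell of its root buffer when there is no root to write. *)
Definition root_val s k : R :=
  head (ar s k 0) (rootsR (\poly_(m < (iv s 1).+1) ar s k m)).

Fixpoint sem (c : cmd) s : state :=
  match c with
  | Skip => s
  | SetI v e => set_iv s v (evI s e)
  | SetR a e => set_sc s a (evR s e)
  | SetA k ie e => set_ar s k (evI s ie) (evR s e)
  | SetRoot a k => set_sc s a (root_val s k)
  | Seq c1 c2 => sem c2 (sem c1 s)
  | IfI e1 e2 c1 c2 => if (evI s e1 < evI s e2)%N then sem c1 s else sem c2 s
  | IfR e1 e2 c1 c2 => if evR s e1 < evR s e2 then sem c1 s else sem c2 s
  | For v e c1 =>
      iteri (evI s e) (fun t s' => set_iv (sem c1 s') v t.+1) (set_iv s v 0)
  end.

Definition loop_state (v : nat) (c : cmd) s t : state :=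
  iteri t (fun t s' => set_iv (sem c s') v t.+1) (set_iv s v 0).

(** Exact length of the compiled code, which serves both to compute jump targets and to bound the
    time. *)
Fixpoint lenI e : nat :=
  match e with
  | EVar _ => 2
  | ENat _ => 1
  | EAdd e1 e2 => lenI e1 + lenI e2 + 1
  | ESub e1 e2 => lenI e1 + lenI e2 + 4
  end.

Fixpoint lenR e : nat :=
  match e with
  | XVar _ => 2
  | XNat _ => 1
  | XArr _ ie => lenI ie + 8
  | XOfI ie => lenI ie + 1
  | XOp _ e1 e2 => lenR e1 + lenR e2 + 1
  end.

(* An upper bound on the running time: both branches of a conditional count. *)
Fixpoint cost (c : cmd) s : nat :=
  match c with
  | Skip => 0
  | SetI v e => lenI e + 2
  | SetR a e => lenR e + 2
  | SetA k ie e => lenR e + lenI ie + 8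
  | SetRoot a k => 8 * (iv s 1).+1 + (iv s 1).+1 + 20
  | Seq c1 c2 => cost c1 s + cost c2 (sem c1 s)
  | IfI e1 e2 c1 c2 => lenI e1 + lenI e2 + 2 + (cost c1 s + cost c2 s)
  | IfR e1 e2 c1 c2 => lenR e1 + lenR e2 + 2 + (cost c1 s + cost c2 s)
  | For v e c1 =>
      (\sum_(t < evI s e) (cost c1 (loop_state v c1 s t) + (lenI e + 4)))
      + (lenI e + 3)
  end.

(* Static well-formedness: bounded register usage, integer variable 1 (which
   holds p) is read-only, loop counters and bounds are loop invariant. *)

Fixpoint varsI e : seq nat :=
  match e with
  | EVar v => [:: v]
  | ENat _ => [::]
  | EAdd e1 e2 | ESub e1 e2 => varsI e1 ++ varsI e2
  end.

Definition wfI e : bool := all (fun v => v < 20)%N (varsI e).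

(** [d] is the register that receives the value. A right operand is evaluated one register higher,
    so the temporaries 12 to 31 limit the nesting on the right. *)
Fixpoint wfR (d : nat) e : bool :=
  (d < 32)%N &&
  match e with
  | XVar a => (a < 12)%N
  | XNat _ => true
  | XArr k ie => (k < 16)%N && wfI ie
  | XOfI ie => wfI ie
  | XOp _ e1 e2 => wfR d e1 && wfR d.+1 e2
  end.

Fixpoint modI c : seq nat :=
  match c with
  | SetI v _ => [:: v]
  | Seq c1 c2 | IfI _ _ c1 c2 | IfR _ _ c1 c2 => modI c1 ++ modI c2
  | For v _ c => v :: modI c
  | _ => [::]
  end.

Fixpoint modA c : seq nat :=
  match c with
  | SetA k _ _ => [:: k]
  | Seq c1 c2 | IfI _ _ c1 c2 | IfR _ _ c1 c2 => modA c1 ++ modA c2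
  | For _ _ c => modA c
  | _ => [::]
  end.

Fixpoint modS c : seq nat :=
  match c with
  | SetR a _ | SetRoot a _ => [:: a]
  | Seq c1 c2 | IfI _ _ c1 c2 | IfR _ _ c1 c2 => modS c1 ++ modS c2
  | For _ _ c => modS c
  | _ => [::]
  end.

Fixpoint wf c : bool :=
  match c with
  | Skip => true
  | SetI v e => [&& v < 20, v != 1 & wfI e]%N
  | SetR a e => (a < 12)%N && wfR 12 e
  | SetA k ie e => [&& (k < 16)%N, wfI ie & wfR 12 e]
  | SetRoot a k => (a < 12)%N && (k < 16)%N
  | Seq c1 c2 => wf c1 && wf c2
  | IfI e1 e2 c1 c2 => [&& wfI e1, wfI e2, wf c1 & wf c2]
  | IfR e1 e2 c1 c2 => [&& wfR 12 e1, wfR 13 e2, wf c1 & wf c2]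
  | For v e c => [&& v < 20, v != 1, wfI e, wf c, v \notin modI c &
                  all (fun w => w \notin v :: modI c) (varsI e)]%N
  end.

Lemma updE (T : Type) (f : nat -> T) k v m :
  upd f k v m = if m == k then v else f m.
Proof. by []. Qed.

Lemma sem_iv c s v : v \notin modI c -> iv (sem c s) v = iv s v.
Proof.
elim: c s => //=.
- by move=> w e s; rewrite inE updE => /negbTE->.
- by move=> c1 IH1 c2 IH2 s; rewrite mem_cat negb_or => /andP[h1 h2]; rewrite IH2 ?IH1.
- move=> e1 e2 c1 IH1 c2 IH2 s; rewrite mem_cat negb_or => /andP[h1 h2].
  by case: ifP; rewrite ?IH1 ?IH2.
- move=> e1 e2 c1 IH1 c2 IH2 s; rewrite mem_cat negb_or => /andP[h1 h2].
  by case: ifP; rewrite ?IH1 ?IH2.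
- move=> w e c IH s; rewrite inE negb_or => /andP[/negbTE h1 h2].
  elim: (evI s e) => [|t IHt] /=; first by rewrite updE h1.
  by rewrite updE h1 IH.
Qed.

Lemma sem_ar c s k : k \notin modA c -> ar (sem c s) k = ar s k.
Proof.
elim: c s => //=.
- by move=> w ie e s; rewrite inE updE => /negbTE->.
- by move=> c1 IH1 c2 IH2 s; rewrite mem_cat negb_or => /andP[h1 h2]; rewrite IH2 ?IH1.
- move=> e1 e2 c1 IH1 c2 IH2 s; rewrite mem_cat negb_or => /andP[h1 h2].
  by case: ifP; rewrite ?IH1 ?IH2.
- move=> e1 e2 c1 IH1 c2 IH2 s; rewrite mem_cat negb_or => /andP[h1 h2].
  by case: ifP; rewrite ?IH1 ?IH2.
- move=> w e c IH s h2.
  by elim: (evI s e) => [|t IHt] //=; rewrite IH.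
Qed.

Lemma sem_sc c s k : k \notin modS c -> sc (sem c s) k = sc s k.
Proof.
elim: c s => //=.
- by move=> w e s; rewrite inE updE => /negbTE->.
- by move=> a b s; rewrite inE updE => /negbTE->.
- by move=> c1 IH1 c2 IH2 s; rewrite mem_cat negb_or => /andP[h1 h2]; rewrite IH2 ?IH1.
- move=> e1 e2 c1 IH1 c2 IH2 s; rewrite mem_cat negb_or => /andP[h1 h2].
  by case: ifP; rewrite ?IH1 ?IH2.
- move=> e1 e2 c1 IH1 c2 IH2 s; rewrite mem_cat negb_or => /andP[h1 h2].
  by case: ifP; rewrite ?IH1 ?IH2.
- move=> w e c IH s h2.
  by elim: (evI s e) => [|t IHt] //=; rewrite IH.
Qed.

Lemma evI_congr s s' e : {in varsI e, iv s =1 iv s'} -> evI s e = evI s' e.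
Proof.
elim: e => //= [v h|e1 IH1 e2 IH2 h|e1 IH1 e2 IH2 h].
- by apply: h; rewrite inE.
- by rewrite IH1 ?IH2 // => v hv; apply: h; rewrite mem_cat hv ?orbT.
- by rewrite IH1 ?IH2 // => v hv; apply: h; rewrite mem_cat hv ?orbT.
Qed.

Lemma loop_state_iv v c s t w :
  w \notin v :: modI c -> iv (loop_state v c s t) w = iv s w.
Proof.
rewrite inE negb_or => /andP[/negbTE h1 h2]; elim: t => [|t IH] /=.
  by rewrite updE h1.
by rewrite updE h1 sem_iv.
Qed.

Lemma loop_state_ar v c s t k :
  k \notin modA c -> ar (loop_state v c s t) k = ar s k.
Proof. by move=> h; elim: t => [|t IH] //=; rewrite sem_ar. Qed.

Lemma loop_state_sc v c s t k :
  k \notin modS c -> sc (loop_state v c s t) k = sc s k.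
Proof. by move=> h; elim: t => [|t IH] //=; rewrite sem_sc. Qed.

Lemma loop_state_counter v c s t : iv (loop_state v c s t) v = t.
Proof. by case: t => [|t] /=; rewrite updE eqxx. Qed.

(** The compiled loop evaluates its bound anew before each turn, whereas [sem] evaluates it once;
    this reconciles the two. *)
Lemma loop_state_bound v e c s t : wf (For v e c) ->
  evI (loop_state v c s t) e = evI s e.
Proof.
move=> /= /and5P[_ _ _ _ /andP[_ /allP h]].
by apply: evI_congr => w /h; apply: loop_state_iv.
Qed.

(** The loop rule treats value and time together, since the cost of a turn may depend on the
    invariant. Everything the body cannot assign is handed to the step unchanged, so invariants
    mention only what varies. The overhead of a turn is the bound, the test, the increment and the
    jump back. *)
Lemma for_ind v e c s (Inv : nat -> state -> Prop) (B : nat) :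
  Inv 0%N (set_iv s v 0) ->
  (forall t s', (t < evI s e)%N -> iv s' v = t ->
     (forall w, w \notin v :: modI c -> iv s' w = iv s w) ->
     (forall k, k \notin modA c -> ar s' k = ar s k) ->
     (forall k, k \notin modS c -> sc s' k = sc s k) ->
     Inv t s' -> Inv t.+1 (set_iv (sem c s') v t.+1) /\ (cost c s' <= B)%N) ->
  Inv (evI s e) (sem (For v e c) s) /\
  (cost (For v e c) s <= evI s e * (B + (lenI e + 4)) + (lenI e + 3))%N.
Proof.
move=> h0 hS.
have key t : (t <= evI s e)%N -> Inv t (loop_state v c s t).
  elim: t => [//|t IH] ht; have := hS t (loop_state v c s t) ht.
  case.
  - exact: loop_state_counter.
  - by move=> w; apply: loop_state_iv.
  - by move=> k; apply: loop_state_ar.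
  - by move=> k; apply: loop_state_sc.
  - exact: IH (ltnW ht).
  - by [].
split; first exact: key.
rewrite /= leq_add2r -[X in (_ <= X * _)%N]card_ord -sum_nat_const.
apply: leq_sum => t _; rewrite leq_add2r.
have [] := hS t (loop_state v c s t) (ltn_ord t) => //.
- exact: loop_state_counter.
- by move=> w; apply: loop_state_iv.
- by move=> k; apply: loop_state_ar.
- by move=> k; apply: loop_state_sc.
- exact: key (ltnW (ltn_ord t)).
Qed.

End Semantics.

(** * Compilation *)

(* Memory layout: real registers below 12 are the scalar variables, 12..31
   temporaries, and a buffer for root finding starts at 32; entry u of array k
   is register I[20] + 16 u + k.  Integer registers below 20 are the integer
   variables, those above 20 are temporaries. *)

Fixpoint compI (e : iexp) (d a : nat) : seq instr :=
  match e with
  | EVar v => [:: ICst d 0; IAdd d v d]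
  | ENat m => [:: ICst d m%:Z]
  | EAdd e1 e2 =>
      compI e1 d a ++ compI e2 d.+1 (a + lenI e1) ++ [:: IAdd d d d.+1]
  | ESub e1 e2 =>
      compI e1 d a ++ compI e2 d.+1 (a + lenI e1) ++
      [:: ISub d d d.+1; ICst d.+1 0; JILt d.+1 d (a + lenI e1 + lenI e2 + 4);
          ICst d 0]
  end.

(** Integers cannot be multiplied, so the factor 16 is made of four doublings. *)
Definition comp_addr (k : nat) : seq instr :=
  [:: IAdd 21 21 21; IAdd 21 21 21; IAdd 21 21 21; IAdd 21 21 21;
      IAdd 21 21 20; ICst 22 k%:Z; IAdd 21 21 22].

Definition comp_op (o : rop) (d : nat) : instr :=
  match o with
  | OAdd => RAdd d d d.+1 | OSub => RSub d d d.+1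
  | OMul => RMul d d d.+1 | ODiv => RDiv d d d.+1 end.

Fixpoint compR (e : rexp) (d a : nat) : seq instr :=
  match e with
  | XVar b => [:: RCst d 0; RAdd d b d]
  | XNat m => [:: RCst d m%:Z]
  | XArr k ie => compI ie 21 a ++ comp_addr k ++ [:: RLd d 21]
  | XOfI ie => compI ie 21 a ++ [:: IToR d 21]
  | XOp o e1 e2 =>
      compR e1 d a ++ compR e2 d.+1 (a + lenR e1) ++ [:: comp_op o d]
  end.

(** [Roots] wants contiguous coefficients and overwrites both them and its degree register: hence
    the copy of the array, whose entries lie 16 apart, into the buffer at 32, and the copy of p in
    register 27. *)
Definition comp_root (b k a : nat) : seq instr :=
  [:: ICst 21 0%N; ICst 22 k%:Z; IAdd 22 22 20; ICst 23 32%N; ICst 24 1%N;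
      ICst 25 16%N; ICst 26 32%N; IAdd 27 1 21;
      RLd 12 22; RSt 23 12; IAdd 21 21 24; IAdd 22 22 25; IAdd 23 23 24;
      JILt 27 21 (a + 15); Jmp (a + 8); Defs.Roots 27 26; RLd b 26].

(** Jump targets are absolute, so the code depends on its address [a]. The second branch of a
    conditional comes first because a comparison jumps when it succeeds. *)
Fixpoint compile (c : cmd) (a : nat) : seq instr :=
  match c with
  | Skip => [::]
  | SetI v e => compI e 21 a ++ [:: ICst 22 0; IAdd v 21 22]
  | SetR b e => compR e 12 a ++ [:: RCst 13 0; RAdd b 12 13]
  | SetA k ie e =>
      compR e 12 a ++ compI ie 21 (a + lenR e) ++ comp_addr k ++ [:: RSt 21 12]
  | SetRoot b k => comp_root b k a
  | Seq c1 c2 => compile c1 a ++ compile c2 (a + size (compile c1 a))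
  | IfI e1 e2 c1 c2 =>
      let l := (a + lenI e1 + lenI e2)%N in
      let s2 := compile c2 l.+1 in
      let l1 := (l + size s2 + 2)%N in
      let s1 := compile c1 l1 in
      compI e1 21 a ++ compI e2 22 (a + lenI e1) ++ JILt 21 22 l1 :: s2 ++
        Jmp (l1 + size s1) :: s1
  | IfR e1 e2 c1 c2 =>
      let l := (a + lenR e1 + lenR e2)%N in
      let s2 := compile c2 l.+1 in
      let l1 := (l + size s2 + 2)%N in
      let s1 := compile c1 l1 in
      compR e1 12 a ++ compR e2 13 (a + lenR e1) ++ JRLt 12 13 l1 :: s2 ++
        Jmp (l1 + size s1) :: s1
  | For v e c =>
      let l := (a + 1 + lenI e + 2)%N in
      let s := compile c l in
      ICst v 0 :: compI e 21 (a + 1) ++ JILt v 21 l :: Jmp (l + size s + 3) ::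
        s ++ [:: ICst 22 1; IAdd v v 22; Jmp (a + 1)]
  end.

Lemma size_compI e d a : size (compI e d a) = lenI e.
Proof.
by elim: e d a => //= e1 IH1 e2 IH2 d a; rewrite !size_cat /= IH1 IH2 addnA.
Qed.

Lemma size_compR e d a : size (compR e d a) = lenR e.
Proof.
elim: e d a => //= [k ie|ie|o e1 IH1 e2 IH2] d a; rewrite !size_cat /= ?size_compI //.
by rewrite IH1 IH2 addnA.
Qed.

Lemma ltn_le_eqF (v d w : nat) : (v < d)%N -> (d <= w)%N -> (v == w) = false.
Proof. by move=> h1 h2; rewrite ltn_eqF // (leq_trans h1). Qed.

(** * Simulation of the structured language by the machine *)

Section Simulation.
Variables (R : realType) (P base : nat) (prog : seq instr).
Hypothesis base_ge : (32 + P.+1 <= base)%N.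
Implicit Types (st : ram_state R) (s : state R).

(** [base_ge] keeps the P + 1 cells of the root buffer, from 32 on, clear of the arrays. Temporaries
    are left unconstrained. *)
Definition rep st s : Prop :=
  [/\ forall a, (a < 12)%N -> rreg st a = sc s a,
      forall k u, (k < 16)%N -> rreg st (base + 16 * u + k)%N = ar s k u,
      forall v, (v < 20)%N -> ireg st v = (iv s v)%:Z,
      ireg st 20%N = base%:Z
    & iv s 1 = P].

Lemma rep_keep st st' s :
  (forall u, (u < 12)%N || (base <= u)%N -> rreg st' u = rreg st u) ->
  (forall v, (v < 21)%N -> ireg st' v = ireg st v) ->
  rep st s -> rep st' s.
Proof.
move=> hr hi [h1 h2 h3 h4 h5]; split=> //.
- by move=> a ha; rewrite hr ?ha ?h1.
- by move=> k u hk; rewrite hr ?h2 // -addnA leq_addr orbT.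
- by move=> v hv; rewrite hi ?h3 // ltnS ltnW.
- by rewrite hi.
Qed.

Lemma compI_ok e d a st s :
  wfI e -> (20 < d)%N -> rep st s -> code_at prog a (compI e d a) -> pc st = a ->
  exists st', [/\ runs prog st st' (lenI e), pc st' = (a + lenI e)%N,
    rreg st' = rreg st, forall v, (v < d)%N -> ireg st' v = ireg st v
    & ireg st' d = (evI s e)%:Z].
Proof.
elim: e d a st => /= [v|m|e1 IH1 e2 IH2|e1 IH1 e2 IH2] d a st wfe hd hrep hc hpc.
- have [st' [-> h1 h2]] := runs_straight_at hc hpc isT.
  exists (foldl (@straight_step R) st [:: ICst d 0; IAdd d v d]); split=> //=.
    by move=> w hw; rewrite !updE ltn_eqF.
  case: hrep => _ _ h3 _ _; rewrite /wfI /= andbT in wfe.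
  by rewrite !updE eqxx ltn_eqF ?h3 ?addr0 //; apply: leq_trans hd; rewrite ltnS ltnW.
- have [st' [-> h1 h2]] := runs_straight_at hc hpc isT.
  exists (foldl (@straight_step R) st [:: ICst d m%:Z]); split=> //=.
    by move=> w hw; rewrite !updE ltn_eqF.
  by rewrite updE eqxx.
- rewrite /wfI /= all_cat in wfe; case/andP: wfe => w1 w2.
  have [st1 [r1 p1 q1 k1 v1]] := IH1 d a st w1 hd hrep (code_at_catl hc) hpc.
  have hc2 := code_at_catr hc (erefl _); rewrite size_compI in hc2.
  have rep1 : rep st1 s.
    apply: rep_keep hrep => [u _|v hv]; first by rewrite q1.
    by rewrite k1 // (leq_trans hv).
  have [st2 [r2 p2 q2 k2 v2]] := IH2 d.+1 _ st1 w2 (ltnW hd) rep1 (code_at_catl hc2) p1.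
  have hc3 := code_at_catr hc2 (erefl _); rewrite size_compI in hc3.
  have [st' [-> h1 h2]] := runs_straight_at hc3 p2 isT.
  exists (foldl (@straight_step R) st2 [:: IAdd d d d.+1]); split.
  + by apply: runs_trans h1; apply: runs_trans r2.
  + by rewrite h2 /= !addnA.
  + by rewrite /= q2.
  + by move=> w hw /=; rewrite updE ltn_eqF // k2 ?k1 // ltnW.
  + by rewrite /= updE eqxx v2 k2 // v1 PoszD.
- rewrite /wfI /= all_cat in wfe; case/andP: wfe => w1 w2.
  have [st1 [r1 p1 q1 k1 v1]] := IH1 d a st w1 hd hrep (code_at_catl hc) hpc.
  have hc2 := code_at_catr hc (erefl _); rewrite size_compI in hc2.
  have rep1 : rep st1 s.
    apply: rep_keep hrep => [u _|v hv]; first by rewrite q1.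
    by rewrite k1 // (leq_trans hv).
  have [st2 [r2 p2 q2 k2 v2]] := IH2 d.+1 _ st1 w2 (ltnW hd) rep1 (code_at_catl hc2) p1.
  have hc3 := code_at_catr hc2 (erefl _); rewrite size_compI in hc3.
  have hc4 := @code_at_catl prog _ [:: ISub d d d.+1; ICst d.+1 0] [:: _; _] hc3.
  have [st3 [e3 r3 p3]] := runs_straight_at hc4 p2 isT.
  have n3 := @code_at_nth prog _ 2 _ hc3 isT.
  have r4 := runs_jump n3 p3.
  have vd : ireg st3 d = (evI s e1)%:Z - (evI s e2)%:Z.
    by rewrite e3 /= !updE eqxx ltn_eqF // v2 k2 // v1.
  have vd1 : ireg st3 d.+1 = 0 by rewrite e3 /= !updE eqxx.
  have vlt w : (w < d)%N -> ireg st3 w = ireg st w.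
    move=> hw; rewrite e3 /= !updE !ltn_eqF ?k2 ?k1 //; exact: ltnW.
  have q3 : rreg st3 = rreg st by rewrite e3 /= q2.
  move: r4; rewrite vd vd1; case cmp: (0 < _); set st4 := (X in runs _ _ X _) => r4.
    exists st4; split=> //.
    + apply: runs_le (runs_trans r1 (runs_trans r2 (runs_trans r3 r4))).
      by rewrite /= -!addnA !leq_add2l.
    + by rewrite /st4 /= !addnA.
    + rewrite /st4 /= vd; lia.
  have hc5 := @code_at_catr prog _ _ [:: _; _; _] [:: _] hc3 (erefl _).
  have p4 : pc st4 = (a + lenI e1 + lenI e2 + 3)%N by rewrite /st4 /= p3 /=; lia.
  have [st' [-> h1 h2]] := runs_straight_at hc5 p4 isT.
  exists (foldl (@straight_step R) st4 [:: ICst d 0]); split=> //.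
  + apply: runs_le (runs_trans r1 (runs_trans r2 (runs_trans r3 (runs_trans r4 h1)))).
    by rewrite /= -!addnA.
  + by rewrite h2 /= -!addnA.
  + by move=> w hw; rewrite /= updE ltn_eqF // vlt.
  + rewrite /= updE eqxx; lia.
Qed.

Lemma comp_addr_ok k u a st :
  ireg st 21 = u%:Z -> ireg st 20 = base%:Z -> code_at prog a (comp_addr k) ->
  pc st = a ->
  exists st', [/\ runs prog st st' 7, pc st' = (a + 7)%N,
    rreg st' = rreg st, forall v, (v < 21)%N -> ireg st' v = ireg st v
    & ireg st' 21 = (base + 16 * u + k)%N].
Proof.
move=> hu hb hc hpc; have [st' [-> h1 h2]] := runs_straight_at hc hpc isT.
exists (foldl (@straight_step R) st (comp_addr k)); rewrite /comp_addr; split=> //=.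
  by move=> v hv; rewrite !updE !(ltn_le_eqF hv).
by rewrite !updE /= hu hb; lia.
Qed.

Lemma compR_ok e d a st s :
  (12 <= d)%N -> wfR d e -> rep st s -> code_at prog a (compR e d a) -> pc st = a ->
  exists st', [/\ runs prog st st' (lenR e), pc st' = (a + lenR e)%N,
    forall u, (u < d)%N || (32 <= u)%N -> rreg st' u = rreg st u,
    forall v, (v < 21)%N -> ireg st' v = ireg st v
    & rreg st' d = evR s e].
Proof.
have upd_keep d0 u (f : nat -> R) x : (d0 < 32)%N -> (u < d0)%N || (32 <= u)%N -> upd f d0 x u = f u.
  by rewrite updE => h1 h2; case: eqP => // ?; lia.
elim: e d a st => [b|m|k ie|ie|o e1 IH1 e2 IH2] d a st hd /= /andP[d32 wfe] hrep hc hpc.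
- have [st' [-> h1 h2]] := runs_straight_at hc hpc isT.
  exists (foldl (@straight_step R) st [:: RCst d 0; RAdd d b d]); split=> //=.
    by move=> w hw; rewrite !upd_keep.
  case: hrep => h3 _ _ _ _; have bd : (b < d)%N by apply: leq_trans hd.
  by rewrite updE eqxx upd_keep ?bd // updE eqxx addr0 h3.
- have [st' [-> h1 h2]] := runs_straight_at hc hpc isT.
  exists (foldl (@straight_step R) st [:: RCst d m%:Z]); split=> //=.
    by move=> w hw; rewrite upd_keep.
  by rewrite updE eqxx.
- case/andP: wfe => hk wi.
  have [st1 [r1 p1 q1 k1 v1]] := compI_ok wi (isT : 20 < 21)%N hrep (code_at_catl hc) hpc.
  have hc2 := code_at_catr hc (erefl _); rewrite size_compI in hc2.
  have b1 : ireg st1 20 = base%:Z by case: hrep => ? ? ? ? ?; rewrite k1.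
  have [st2 [r2 p2 q2 k2 v2]] := comp_addr_ok v1 b1 (@code_at_catl _ _ (comp_addr k) _ hc2) p1.
  have hc3 := @code_at_catr _ _ _ (comp_addr k) _ hc2 (erefl _).
  have [st' [-> h1 h2]] := runs_straight_at hc3 p2 isT.
  exists (foldl (@straight_step R) st2 [:: RLd d 21]); split=> //.
  + apply: runs_le (runs_trans r1 (runs_trans r2 h1)); rewrite /=; lia.
  + by rewrite h2 /=; lia.
  + by move=> u hu /=; rewrite upd_keep // q2 q1.
  + by move=> v hv /=; rewrite k2 ?k1.
  + rewrite /= updE eqxx v2 q2 q1 absz_nat.
    by case: hrep => _ -> .
- have [st1 [r1 p1 q1 k1 v1]] := compI_ok wfe (isT : 20 < 21)%N hrep (code_at_catl hc) hpc.
  have hc2 := code_at_catr hc (erefl _); rewrite size_compI in hc2.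
  have [st' [-> h1 h2]] := runs_straight_at hc2 p1 isT.
  exists (foldl (@straight_step R) st1 [:: IToR d 21]); split=> //.
  + exact: runs_trans h1.
  + by rewrite h2 /=; lia.
  + by move=> u hu /=; rewrite upd_keep // q1.
  + by rewrite /= updE eqxx v1.
- case/andP: wfe => w1 w2.
  have [st1 [r1 p1 q1 k1 v1]] := IH1 d a st hd w1 hrep (code_at_catl hc) hpc.
  have hc2 := code_at_catr hc (erefl _); rewrite size_compR in hc2.
  have rep1 : rep st1 s.
    apply: rep_keep hrep => [u hu|v hv]; last by rewrite k1.
    by apply: q1; move: hu base_ge; lia.
  have [st2 [r2 p2 q2 k2 v2]] :=
    IH2 d.+1 _ st1 (leqW hd) w2 rep1 (code_at_catl hc2) p1.
  have hc3 := code_at_catr hc2 (erefl _); rewrite size_compR in hc3.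
  have so : all straight [:: comp_op o d] by case: (o).
  have [st' [-> h1 h2]] := runs_straight_at hc3 p2 so.
  exists (foldl (@straight_step R) st2 [:: comp_op o d]).
  have e2d : rreg st2 d = evR s e1 by rewrite q2 ?ltnSn.
  have -> : foldl (@straight_step R) st2 [:: comp_op o d] =
    setR st2 d (evop o (evR s e1) (evR s e2)).
    by rewrite -e2d -v2; case: (o).
  split.
  + rewrite (_ : setR _ _ _ = foldl (@straight_step R) st2 [:: comp_op o d]).
      by apply: runs_trans h1; apply: runs_trans r2.
    by rewrite -e2d -v2; case: (o).
  + by rewrite /= p2 !addnA addn1.
  + move=> u hu /=; rewrite upd_keep // q2 ?q1 //; move: hu; lia.
  + by move=> v hv /=; rewrite k2 ?k1.
  + by rewrite /= updE eqxx.
Qed.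

Lemma keep_rep_compI st st' s :
  rreg st' = rreg st -> (forall v, (v < 21)%N -> ireg st' v = ireg st v) ->
  rep st s -> rep st' s.
Proof. by move=> e h; apply: rep_keep => // u _; rewrite e. Qed.

Lemma keep_rep_compR d st st' s : (12 <= d)%N ->
  (forall u, (u < d)%N || (32 <= u)%N -> rreg st' u = rreg st u) ->
  (forall v, (v < 21)%N -> ireg st' v = ireg st v) ->
  rep st s -> rep st' s.
Proof.
by move=> hd e h; apply: rep_keep => // u hu; apply: e; move: hu base_ge; lia.
Qed.

Lemma rep_set_iv st st' s v m :
  v != 1%N -> (v < 20)%N -> rep st s -> rreg st' = rreg st ->
  (forall w, (w < 21)%N -> w != v -> ireg st' w = ireg st w) ->
  ireg st' v = m%:Z -> rep st' (set_iv s v m).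
Proof.
move=> v1 hv [h1 h2 h3 h4 h5] er ei em; split=> //=.
- by move=> a; rewrite er; apply: h1.
- by move=> k u; rewrite er; apply: h2.
- move=> w hw; rewrite updE; case: eqP => [->|/eqP ne] //.
  by rewrite ei ?h3 // ltnS ltnW.
- by rewrite ei // neq_ltn hv orbT.
- by rewrite updE eq_sym (negbTE v1).
Qed.

Lemma rep_set_sc st st' s a x :
  (a < 12)%N -> rep st s ->
  (forall u, (u < 12)%N || (base <= u)%N -> u != a -> rreg st' u = rreg st u) ->
  (forall w, (w < 21)%N -> ireg st' w = ireg st w) ->
  rreg st' a = x -> rep st' (set_sc s a x).
Proof.
move=> ha [h1 h2 h3 h4 h5] er ei ex; split=> //=.
- move=> b hb; rewrite updE; case: eqP => [->|/eqP ne] //.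
  by rewrite er ?hb ?h1.
- move=> k u hk; rewrite er ?h2 //; move: base_ge; first lia.
  by move=> ?; apply/eqP; lia.
- by move=> w hw; rewrite ei ?h3 // ltnS ltnW.
- by rewrite ei.
Qed.

Lemma comp_root_ok b k a st s :
  (b < 12)%N -> (k < 16)%N -> rep st s -> code_at prog a (comp_root b k a) ->
  pc st = a ->
  exists st', [/\ runs prog st st' (cost (SetRoot b k) s),
    pc st' = (a + size (comp_root b k a))%N & rep st' (set_sc s b (root_val s k))].
Proof.
move=> hb hk hrep hc hpc; have [R1 R2 R3 R4 R5] := hrep.
have hc0 := @code_at_catl prog _ [:: _; _; _; _; _; _; _; _]
              [:: _; _; _; _; _; _; _; _; _] hc.
have [st0 [e0 r0 p0]] := runs_straight_at hc0 hpc isT.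
have hcl := @code_at_catr prog _ _ [:: _; _; _; _; _; _; _; _]
              [:: _; _; _; _; _; _; _; _; _] hc (erefl _).
have hcl5 := @code_at_catl prog _ [:: _; _; _; _; _] [:: _; _; _; _] hcl.
(* Invariant of the copying loop once m coefficients are in the buffer: the source address advances
   by 16, the destination by 1. *)
pose J m (x : ram_state R) :=
  [/\ ireg x 21 = m%:Z, ireg x 22 = (base + 16 * m + k)%N%:Z, ireg x 23 = (32 + m)%N%:Z,
      ireg x 24 = 1%N & ireg x 25 = 16%N /\ ireg x 26 = 32%N /\ ireg x 27 = P%:Z] /\
  [/\ forall u, (u < 12)%N || (base <= u)%N -> rreg x u = rreg st u,
      forall v, (v < 21)%N -> ireg x v = ireg st v
    & forall i, (i < m)%N -> rreg x (32 + i)%N = ar s k i].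
have J0 : J 0%N st0.
  rewrite e0; split; split=> //=; rewrite ?updE /= ?R4 ?R3 ?R5 ?addr0 ?muln0 ?addn0 //.
    by lia.
  by move=> v hv; rewrite !updE !(ltn_le_eqF hv).
have once m x : (m <= P)%N -> J m x -> pc x = (a + 8)%N ->
    exists y, [/\ runs prog x y 7, J m.+1 y
      & pc y = if (P < m.+1)%N then (a + 15)%N else (a + 8)%N].
  move=> mP Jx px; have [y [ey ry py]] := runs_straight_at hcl5 px isT.
  have Jy : J m.+1 y.
    case: Jx => -[i1 i2 i3 i4 [i5 [i6 i7]]] [kr ki kb]; rewrite ey; split; split;
      rewrite /= ?updE /= ?i1 ?i2 ?i3 ?i4 ?i5 ?i6 ?i7 //; try by lia.
    - move=> u hu; rewrite ?updE ?absz_nat; case: eqP => [?|_].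
        by exfalso; move: hu base_ge; lia.
      by case: eqP => [?|_]; [exfalso; move: hu base_ge; lia|rewrite kr].
    - by move=> v hv; rewrite !updE !(ltn_le_eqF hv) // ki.
    - move=> i hi; rewrite ?updE ?absz_nat ?eqxx; case: eqP => [?|ne].
        have -> : i = m by lia.
        by rewrite kr ?R2 // -addnA leq_addr orbT.
      have -> : (32 + i == 12)%N = false by apply/eqP; lia.
      by apply: kb; lia.
  have rj := runs_jump (@code_at_nth prog _ 5 _ hcl isT) py.
  case: (Jy) => -[j1 _ _ _ [_ [_ j7]]] _; move: rj; rewrite j1 j7 ltz_nat.
  case: ifP => _ rj; first by exists (jump y true (a + 15)); split=> //;
    apply: runs_le (runs_trans ry rj).
  have p6 : pc (jump y false (a + 15)) = (a + 8 + 6)%N by rewrite /= py /=; lia.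
  have rj2 := runs_jmp (@code_at_nth prog _ 6 _ hcl isT) p6.
  by exists (jump y true (a + 8)); split=> //; apply: runs_le (runs_trans ry (runs_trans rj rj2)).
have loop n : forall m x, (m + n = P)%N -> J m x -> pc x = (a + 8)%N ->
    exists y, [/\ runs prog x y (7 * n.+1), pc y = (a + 15)%N & J P.+1 y].
  elim: n => [|n IH] m x mn Jx px.
    have [|y [ry Jy py]] := once m x _ Jx px; first lia.
    exists y; split=> //; last by rewrite (_ : P.+1 = m.+1) //; lia.
    by rewrite py ifT //; lia.
  have [|y [ry Jy py]] := once m x _ Jx px; first lia.
  have [||w [rw pw Jw]] := IH m.+1 y _ Jy; first lia.
    by rewrite py ifF //; lia.
  by exists w; split=> //; apply: runs_le (runs_trans ry rw); lia.
have [y [ry py Jy]] := loop P 0%N st0 (add0n _) J0 p0.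
case: Jy => -[i1 i2 i3 i4 [i5 [i6 i7]]] [kr ki kb].
have n15 := @code_at_nth prog _ 15 _ hc isT.
pose z := roots_step y 27 26.
have rz : runs prog y z P.+1.
  by apply: runs_step; rewrite /step py n15 /= i7.
have Pz : pc z = (a + 16)%N by rewrite /z /= py; lia.
have hce := @code_at_catr prog _ _ [:: _; _; _; _; _; _; _; _; _; _; _; _; _; _; _; _]
              [:: _] hc (erefl _).
have [w [ew rw pw]] := runs_straight_at hce Pz isT.
exists w; split=> //.
- apply: runs_le (runs_trans r0 (runs_trans ry (runs_trans rz rw))).
  by rewrite /= R5; lia.
- by rewrite pw /=; lia.
have polyE : \poly_(m < P.+1) rreg y (32 + m) = \poly_(m < P.+1) ar s k m.
  by apply/polyP => i; rewrite !coef_poly; case: ltnP => // /kb.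
(* A nonzero polynomial with P + 1 coefficients has at most P roots, so writing them back stays
   inside the buffer. *)
have szr : (size (rootsR (\poly_(m < P.+1) ar s k m)) <= P)%N.
  set p := \poly_(_ < _) _; have [->|p0'] := eqVneq p 0; first by rewrite rootsR0.
  have /roots_on_rootsR ro := p0'.
  rewrite -ltnS; apply: leq_trans (size_poly P.+1 (ar s k)).
  apply: max_poly_roots => //; last by rewrite uniq_roots.
  by apply/allP => x; rewrite -ro => /andP[].
rewrite ew; apply: (rep_set_sc (st := y)) => //.
- apply: rep_keep hrep; first exact: kr.
  exact: ki.
- move=> u hu ua; rewrite /z /= updE (negbTE ua) i6 i7 !absz_nat polyE.
  rewrite ifF //; apply/negbTE/negP => /andP[]; move: hu base_ge szr.
  by move: (size (rootsR _)) => ?; lia.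
- by move=> v hv; rewrite /z /= updE (ltn_le_eqF hv).
- have -> : rreg (foldl (@straight_step R) z [:: RLd b 26]) b = rreg z `|ireg y 26|%N.
    by rewrite /= updE eqxx.
  rewrite i6 absz_nat /z /= i6 i7 !absz_nat polyE /root_val R5.
  case: (rootsR _) => [|r rs]; last first.
    have -> : (32 <= 32 < 32 + size (r :: rs))%N = true by rewrite /= addnS ltnS leq_addr.
    by rewrite subnn.
  have -> : (32 <= 32 < 32 + size ([::] : seq R))%N = false by rewrite addn0 ltnn andbF.
  by rewrite -[X in rreg y X]addn0 (kb 0%N).
Qed.

(** Compiler correctness with time, by induction on the command. A loop is simulated turn by turn
    through the states [loop_state]; in a conditional the branch not taken is slack in [cost]. *)
Lemma comp_ok c a st s :
  wf c -> rep st s -> code_at prog a (compile c a) -> pc st = a ->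
  exists st', [/\ runs prog st st' (cost c s), pc st' = (a + size (compile c a))%N
    & rep st' (sem c s)].
Proof.
elim: c a st s.
- move=> a st s _ hrep _ hpc; exists st; split=> //; first exact: runs_refl.
  by rewrite addn0.
- move=> v e a st s /= /and3P[hv v1 we] hrep hc hpc.
  have [st1 [r1 p1 q1 k1 v1']] := compI_ok we (isT : 20 < 21)%N hrep (code_at_catl hc) hpc.
  have hc2 := code_at_catr hc (erefl _); rewrite size_compI in hc2.
  have [st' [-> h1 h2]] := runs_straight_at hc2 p1 isT.
  eexists; split; [exact: runs_trans h1 | by rewrite h2 size_cat size_compI addnA|].
  apply: rep_set_iv hrep _ _ _ => //=.
    move=> w hw ne; rewrite !updE (negbTE ne) ltn_eqF ?k1 //; exact: ltnW.
  by rewrite updE eqxx !updE /= v1' addr0.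
- move=> v e a st s /= /andP[hv we] hrep hc hpc.
  have [st1 [r1 p1 q1 k1 v1']] :=
    compR_ok (isT : 12 <= 12)%N we hrep (code_at_catl hc) hpc.
  have hc2 := code_at_catr hc (erefl _); rewrite size_compR in hc2.
  have [st' [-> h1 h2]] := runs_straight_at hc2 p1 isT.
  eexists; split; [exact: runs_trans h1 | by rewrite h2 size_cat size_compR addnA|].
  apply: rep_set_sc hrep _ _ _ => //=.
    move=> u hu ne; rewrite !updE (negbTE ne) ifN.
      by rewrite q1 //; move: hu base_ge; lia.
    by apply/eqP; move: hu base_ge; lia.
  by rewrite updE eqxx !updE /= v1' addr0.
- move=> k ie e a st s /= /and3P[hk wi we] hrep hc hpc.
  have [st1 [r1 p1 q1 k1 v1]] :=
    compR_ok (isT : 12 <= 12)%N we hrep (code_at_catl hc) hpc.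
  have hc2 := code_at_catr hc (erefl _); rewrite size_compR in hc2.
  have rep1 := keep_rep_compR (isT : 12 <= 12)%N q1 k1 hrep.
  have [st2 [r2 p2 q2 k2 v2]] := compI_ok wi (isT : 20 < 21)%N rep1 (code_at_catl hc2) p1.
  have rep2 := keep_rep_compI q2 k2 rep1.
  have hc3 := code_at_catr hc2 (erefl _); rewrite size_compI in hc3.
  have b2 : ireg st2 20 = base%:Z by case: rep2.
  have [st3 [r3 p3 q3 k3 v3]] := comp_addr_ok v2 b2 (@code_at_catl _ _ (comp_addr k) _ hc3) p2.
  have [R1 R2 R3 R4 R5] := keep_rep_compI q3 k3 rep2.
  have hc4 := @code_at_catr _ _ _ (comp_addr k) _ hc3 (erefl _).
  have [st' [-> h1 h2]] := runs_straight_at hc4 p3 isT.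
  eexists; split.
  + apply: runs_le (runs_trans r1 (runs_trans r2 (runs_trans r3 h1))); rewrite /=; lia.
  + by rewrite h2 !size_cat size_compI size_compR /= !addnA; lia.
  split=> //=.
  + move=> b hb; rewrite updE v3 absz_nat ifN ?R1 //.
    by apply/eqP; move: base_ge; lia.
  + move=> k' u hk'; rewrite v3 absz_nat !updE.
    case: eqP => [e1|ne1]; last first.
      rewrite R2 //; case: eqP => // ?; subst k'; rewrite updE.
      by case: eqP => // ?; subst u.
    have -> : k' = k by lia.
    have -> : u = evI s ie by lia.
    by rewrite eqxx updE eqxx q3 q2 v1.
- move=> b k a st s /= /andP[hb hk]; exact: comp_root_ok.
- move=> c1 IH1 c2 IH2 a st s /= /andP[w1 w2] hrep hc hpc.
  have [st1 [r1 p1 rep1]] := IH1 _ _ _ w1 hrep (code_at_catl hc) hpc.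
  have hc2 := code_at_catr hc (erefl _).
  have [st2 [r2 p2 rep2]] := IH2 _ _ _ w2 rep1 hc2 p1.
  exists st2; split=> //; first exact: runs_trans r2.
  by rewrite p2 size_cat addnA.
- move=> e1 e2 c1 IH1 c2 IH2 a st s /= /and4P[we1 we2 w1 w2] hrep hc hpc.
  have [st1 [r1 p1 q1 k1 v1]] := compI_ok we1 (isT : 20 < 21)%N hrep (code_at_catl hc) hpc.
  have rep1 := keep_rep_compI q1 k1 hrep.
  have hc2 := code_at_catr hc (erefl _); rewrite size_compI in hc2.
  have [st2 [r2 p2 q2 k2 v2]] := compI_ok we2 (isT : 20 < 22)%N rep1 (code_at_catl hc2) p1.
  have rep2 : rep st2 s.
    by apply: keep_rep_compI rep1 => // v hv; apply: k2; apply: ltnW.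
  have hc3 := code_at_catr hc2 (erefl _); rewrite size_compI in hc3.
  have r3 := runs_jump (etrans (f_equal _ (esym (addn0 _))) (@code_at_nth prog _ 0 _ hc3 isT)) p2.
  move: r3; rewrite v2 k2 // v1 ltz_nat; case cmp: (evI s e1 < evI s e2)%N => r3.
    have hc4 := @code_at_catr prog _ _ [:: _] _ hc3 (erefl _).
    have hc5 := code_at_catr hc4 (erefl _).
    have hc6 := @code_at_catr prog _ _ [:: _] _ hc5 (erefl _).
    rewrite /= in hc6.
    have [||st4 [r4 p4 rep4]] := IH1 _ (jump st2 true (a + lenI e1 + lenI e2 + size (compile c2 (a + lenI e1 + lenI e2).+1) + 2)) s w1 _ _ (erefl _).
    + exact: keep_rep_compI rep2.
    + move: hc6; rewrite (_ : (_ + 1)%N = (a + lenI e1 + lenI e2 +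
        size (compile c2 (a + lenI e1 + lenI e2).+1) + 2)%N) //; lia.
    exists st4; split=> //.
    + apply: runs_le (runs_trans r1 (runs_trans r2 (runs_trans r3 r4))); lia.
    + by rewrite p4 !size_cat !size_compI /= !size_cat /=; lia.
  have hc4 := @code_at_catr prog _ _ [:: _] _ hc3 (erefl _).
  rewrite addn1 in hc4.
  have [||st4 [r4 p4 rep4]] := IH2 _ (jump st2 false (a + lenI e1 + lenI e2 + size (compile c2 (a + lenI e1 + lenI e2).+1) + 2)) s w2 _ (code_at_catl hc4) _.
  + exact: keep_rep_compI rep2.
  + by rewrite /= p2.
  have hc5 := code_at_catr hc4 (erefl _).
  have r5 := runs_jmp (etrans (f_equal _ (esym (addn0 _))) (@code_at_nth prog _ 0 _ hc5 isT)) p4.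
  eexists; split.
  + apply: runs_le (runs_trans r1 (runs_trans r2 (runs_trans r3 (runs_trans r4 r5)))); lia.
  + by rewrite /= !size_cat !size_compI /= !size_cat /=; lia.
  + exact: keep_rep_compI rep4.
- move=> e1 e2 c1 IH1 c2 IH2 a st s /= /and4P[we1 we2 w1 w2] hrep hc hpc.
  have [st1 [r1 p1 q1 k1 v1]] := compR_ok (isT : 12 <= 12)%N we1 hrep (code_at_catl hc) hpc.
  have rep1 := keep_rep_compR (isT : 12 <= 12)%N q1 k1 hrep.
  have hc2 := code_at_catr hc (erefl _); rewrite size_compR in hc2.
  have [st2 [r2 p2 q2 k2 v2]] := compR_ok (isT : 12 <= 13)%N we2 rep1 (code_at_catl hc2) p1.
  have rep2 := keep_rep_compR (isT : 12 <= 13)%N q2 k2 rep1.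
  have hc3 := code_at_catr hc2 (erefl _); rewrite size_compR in hc3.
  have r3 := runs_jumpR (etrans (f_equal _ (esym (addn0 _))) (@code_at_nth prog _ 0 _ hc3 isT)) p2.
  move: r3; rewrite v2 q2 // v1; case cmp: (evR s e1 < evR s e2) => r3.
    have hc4 := @code_at_catr prog _ _ [:: _] _ hc3 (erefl _).
    have hc5 := code_at_catr hc4 (erefl _).
    have hc6 := @code_at_catr prog _ _ [:: _] _ hc5 (erefl _).
    rewrite /= in hc6.
    have [||st4 [r4 p4 rep4]] := IH1 _ (jump st2 true (a + lenR e1 + lenR e2 + size (compile c2 (a + lenR e1 + lenR e2).+1) + 2)) s w1 _ _ (erefl _).
    + exact: keep_rep_compI rep2.
    + move: hc6; rewrite (_ : (_ + 1)%N = (a + lenR e1 + lenR e2 +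
        size (compile c2 (a + lenR e1 + lenR e2).+1) + 2)%N) //; lia.
    exists st4; split=> //.
    + apply: runs_le (runs_trans r1 (runs_trans r2 (runs_trans r3 r4))); lia.
    + by rewrite p4 !size_cat !size_compR /= !size_cat /=; lia.
  have hc4 := @code_at_catr prog _ _ [:: _] _ hc3 (erefl _).
  rewrite addn1 in hc4.
  have [||st4 [r4 p4 rep4]] := IH2 _ (jump st2 false (a + lenR e1 + lenR e2 + size (compile c2 (a + lenR e1 + lenR e2).+1) + 2)) s w2 _ (code_at_catl hc4) _.
  + exact: keep_rep_compI rep2.
  + by rewrite /= p2.
  have hc5 := code_at_catr hc4 (erefl _).
  have r5 := runs_jmp (etrans (f_equal _ (esym (addn0 _))) (@code_at_nth prog _ 0 _ hc5 isT)) p4.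
  eexists; split.
  + apply: runs_le (runs_trans r1 (runs_trans r2 (runs_trans r3 (runs_trans r4 r5)))); lia.
  + by rewrite /= !size_cat !size_compR /= !size_cat /=; lia.
  + exact: keep_rep_compI rep4.
- move=> v e c IH a st s wfc hrep hc hpc.
  have bnd t := loop_state_bound s t wfc.
  move: (wfc) => /= /and5P[hv v1 we wc _].
  have [st0 [e0 r0 p0]] := runs_straight_at (@code_at_catl prog _ [:: _] _ hc) hpc isT.
  have rep0 : rep st0 (loop_state v c s 0).
    rewrite e0; apply: rep_set_iv hrep _ _ _ => //=; last by rewrite updE eqxx.
    by move=> w _ ne; rewrite updE (negbTE ne).
  have hc1 := @code_at_catr prog _ _ [:: _] _ hc (erefl _).
  have hc1a := code_at_catl hc1.
  have hc2 := code_at_catr hc1 (erefl _); rewrite size_compI in hc2.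
  have hc3 := @code_at_catr prog _ _ [:: _; _] _ hc2 (erefl _).
  have hc4 := code_at_catl hc3.
  have hc5 := code_at_catr hc3 (erefl _).
  have test t x : rep x (loop_state v c s t) -> pc x = (a + 1)%N ->
    exists y, [/\ runs prog x y (lenI e + 1), rep y (loop_state v c s t) &
      pc y = if (t < evI s e)%N then (a + 1 + lenI e + 2)%N else (a + 1 + lenI e + 1)%N].
    move=> hx px.
    have [y [ry py qy ky vy]] := compI_ok we (isT : 20 < 21)%N hx hc1a px.
    have repy := keep_rep_compI qy ky hx.
    have rj := runs_jump (etrans (f_equal _ (esym (addn0 _))) (@code_at_nth prog _ 0 _ hc2 isT)) py.
    have vv : ireg y v = t%:Z by case: repy => _ _ h3 _ _; rewrite h3 ?loop_state_counter.
    rewrite vv vy bnd ltz_nat in rj.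
    eexists; split; first exact: runs_trans ry rj.
      exact: keep_rep_compI repy.
    by rewrite /=; case: ifP => //; rewrite py addn1.
  have loop t : (t <= evI s e)%N ->
    exists x, [/\ runs prog st x (1 + \sum_(i < t) (cost c (loop_state v c s i) + (lenI e + 4))),
       rep x (loop_state v c s t) & pc x = (a + 1)%N].
    elim: t => [|t IHt] ht; first by exists st0; split=> //; rewrite big_ord0 addn0.
    have [x [rx hx px]] := IHt (ltnW ht).
    have [y [ry hy]] := test t x hx px; rewrite ht => py.
    have [z [rz pz hz]] := IH _ _ _ wc hy hc4 py.
    have hc5a := @code_at_catl prog _ [:: _; _] [:: _] hc5.
    have [w [ew rw pw]] := runs_straight_at hc5a pz isT.
    have rj := runs_jmp (@code_at_nth prog _ 2 _ hc5 isT) pw.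
    exists (jump w true (a + 1)); split=> //.
      rewrite big_ord_recr /= addnA.
      apply: runs_le (runs_trans rx (runs_trans ry (runs_trans rz (runs_trans rw rj)))).
      by rewrite /=; lia.
    have iz : ireg z v = t%:Z.
      case: hz => _ _ h3 _ _; rewrite h3 //; congr (_%:Z).
      by rewrite sem_iv ?loop_state_counter //; case/and5P: wfc => _ _ _ _ /andP[].
    rewrite ew; apply: rep_set_iv hz _ _ _ => //=.
      move=> u hu ne; rewrite !updE (negbTE ne) ltn_eqF //; exact: ltnW.
    by rewrite updE eqxx !updE /= ltn_eqF ?iz; lia.
  have sz : size (compile (For v e c) a) = (lenI e + size (compile c (a + 1 + lenI e + 2)) + 6)%N.
    have aux (i p q : instr) (w1 w2 w3 : seq instr) :
      size (i :: w1 ++ p :: q :: w2 ++ w3) = (size w1 + size w2 + (size w3 + 3))%N.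
      by rewrite /= size_cat /= size_cat; lia.
    by apply: etrans (aux _ _ _ _ _ _) _; rewrite size_compI.
  have [x [rx hx px]] := loop _ (leqnn _).
  have [y [ry hy]] := test _ x hx px; rewrite ltnn => py.
  have rj := runs_jmp (@code_at_nth prog _ 1 _ hc2 isT) py.
  eexists; split.
  + apply: runs_le (runs_trans rx (runs_trans ry rj)); rewrite /=; lia.
  + transitivity (a + (lenI e + size (compile c (a + 1 + lenI e + 2)) + 6))%N.
      transitivity (a + 1 + lenI e + 2 + size (compile c (a + 1 + lenI e + 2)) + 3)%N => //.
      by lia.
    exact: congr1 (esym sz).
  + exact: keep_rep_compI hy.
Qed.

End Simulation.

(* Moves the input to array 0; register 0 serves as scratch, which is harmless
   because its own content is copied first. *)
Definition prelude : seq instr :=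
  [:: ICst 21 33%N; IAdd 20 0 0; IAdd 20 20 1; IAdd 20 20 21; IAdd 21 0 0;
      ICst 22 0%N; ICst 23 0%N; IAdd 23 20 23; ICst 24 1%N; ICst 25 16%N;
      RLd 0 22; RSt 23 0; IAdd 22 22 24; IAdd 23 23 25; JILt 22 21 10].

Definition program (c : cmd) : seq instr := prelude ++ compile c 15 ++ [:: Halt].

(** The base clears both the 2 n input registers, so that no cell is overwritten by a stored entry
    before it is read, and the root buffer, which ends at 32 + p. *)
Lemma prelude_ok (R : realType) (prog : seq instr) (p n : nat) (xs ys : seq R) :
  (0 < n)%N -> size xs = n -> code_at prog 0 prelude ->
  exists (st : ram_state R) (s : state R),
   [/\ runs prog (necklace_init p xs ys) st (10 + 5 * n.*2), pc st = 15%N,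
      rep p (n.*2 + p + 33) st s, iv s 0 = n
    & forall u, (u < n.*2)%N -> ar s 0 u = if (u < n)%N then nth 0 xs u else nth 0 ys (u - n)].
Proof.
move=> n0 sx hc; set init := necklace_init p xs ys; set base := (n.*2 + p + 33)%N.
have hc0 := @code_at_catl prog _ [:: _; _; _; _; _; _; _; _; _; _]
              [:: _; _; _; _; _] hc.
have [st0 [e0 r0 p0]] := runs_straight_at hc0 (erefl (pc init)) isT.
have hcl := @code_at_catr prog _ _ [:: _; _; _; _; _; _; _; _; _; _]
              [:: _; _; _; _; _] hc (erefl _).
have hcl4 := @code_at_catl prog _ [:: _; _; _; _] [:: _] hcl.
(* Register 0 is trusted only while m = 0, since the first turn turns it into scratch. *)
pose J m (x : ram_state R) :=
  [/\ ireg x 21 = n.*2%:Z, ireg x 22 = m%:Z, ireg x 23 = (base + 16 * m)%N%:Z,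
      ireg x 24 = 1%N & ireg x 25 = 16%N /\ ireg x 20 = base%:Z] /\
  [/\ forall u, (0 < u)%N || (m == 0)%N -> (u < n.*2)%N -> rreg x u = rreg init u,
      forall v, (v < 20)%N -> ireg x v = ireg init v
    & forall i, (i < m)%N -> rreg x (base + 16 * i)%N = rreg init i].
have J0 : J 0%N st0.
  rewrite e0 /J; split; split; rewrite /= ?updE /= ?sx ?muln0 ?addn0 ?addr0 //.
  - by rewrite -addnn.
  - by rewrite /base; lia.
  - by split=> //; rewrite /base; lia.
  - move=> v hv; rewrite !updE.
    by do ![rewrite (_ : (v == _) = false); last by apply: ltn_le_eqF hv _].
have once m x : (m < n.*2)%N -> J m x -> pc x = 10%N ->
    exists y, [/\ runs prog x y 5, J m.+1 y
      & pc y = if (m.+1 < n.*2)%N then 10%N else 15%N].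
  move=> mn Jx px; have [y [ey ry py]] := runs_straight_at hcl4 px isT.
  have Jy : J m.+1 y.
    case: Jx => -[i1 i2 i3 i4 [i5 i6]] [ku ki kb]; rewrite ey; split; split;
      rewrite /= ?updE /= ?i1 ?i2 ?i3 ?i4 ?i5 ?i6 ?absz_nat //; try by lia.
    - move=> u; rewrite orbF => u0 hu; rewrite !updE.
      case: eqP => [|_]; first by rewrite /base; lia.
      by rewrite (gtn_eqF u0) ku // u0.
    - move=> v hv; transitivity (ireg x v); last exact: ki.
      by rewrite !updE !(ltn_le_eqF hv).
    - move=> i hi; rewrite !updE; case: eqP => [?|ne].
        have -> : i = m by lia.
        by rewrite ku //; case: (m).
      have -> : (base + 16 * i == 0)%N = false by apply/eqP; rewrite /base; lia.
      by apply: kb; lia.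
  have rj := runs_jump (@code_at_nth prog _ 4 _ hcl isT) py.
  case: (Jy) => -[j1 j2 _ _ _] _; move: rj; rewrite j1 j2 ltz_nat => rj.
  by eexists; split; [exact: runs_trans ry rj | | rewrite /= py].
have loop k : forall m x, (m + k.+1 = n.*2)%N -> J m x -> pc x = 10%N ->
    exists y, [/\ runs prog x y (5 * k.+1), pc y = 15%N & J n.*2 y].
  elim: k => [|k IH] m x mk Jx px.
    have [|y [ry Jy py]] := once m x _ Jx px; first lia.
    exists y; split=> //; last by rewrite (_ : n.*2 = m.+1) //; lia.
    by rewrite py ifF //; lia.
  have [|y [ry Jy py]] := once m x _ Jx px; first lia.
  have [||w [rw pw Jw]] := IH m.+1 y _ Jy; first lia.
    by rewrite py ifT //; lia.
  by exists w; split=> //; apply: runs_le (runs_trans ry rw); lia.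
have [||y [ry py Jy]] := loop n.*2.-1 0%N st0 _ J0; [lia | by rewrite p0 |].
case: Jy => -[_ _ _ _ [_ i20]] [_ ki kb].
exists y, (State (rreg y) (fun k u => rreg y (base + 16 * u + k)%N)
  (fun v => if v == 0%N then n else if v == 1%N then p else 0%N)); split=> //.
- by apply: runs_le (runs_trans r0 ry); rewrite /=; lia.
- split=> //= v hv; rewrite ki //= sx.
  by case: (v == 0%N); case: (v == 1%N).
- move=> u hu; rewrite /= addn0 kb //= sx; case: ifP => // _.
  by rewrite addnn hu.
Qed.

Lemma program_ok (R : realType) (c : cmd) (p n : nat) (xs ys : seq R) :
  wf c -> (0 < n)%N -> size xs = n ->
  exists (s : state R) fuel fin T,
  [/\ [/\ iv s 0 = n, iv s 1 = p & forall u, (u < n.*2)%N ->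
        ar s 0 u = if (u < n)%N then nth 0 xs u else nth 0 ys (u - n)],
      exec (program c) fuel (necklace_init p xs ys) = Some (fin, T),
      (T <= 10 + 10 * n + cost c s)%N &
      [/\ rreg fin 0 = sc (sem c s) 0, rreg fin 1 = sc (sem c s) 1
        & ireg fin 0 = (iv (sem c s) 0)%:Z]].
Proof.
move=> wfc n0 sx.
have hc : code_at (program c) 0 prelude by exists [::], (compile c 15 ++ [:: Halt]).
have hc2 : code_at (program c) 15 (compile c 15) by exists prelude, [:: Halt].
have [st [s [r1 p1 rep1 s0 su]]] := prelude_ok p ys n0 sx hc.
have bge : (32 + p.+1 <= n.*2 + p + 33)%N by lia.
have [st' [r2 p2 rep2]] := comp_ok bge wfc rep1 hc2 p1.
have [t [k [ht hk]]] := runs_trans r1 r2.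
have [h1 _ h3 _ _] := rep2; have [_ _ _ _ h5] := rep1.
exists s, (k + 1)%N, st', t; split=> //.
- rewrite hk /= /step p2 /program catA nth_cat size_cat ltnn subnn /=.
  by rewrite add0n.
- by apply: leq_trans ht _; lia.
- by rewrite !h1 ?h3.
Qed.

(** * Real fast Fourier transform *)

(* After r stages, entry t 2^r + j (j < 2^r) of the array is the coefficient of
   z^t in the residue of the input polynomial modulo
   z^(2m) + tw (2^r + j) z^m + 1, where m 2^r = 2q.  One stage splits each
   modulus as z^(4m) + a z^(2m) + 1 =
   (z^(2m) + b z^m + 1) (z^(2m) - b z^m + 1) with b^2 = 2 - a; the
   parameters a form a binary tree stored in heap order in [tw]. *)

Section Transform.
Variables (R : fieldType) (tw : nat -> R).
Implicit Types (A B : nat -> R) (q r u : nat).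

(** Heap number of the modulus to which entry [u] belongs after [r] stages: the residue index is the
    remainder of [u] modulo 2^r. *)
Definition node r u : nat := 2 ^ r + u %% 2 ^ r.

(** With y = z^m, a residue c0 + c1 y + c2 y^2 + c3 y^3 has its parts at distance q. Modulo y^2 + s
    y + 1 one has y^2 = - s y - 1 and y^3 = (s^2 - 1) y + s, which gives the two formulas, with s =
    b or - b. The parity of [u] selects the child, and the shuffle of indices is the same in every
    stage. *)
Definition fstage q r A u : R :=
  let i := (u %% (2 * q))./2 in
  let b := tw (2 * node r i) in
  let sb := if odd u then - b else b in
  if (u < 2 * q)%N then A i - A (i + 2 * q)%N + sb * A (i + 3 * q)%N
  else A (i + q)%N - sb * A (i + 2 * q)%N + (b * b - 1) * A (i + 3 * q)%N.

(** Inverse of the 4 by 4 system of [fstage]: the difference of the two lower outputs is 2 b c3,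
    that of the two upper ones gives 2 b c2, and the half sums then yield c0 and c1. *)
Definition istage q r B u : R :=
  let i := (u %% q)%N in
  let b := tw (2 * node r i) in
  let e0 := B (2 * i)%N in
  let e1 := B (2 * i + 1)%N in
  let g0 := B (2 * i + 2 * q)%N in
  let g1 := B (2 * i + 1 + 2 * q)%N in
  let d := (e0 - e1) / (2 * b) in
  let c := (g1 - g0) / (2 * b) in
  match (u %/ q)%N with
  | 0%N => (e0 + e1) / 2 + c
  | 1%N => (g0 + g1) / 2 - (b * b - 1) * d
  | 2%N => c
  | _ => d
  end.

Fixpoint fft q r A : nat -> R :=
  if r is r'.+1 then fstage q r' (fft q r' A) else A.

Fixpoint ifft q r B : nat -> R :=
  if r is r'.+1 then ifft q r' (istage q r' B) else B.

Lemma fstage_lo q r A i (e : bool) : (i < q)%N ->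
  fstage q r A (2 * i + e) =
    A i - A (i + 2 * q)%N + (if e then - tw (2 * node r i) else tw (2 * node r i)) * A (i + 3 * q)%N.
Proof.
move=> iq; have hlt : (2 * i + e < 2 * q)%N by case: e; lia.
rewrite /fstage hlt modn_small //.
have -> : (2 * i + e)./2 = i by case: (e) => /=; lia.
by have -> : odd (2 * i + e) = e by case: (e); lia.
Qed.

Lemma fstage_hi q r A i (e : bool) : (i < q)%N ->
  fstage q r A (2 * i + e + 2 * q) =
    A (i + q)%N - (if e then - tw (2 * node r i) else tw (2 * node r i)) * A (i + 2 * q)%N
    + (tw (2 * node r i) * tw (2 * node r i) - 1) * A (i + 3 * q)%N.
Proof.
move=> iq; have hlt : (2 * i + e < 2 * q)%N by case: e; lia.
rewrite /fstage [(_ + _ < _)%N]ltnNge leq_addl modnDr modn_small //.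
have -> : (2 * i + e)./2 = i by case: (e) => /=; lia.
by have -> : odd (2 * i + e + 2 * q) = e by case: (e); lia.
Qed.

(** Arrays are total functions with arbitrary contents beyond 4 q; a stage never looks there. *)
Lemma eq_fstage q r A A' u : (u < 4 * q)%N ->
  (forall w, (w < 4 * q)%N -> A w = A' w) -> fstage q r A u = fstage q r A' u.
Proof.
move=> hu h; rewrite /fstage.
have hi : ((u %% (2 * q))./2 < q)%N.
  by have := ltn_pmod u (_ : 0 < 2 * q)%N; lia.
by rewrite !h //; lia.
Qed.

Lemma eq_istage q r B B' u : (u < 4 * q)%N ->
  (forall w, (w < 4 * q)%N -> B w = B' w) -> istage q r B u = istage q r B' u.
Proof.
move=> hu h; rewrite /istage.
have hi : (u %% q < q)%N by apply: ltn_pmod; lia.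
by rewrite !h //; lia.
Qed.

Lemma eq_ifft q r B B' u : (u < 4 * q)%N ->
  (forall w, (w < 4 * q)%N -> B w = B' w) -> ifft q r B u = ifft q r B' u.
Proof.
elim: r B B' => [|r IH] B B' hu h /=; first exact: h.
by apply: IH => // w hw; apply: eq_istage.
Qed.

Lemma eq_fft q r A A' u : (u < 4 * q)%N ->
  (forall w, (w < 4 * q)%N -> A w = A' w) -> fft q r A u = fft q r A' u.
Proof.
elim: r u => [|r IH] u hu h /=; first exact: h.
by apply: eq_fstage => // w hw; apply: IH.
Qed.

Lemma istageK q r A B u : (2%:R != 0 :> R) ->
  (forall i, (i < q)%N -> tw (2 * node r i) != 0) ->
  (forall w, (w < 4 * q)%N -> B w = fstage q r A w) ->
  (u < 4 * q)%N -> istage q r B u = A u.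
Proof.
move=> two0 nz hB hu; rewrite (eq_istage r hu hB) /istage.
have hi : (u %% q < q)%N by apply: ltn_pmod; lia.
have := nz _ hi; set i := (u %% q)%N in hi *; set b := tw _ => b0.
have := fstage_lo r A false hi; have := fstage_lo r A true hi.
have := fstage_hi r A false hi; have := fstage_hi r A true hi.
rewrite addn0 -/b => -> -> -> ->.
have ud : u = ((u %/ q) * q + i)%N by rewrite -divn_eq.
have ulq : (u %/ q < 4)%N by rewrite ltn_divLR //; lia.
rewrite [A u](congr1 A ud); case: (u %/ q)%N ulq => [|[|[|[|//]]]] _.
- have -> : (0 * q + i = i)%N by lia.
  by field; rewrite two0 b0.
- have -> : (1 * q + i = i + q)%N by lia.
  by field; rewrite two0 b0.
- have -> : (2 * q + i = i + 2 * q)%N by lia.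
  by field; rewrite two0 b0.
- have -> : (3 * q + i = i + 3 * q)%N by lia.
  by field; rewrite two0 b0.
Qed.

Lemma fftK q r A B u : (2%:R != 0 :> R) ->
  (forall r' i, (r' < r)%N -> (i < q)%N -> tw (2 * node r' i) != 0) ->
  (forall w, (w < 4 * q)%N -> B w = fft q r A w) ->
  (u < 4 * q)%N -> ifft q r B u = A u.
Proof.
move=> two0; elim: r B => [|r IH] B nz hB hu /=; first exact: hB.
apply: IH => // [r' i hr|w hw]; first by apply: nz; apply: ltnW.
by apply: istageK hB hw => // i; apply: nz.
Qed.

End Transform.

(** * Evaluation of residues at roots of their moduli *)

Section Evaluation.
Variables (R : fieldType) (C : comNzRingType) (f : {rmorphism R -> C}).
Variable tw : nat -> R.

(** Reducing modulo a polynomial does not change the value at one of its roots. The roots of the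
    moduli are not real, hence the morphism [f] into a larger ring. *)
Lemma fstage_eval q r m A j (x : C) :
  (m * 2 ^ r = q)%N -> (j < 2 ^ r.+1)%N ->
  let b := f (tw (2 * node r j./2)) in
  let sb := if odd j then - b else b in
  x ^+ m * x ^+ m + sb * x ^+ m + 1 = 0 ->
  \sum_(t < 2 * m) f (fstage tw q r A (t * 2 ^ r.+1 + j)) * x ^+ t =
  \sum_(t < 4 * m) f (A (t * 2 ^ r + j./2)%N) * x ^+ t.
Proof.
move=> mq jr b sb hx.
have jr2 : (j./2 < 2 ^ r)%N by move: jr; rewrite expnS; lia.
have split2 (g : nat -> C) : \sum_(t < 2 * m) g t = \sum_(t < m) (g t + g (m + t)%N).
  by rewrite mul2n -addnn big_split_ord big_split.
have -> : (4 * m = 2 * (2 * m))%N by lia.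
rewrite (split2 (fun t => f (fstage tw q r A (t * 2 ^ r.+1 + j)) * x ^+ t)).
have -> : \sum_(t < 2 * (2 * m)) f (A (t * 2 ^ r + j./2)%N) * x ^+ t =
   \sum_(t < m) (f (A (t * 2 ^ r + j./2)%N) + f (A (t * 2 ^ r + j./2 + q)%N) * x ^+ m
     + f (A (t * 2 ^ r + j./2 + 2 * q)%N) * (x ^+ m * x ^+ m)
     + f (A (t * 2 ^ r + j./2 + 3 * q)%N) * (x ^+ m * x ^+ m * x ^+ m)) * x ^+ t.
  have aux (g : nat -> C) : \sum_(t < 2 * (2 * m)) g t =
      \sum_(t < m) (g t + g (m + t)%N + g (2 * m + t)%N + g (3 * m + t)%N).
    rewrite [(2 * (2 * m))%N]mul2n -addnn big_split_ord /= split2.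
    rewrite (split2 (fun t => g (2 * m + t)%N)) -big_split /=.
    apply: eq_bigr => t _; rewrite !addrA; congr (_ + _ + _ + g _); lia.
  rewrite (aux (fun t => f (A (t * 2 ^ r + j./2)%N) * x ^+ t)); apply: eq_bigr => t _.
  have e1 : ((m + t) * 2 ^ r + j./2 = t * 2 ^ r + j./2 + q)%N by lia.
  have e2 : ((2 * m + t) * 2 ^ r + j./2 = t * 2 ^ r + j./2 + 2 * q)%N by lia.
  have e3 : ((3 * m + t) * 2 ^ r + j./2 = t * 2 ^ r + j./2 + 3 * q)%N by lia.
  rewrite e1 e2 e3 (exprD x m t) (exprD x (2 * m) t) (exprD x (3 * m) t).
  have -> : x ^+ (2 * m) = x ^+ m * x ^+ m by rewrite mulnC exprM expr2.
  have -> : x ^+ (3 * m) = x ^+ m * x ^+ m * x ^+ m by rewrite mulnC exprM exprSr expr2.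
  by ring.
apply: eq_bigr => t _.
have hi : (t * 2 ^ r + j./2 < q)%N.
  rewrite -mq; have := ltn_ord t; move: jr2; set p := (2 ^ r)%N => h1 h2.
  have : ((t.+1) * p <= m * p)%N by rewrite leq_mul2r h2 orbT.
  by rewrite mulSn; lia.
have e0 : (t * 2 ^ r.+1 + j = 2 * (t * 2 ^ r + j./2) + odd j)%N.
  by rewrite -[j in LHS]odd_double_half expnS; lia.
have e1 : ((m + t) * 2 ^ r.+1 + j = 2 * (t * 2 ^ r + j./2) + odd j + 2 * q)%N.
  by rewrite mulnDl -addnA e0 expnS -mq; lia.
rewrite e0 e1 fstage_lo // fstage_hi //.
have nodeE : node r (t * 2 ^ r + j./2) = node r j./2 by rewrite /node modnMDl.
rewrite nodeE exprD.
rewrite !(rmorphD, rmorphM, rmorphN, rmorph1) /=.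
have -> : f (if odd j then - tw (2 * node r j./2) else tw (2 * node r j./2)) = sb.
  by rewrite /sb; case: (odd j); rewrite ?rmorphN.
rewrite -/b.
have bb : b * b = sb * sb by rewrite /sb; case: (odd j); rewrite ?mulrNN.
rewrite bb; set y := x ^+ m in hx *.
have yy : y * y = - (sb * y) - 1 by apply/eqP; rewrite -subr_eq0; apply/eqP; rewrite -hx; ring.
have yyy : y * y * y = - sb * (y * y) - y by rewrite yy; ring: yy.
by rewrite yyy yy; ring.
Qed.

End Evaluation.

(* [h] is the number of leaves. *)
Definition tree_ok (R : numDomainType) (h : nat) (tw : nat -> R) : Prop :=
  [/\ tw 1%N = 0,
      forall v, (0 < v < h)%N ->
        tw (2 * v)%N * tw (2 * v)%N = 2 - tw v /\ tw (2 * v).+1 = - tw (2 * v)%N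
    & forall v, (0 < v < 2 * h)%N -> tw v * tw v < 4].

Section Convolution.
Variables (R : rcfType) (tw : nat -> R) (K : nat).
Hypothesis tw_ok : tree_ok (2 ^ K.+1) tw.
Let q := (2 ^ K)%N.
Let h := (2 ^ K.+1)%N.
Implicit Types A B : nat -> R.

Lemma node_bound r j : (r < K.+1)%N -> (0 < node r j < h)%N.
Proof.
move=> hr; rewrite /node addn_gt0 expn_gt0 /=.
have h1 := ltn_pmod j (_ : 0 < 2 ^ r)%N; rewrite expn_gt0 in h1.
have h2 : (2 ^ r.+1 <= h)%N by rewrite leq_exp2l.
by move: h2 (h1 isT); rewrite expnS; lia.
Qed.

(** A vanishing child would force the value 2 on its parent, which the strict bound on squares
    excludes. This makes the divisions of [istage] legitimate. *)
Lemma tw_neq0 r i : (r < K.+1)%N -> tw (2 * node r i) != 0.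
Proof.
move=> hr; have hn := node_bound i hr; have [_ h2 h3] := tw_ok.
have [e _] := h2 _ hn; apply/eqP => e0; rewrite e0 mulr0 in e.
have := h3 (node r i); rewrite -/h => /(_ _) h4.
have : tw (node r i) = 2 by lra.
by move=> e2; move: h4; rewrite e2 => h4; have := h4 ltac:(lia); lra.
Qed.

(** By induction on the stages: the modulus of a node is the product of those of its children, so a
    root for a child is a root for the parent, down to the input polynomial itself. *)
Lemma fft_eval (C : comNzRingType) (f : {rmorphism R -> C}) r A j (x : C) :
  (r <= K.+1)%N -> (j < 2 ^ r)%N ->
  let y := x ^+ (2 ^ (K.+1 - r))%N in
  y * y + f (tw (2 ^ r + j)%N) * y + 1 = 0 ->
  \sum_(t < 2 * 2 ^ (K.+1 - r)) f (fft tw q r A (t * 2 ^ r + j)) * x ^+ t =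
  \sum_(t < 4 * q) f (A t) * x ^+ t.
Proof.
have [t1 t2 _] := tw_ok.
elim: r j => [|r IH] j hr hj /= hx.
  have j0 : j = 0%N by move: hj; rewrite expn0; lia.
  rewrite subn0 expnS mulnA; apply: eq_bigr => t _.
  by rewrite /= expn0 muln1 j0 addn0.
set m := (2 ^ (K.+1 - r.+1))%N.
have mE : (2 ^ (K.+1 - r) = 2 * m)%N by rewrite /m -expnS subSS subSn.
have mq : (m * 2 ^ r = q)%N by rewrite /m subSS -expnD subnK.
have jr2 : (j./2 < 2 ^ r)%N by move: hj; rewrite expnS; lia.
have nodeE : node r j./2 = (2 ^ r + j./2)%N by rewrite /node modn_small.
have [b2 b1] := t2 _ (node_bound j./2 hr).
have jE : (2 ^ r.+1 + j = 2 * node r j./2 + odd j)%N.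
  by rewrite nodeE expnS -[j in LHS]odd_double_half; lia.
have hx' : x ^+ m * x ^+ m + (if odd j then - f (tw (2 * node r j./2)) else
    f (tw (2 * node r j./2))) * x ^+ m + 1 = 0.
  rewrite -hx jE; congr (_ + _ * _ + _); case: (odd j); rewrite ?addn0 //.
  by rewrite addn1 b1 rmorphN.
rewrite /= (fstage_eval (f := f) (fft tw q r A) mq hj hx').
rewrite -(IH j./2 (ltnW hr) jr2) mE; first by rewrite mulnA.
rewrite mulnC exprM; move: hx'; set y := x ^+ m.
have bb : f (tw (node r j./2)) =
    2 - f (tw (2 * node r j./2)) * f (tw (2 * node r j./2)).
  by rewrite -rmorphM b2 rmorphB rmorph_nat; ring.
rewrite -nodeE bb; set b := f (tw (2 * _)).
have -> : y ^+ 2 * y ^+ 2 + (2 - b * b) * y ^+ 2 + 1 =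
  (y * y + b * y + 1) * (y * y - b * y + 1) by ring.
by case: (odd j); rewrite ?mulNr => ->; rewrite ?mulr0 ?mul0r.
Qed.

(** The root of x^2 + a x + 1 in the upper half-plane when a^2 < 4. *)
Definition leaf_root (a : R) : R[i] := Complex (- a / 2) (Num.sqrt (4 - a * a) / 2).

Lemma leaf_rootP (a : R) : a * a < 4 ->
  let x := leaf_root a in x * x + (a%:C)%C * x + 1 = 0.
Proof.
move=> ha; have := sqr_sqrtr (_ : 0 <= 4 - a * a).
rewrite subr_ge0 ltW // => /(_ isT); rewrite expr2 /leaf_root; set s := Num.sqrt _ => hs.
apply/eqP; rewrite eq_complex /=; apply/andP; split; apply/eqP; rewrite /=.
  have -> : - a / 2 * (- a / 2) - s / 2 * (s / 2) + (a * (- a / 2) - 0 * (s / 2)) + 1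
    = (4 - a * a - s * s) / 4 by field.
  by rewrite hs subrr mul0r.
by field.
Qed.

(** The imaginary part of the root is nonzero, so a linear real residue is determined by one complex
    value. *)
Lemma leaf_uniq (a p0 p1 r0 r1 : R) : a * a < 4 ->
  ((p0%:C + p1%:C * leaf_root a = r0%:C + r1%:C * leaf_root a)%C : Prop) ->
  p0 = r0 /\ p1 = r1.
Proof.
move=> ha /eqP; rewrite eq_complex /= !mul0r !addr0 !subr0 !add0r => /andP[/eqP e1 /eqP e2].
have s0 : Num.sqrt (4 - a * a) / 2 != 0.
  by rewrite mulf_neq0 ?invr_eq0 ?pnatr_eq0 // gt_eqF // sqrtr_gt0 subr_gt0.
have e3 : p1 = r1 by apply: (mulIf s0).
by split=> //; move: e1; rewrite e3; lra.
Qed.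

Lemma leaf_eval A j : (j < h)%N ->
  (((fft tw q K.+1 A j)%:C + (fft tw q K.+1 A (j + h))%:C * leaf_root (tw (h + j)))%C
   = (map_poly (real_complex R) (\poly_(i < 4 * q) A i)).[leaf_root (tw (h + j))]).
Proof.
move=> hj; have [_ _ t3] := tw_ok.
have ha : tw (h + j) * tw (h + j) < 4 by apply: t3; move: hj; rewrite -/h; lia.
have := @fft_eval _ (real_complex R) K.+1 A j (leaf_root (tw (h + j))) (leqnn _) hj.
rewrite subnn expn0 expr1 muln1 => /(_ (leaf_rootP ha)).
rewrite big_ord_recr big_ord1 /= mul0n mul1n add0n expr0 mulr1 expr1 [(_ + j)%N]addnC => ->.
rewrite poly_def rmorph_sum horner_sum; apply: eq_bigr => i _.
by rewrite /= map_polyZ hornerZ map_polyXn hornerXn.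
Qed.

(** [L] multiplies linear residues modulo z^2 + a z + 1 at each leaf and sums the products.
    Comparing values at the leaf roots identifies it with the transform of the sum of products,
    which fits in 4 q coefficients and is thus recovered without wrap-around. *)
Lemma fft_convolution (I : finType) (P : pred I) (F G : I -> nat -> R) (L : nat -> R) (u : nat) :
  (size (\sum_(a | P a) (\poly_(i < 4 * q) F a i * \poly_(i < 4 * q) G a i))%R
     <= 4 * q)%N ->
  (forall j, (j < h)%N ->
    L j = \sum_(a | P a) (fft tw q K.+1 (F a) j * fft tw q K.+1 (G a) j
                   - fft tw q K.+1 (F a) (j + h) * fft tw q K.+1 (G a) (j + h))
    /\ L (j + h)%N =
      \sum_(a | P a) (fft tw q K.+1 (F a) j * fft tw q K.+1 (G a) (j + h)
        + fft tw q K.+1 (F a) (j + h) * fft tw q K.+1 (G a) j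
        - tw (h + j) * fft tw q K.+1 (F a) (j + h) * fft tw q K.+1 (G a) (j + h))) ->
  (u < 4 * q)%N ->
  ifft tw q K.+1 L u =
    (\sum_(a | P a) (\poly_(i < 4 * q) F a i * \poly_(i < 4 * q) G a i))`_u.
Proof.
set S := \sum_(a | P a) _ => sz hL hu.
have q2 : (2 * q)%N = h by rewrite /q /h expnS.
apply: (@fftK _ tw q K.+1 (fun v => S`_v)) hu; first by rewrite pnatr_eq0.
  by move=> r i hr hi; apply: tw_neq0.
have key j : (j < h)%N -> fft tw q K.+1 (fun v => S`_v) j = L j /\
    fft tw q K.+1 (fun v => S`_v) (j + h) = L (j + h)%N.
  move=> hj; have [_ _ t3] := tw_ok.
  have ha : tw (h + j) * tw (h + j) < 4 by apply: t3; move: hj; rewrite -/h; lia.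
  apply: (leaf_uniq ha); rewrite leaf_eval //.
  have -> : \poly_(i < 4 * q) S`_i = S.
    apply/polyP => i; rewrite coef_poly; case: ltnP => // hi.
    by rewrite nth_default // (leq_trans sz).
  have [-> ->] := hL j hj.
  rewrite /S rmorph_sum horner_sum !rmorph_sum /= mulr_suml -big_split /=.
  apply: eq_bigr => a _; rewrite rmorphM hornerM -!leaf_eval //.
  have := leaf_rootP ha; rewrite !(rmorphB, rmorphD, rmorphM) /=.
  set x := leaf_root _ => hx.
  set p0 := (_%:C)%C; set p1 := (_%:C)%C; set r0 := (_%:C)%C; set r1 := (_%:C)%C.
  set c := (_%:C)%C in hx *.
  have xx : x * x = - (c * x) - 1 by apply/eqP; rewrite -subr_eq0; apply/eqP; rewrite -hx; ring.
  ring: xx.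
move=> w hw; have [wh|hw2] := ltnP w h; first by case: (key w wh).
have wh2 : (w - h < h)%N by move: hw; lia.
by have [_] := key _ wh2; rewrite subnK // => ->.
Qed.

End Convolution.

(** * Circular and linear matchings *)

Section EvenPowers.
Variables (R : realFieldType) (p : nat).
Hypothesis evp : ~~ odd p.

(** For u >= 0 the difference is the sum of the products (u - 1) (u^i - 1), whose factors have equal
    signs. For u < 0 and p > 0 the left side is at most 0 and evenness makes the right side
    nonnegative. *)
Lemma even_bernoulli (u : R) : 1 + p%:R * (u - 1) <= u ^+ p.
Proof.
have [u0|u0] := leP 0 u.
  rewrite -lerBrDl subrX1 mulrC -[p in p%:R]card_ord -sum1_card natr_sum -subr_ge0.
  rewrite -mulrBr -sumrB mulr_sumr sumr_ge0 // => i _.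
  have [u1|u1] := leP 1 u; first by rewrite mulr_ge0 ?subr_ge0 // exprn_ege1.
  by rewrite mulr_le0 // subr_le0 ?exprn_ile1 // ltW.
have := exprn_even_ge0 u evp; case: p => [|p'] h; first by rewrite mul0r addr0.
apply: le_trans h; have : 1 <= p'.+1%:R :> R by rewrite ler1n.
nra.
Qed.

(** Bernoulli's inequality at u = t / w, scaled by w^p >= 0: convexity without derivatives. *)
Lemma even_tangent (t w : R) : w ^+ p + p%:R * w ^+ p.-1 * (t - w) <= t ^+ p.
Proof.
have [->|w0] := eqVneq w 0.
  case: p evp => [|[|p']] // ev; first by rewrite !mul0r addr0.
  by rewrite /= !expr0n !mulr0n mulr0 mul0r addr0 exprn_even_ge0.
have -> : t = w * (t / w) by field.
set u := t / w; rewrite exprMn.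
have -> : w ^+ p + p%:R * w ^+ p.-1 * (w * u - w) = w ^+ p * (1 + p%:R * (u - 1)).
  case: p => [|p'] /=; first by rewrite expr0; ring.
  by rewrite exprS; ring.
by rewrite ler_wpM2l ?even_bernoulli ?exprn_even_ge0.
Qed.

(** The tangents at a + d and at a + e are compared with both end points. Weighted by d and e, their
    linear terms cancel, and d + e is divided out. *)
Lemma even_convex2 (a d e : R) : 0 <= d -> 0 <= e ->
  (a + d) ^+ p + (a + e) ^+ p <= a ^+ p + (a + d + e) ^+ p.
Proof.
move=> d0 e0; have [de|de] := leP (d + e) 0.
  have -> : d = 0 by lra. have -> : e = 0 by lra.
  by rewrite !addr0.
rewrite -(ler_pM2l de).
have h1 := even_tangent a (a + d); have h2 := even_tangent (a + d + e) (a + d).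
have h3 := even_tangent a (a + e); have h4 := even_tangent (a + d + e) (a + e).
have k1 := ler_wpM2l e0 h1; have k2 := ler_wpM2l d0 h2.
have k3 := ler_wpM2l d0 h3; have k4 := ler_wpM2l e0 h4.
move: k1 k2 k3 k4; lra.
Qed.

End EvenPowers.

(** * Uncrossing periodic matchings *)

Section Rearrangement.
Variables (R : realFieldType) (p n : nat) (X Y : int -> R).
Hypotheses (evp : ~~ odd p) (n0 : (0 < n)%N).
Hypotheses (X_homo : {homo X : x y / x <= y}) (Y_homo : {homo Y : x y / x <= y}).
Hypotheses (X_period : forall z, X (z + n%:Z) = X z + 1).
Hypotheses (Y_period : forall z, Y (z + n%:Z) = Y z + 1).

(* Uncrossing two cyclically adjacent beads lowers the integer
   \sum_i (b i - i)^2 without increasing the cost; a matching without such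
   crossings is a shift. *)
Lemma uncross (b : 'I_n -> int) :
  (forall i j, (b i = b j %[mod n%:Z])%Z -> i = j) ->
  exists S : int, \sum_(i < n) (X i%:Z - Y (i%:Z + S)) ^+ p <=
                  \sum_(i < n) (X i%:Z - Y (b i)) ^+ p.
Proof.
pose D (b : 'I_n -> int) := \sum_(i < n) (b i - i%:Z) ^+ 2.
have D0 c : 0 <= D c by apply: sumr_ge0 => i _; apply: sqr_ge0.
(* The cyclic successor of the last bead is bead 0 of the next period; [wrap] records this change of
   period. *)
pose wrap (i : 'I_n) : int := (i.+1 == n)%:R.
have ordSE i : (ordS i)%:Z + wrap i * n%:Z = i%:Z + 1.
  rewrite /wrap /=; case: eqP => [e|ne]; first by rewrite e modnn; lia.
  by rewrite modn_small; have := ltn_ord i; lia.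
have per (Z : int -> R) z i : (forall z, Z (z + n%:Z) = Z z + 1) ->
    Z (z + wrap i * n%:Z) = Z z + (wrap i)%:~R.
  by move=> hZ; rewrite /wrap; case: eqP => _; rewrite ?mul1r ?hZ // mul0r !addr0.
(* Distinct residues turn each weak ascent into one of at least 1, and the condition across the
   period leaves n - 1 for the n - 1 steps, so every step is exactly 1. *)
have shift (c : 'I_n -> int) : (forall i, c i <= c (ordS i) + wrap i * n%:Z) ->
    (forall i j, (c i = c j %[mod n%:Z])%Z -> i = j) ->
    exists S : int, forall i, c i = i%:Z + S.
  move=> hno inj; exists (c (Ordinal n0)).
  have lt (i : 'I_n) : i.+1 != n -> c i + 1 <= c (ordS i).
    move=> ne; have := hno i; rewrite /wrap (negbTE ne) mul0r addr0 => le.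
    have : c i != c (ordS i); last by lia.
    apply/eqP => e; have := ordSE i; rewrite /wrap (negbTE ne) mul0r addr0.
    by rewrite -(inj _ _ (congr1 (modz^~ n%:Z) e)); lia.
  have up k : forall i : 'I_n, i = k :> nat -> k%:Z + c (Ordinal n0) <= c i.
    elim: k => [|k IHk] i hi; first by rewrite add0r (_ : i = Ordinal n0) //; apply: val_inj.
    have hk : (k < n)%N by have := ltn_ord i; lia.
    have hS : ordS (Ordinal hk) = i by apply: val_inj; rewrite /= modn_small -?hi.
    have h1 : c (Ordinal hk) + 1 <= c i.
      by rewrite -hS; apply: lt; rewrite -hi neq_ltn ltn_ord.
    have h2 := IHk (Ordinal hk) erefl; move: h1 h2.
    by move: (c i) (c (Ordinal hk)) (c (Ordinal n0)) => *; lia.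
  have hn1 : (n.-1 < n)%N by rewrite prednK.
  have down k : forall i : 'I_n, (i + k)%N = n.-1 -> c i + k%:Z <= c (Ordinal hn1).
    elim: k => [|k IHk] i hi; first by rewrite addr0 (_ : i = Ordinal hn1) //; apply: val_inj; rewrite /= -hi addn0.
    have ne : i.+1 != n by apply/eqP; lia.
    have hS : ordS i = i.+1 :> nat by rewrite /= modn_small //; have := ltn_ord i; lia.
    have := IHk (ordS i) _; rewrite hS => /(_ ltac:(lia)).
    by have := lt i ne; lia.
  have last : c (Ordinal hn1) <= c (Ordinal n0) + n%:Z - 1.
    have := hno (Ordinal hn1); rewrite /wrap /= prednK // eqxx mul1r.
    have -> : ordS (Ordinal hn1) = Ordinal n0 by apply: val_inj; rewrite /= prednK // modnn.
    move=> le; have [n1|n1] := eqVneq n 1%N.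
      have -> : Ordinal hn1 = Ordinal n0 by apply: val_inj; rewrite /= n1.
      by lia.
    have : c (Ordinal hn1) != c (Ordinal n0) + n%:Z; last by lia.
    apply/eqP => e.
    have /(congr1 val) /= : Ordinal hn1 = Ordinal n0 by apply: inj; rewrite e modzDr.
    by lia.
  move=> i; apply/eqP; rewrite eq_le (up i i erefl) andbT.
  have := down (n.-1 - i)%N i _; have := ltn_ord i => hi /(_ ltac:(lia)).
  by lia.
have swap (c : 'I_n -> int) (i : 'I_n) : (forall i j, (c i = c j %[mod n%:Z])%Z -> i = j) ->
    c (ordS i) + wrap i * n%:Z < c i ->
  exists c', [/\ forall i j, (c' i = c' j %[mod n%:Z])%Z -> i = j, D c' < D c &
    \sum_(i < n) (X i%:Z - Y (c' i)) ^+ p <= \sum_(i < n) (X i%:Z - Y (c i)) ^+ p].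
  set j := ordS i; set k := wrap i => inj hlt.
  have ji : j != i.
    apply/eqP => e; move: hlt; rewrite e; have := ordSE i; rewrite -/j e -/k.
    by rewrite /k /wrap; case: eqP; lia.
  (* Bead i and its successor exchange partners, moved by a period when the successor lies in the
     next one. *)
  pose c' l := if l == i then c j + k * n%:Z else if l == j then c i - k * n%:Z else c l.
  exists c'.
  have c'i : c' i = c j + k * n%:Z by rewrite /c' eqxx.
  have c'j : c' j = c i - k * n%:Z by rewrite /c' (negbTE ji) eqxx.
  have c'E l : l != i -> l != j -> c' l = c l by rewrite /c' => /negbTE-> /negbTE->.
  have sumE (V : zmodType) (F : 'I_n -> int -> V) c1 :
    \sum_l F l (c1 l) = F i (c1 i) + (F j (c1 j) + \sum_(l | (l != i) && (l != j)) F l (c1 l)).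
    by rewrite (bigD1 i) //= (bigD1 j).
  have rest (V : zmodType) (F : 'I_n -> int -> V) :
    \sum_(l | (l != i) && (l != j)) F l (c' l) = \sum_(l | (l != i) && (l != j)) F l (c l).
    by apply: eq_bigr => l /andP[h1 h2]; rewrite c'E.
  have jE := ordSE i; rewrite -/j -/k in jE.
  split.
  - have c'mod l : (c' l = c (tperm i j l) %[mod n%:Z])%Z.
      case: tpermP => [->|->|/eqP h1 /eqP h2]; last by rewrite c'E.
        by rewrite c'i addrC modzMDl.
      by rewrite c'j -mulNr addrC modzMDl.
    by move=> l1 l2; rewrite !c'mod => /inj /perm_inj.
  - rewrite /D (sumE _ (fun l z => (z - l%:Z) ^+ 2)) (sumE _ (fun l z => (z - l%:Z) ^+ 2)).
    rewrite (rest _ (fun l z => (z - l%:Z) ^+ 2)) c'i c'j !addrA ltrD2r.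
    have -> : j%:Z = i%:Z + 1 - k * n%:Z by rewrite -jE addrK.
    rewrite !expr2; nia.
  - rewrite (sumE _ (fun l z => (X l%:Z - Y z) ^+ p)) (sumE _ (fun l z => (X l%:Z - Y z) ^+ p)).
    rewrite (rest _ (fun l z => (X l%:Z - Y z) ^+ p)) c'i c'j !addrA lerD2r.
    have Xj : X j%:Z = X (i%:Z + 1) - k%:~R by rewrite -jE per // addrK.
    have Ycj : Y (c j + k * n%:Z) = Y (c j) + k%:~R by rewrite per.
    have Yci : Y (c i - k * n%:Z) = Y (c i) - k%:~R.
      by rewrite -[c i in RHS](subrK (k * n%:Z)) per // addrK.
    have hX : X i%:Z <= X (i%:Z + 1) by apply: X_homo; rewrite lerDl.
    have hY : Y (c j + k * n%:Z) <= Y (c i) by apply: Y_homo; apply: ltW.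
    rewrite Ycj in hY *; rewrite Xj Yci.
    (* The old differences are a and a + d + e, the new ones a + d and a + e. *)
    have := even_convex2 evp (X i%:Z - Y (c i)) (_ : 0 <= Y (c i) - (Y (c j) + k%:~R))
       (_ : 0 <= X (i%:Z + 1) - X i%:Z).
    rewrite !subr_ge0 => /(_ hY hX).
    congr (_ <= _); congr (_ ^+ _ + _ ^+ _); ring.
move: {2}(`|D b|%N) (leqnn `|D b|%N) => m; elim: m b => [|m IH] b hD inj.
  all: have [/existsP[i hi]|] := boolP [exists i, b (ordS i) + wrap i * n%:Z < b i].
- have [c [_ lt _]] := swap b i inj hi.
  by have := D0 c; have := D0 b; move: lt hD; lia.
- rewrite negb_exists => /forallP hno.
  have [S hS] := shift b (fun i => ltac:(rewrite leNgt; exact: hno)) inj.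
  by exists S; apply: ler_sum => i _; rewrite hS.
- have [c [injc lt le]] := swap b i inj hi.
  have [|S hS] := IH c _ injc; last by exists S; apply: le_trans le.
  by have := D0 c; have := D0 b; move: lt hD; lia.
- rewrite negb_exists => /forallP hno.
  have [S hS] := shift b (fun i => ltac:(rewrite leNgt; exact: hno)) inj.
  by exists S; apply: ler_sum => i _; rewrite hS.
Qed.

End Rearrangement.

(** * From the circle to the line and back *)

Section Unrolling.
Variable R : realType.
Implicit Types (xs ys : seq R) (a b c : R).

Definition unroll xs (z : int) : R :=
  nth 0 xs `|(z %% (size xs)%:Z)%Z|%N + (z %/ (size xs)%:Z)%Z%:~R.

Definition linear_cost (p : nat) xs ys (s : int) (c : R) : R :=
  \sum_(i < size xs) (nth 0 xs i + c - unroll ys (i%:Z + s)) ^+ p.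

Lemma mod1_itv a : 0 <= mod1 a < 1.
Proof. by have := floor_itv a; rewrite /mod1 intrD; lra. Qed.

Lemma dcirc_ge0 a b : 0 <= a < 1 -> 0 <= b < 1 -> 0 <= dcirc a b.
Proof.
move=> ha hb; rewrite /dcirc le_min normr_ge0 subr_ge0 /= ler_norml; lra.
Qed.

(** For k nonzero, |k| >= 1 and the triangle inequality bound the second term of the minimum. With
    [dcirc_attained], the circular distance is the least distance between lifts. *)
Lemma dcirc_le a b (k : int) : 0 <= a < 1 -> 0 <= b < 1 ->
  dcirc a b <= `|a - b + k%:~R|.
Proof.
move=> ha hb; rewrite /dcirc ge_min.
have [->|k0] := eqVneq k 0; first by rewrite addr0 lexx.
have : 1 <= `|k%:~R : R|.
  by rewrite -intr_norm -[1]/(1%:~R) ler_int; lia.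
move=> k1; apply/orP; right; rewrite lerBlDr; apply: le_trans k1 _.
by rewrite -[X in `|X| <= _](addrK (a - b)) [X in `|X - _|]addrC ler_normB.
Qed.

Lemma dcirc_attained a b : 0 <= a < 1 -> 0 <= b < 1 ->
  exists k : int, dcirc a b = `|a - b - k%:~R|.
Proof.
move=> ha hb; rewrite /dcirc minEle; case: ifP => _; first by exists 0; rewrite subr0.
have [ab|ab] := leP 0 (a - b).
  by exists 1; rewrite [in LHS]ger0_norm // ler0_norm; lra.
by exists (-1); rewrite [in LHS]ltr0_norm // ger0_norm; lra.
Qed.

Lemma even_norm_exp p a : ~~ odd p -> `|a| ^+ p = a ^+ p.
Proof. by move=> ev; rewrite -normrX ger0_norm // exprn_even_ge0. Qed.

Lemma unrollMD xs (k z : int) : (0 < size xs)%N ->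
  unroll xs (z + k * (size xs)%:Z) = unroll xs z + k%:~R.
Proof.
move=> h; rewrite /unroll [z + _]addrC modzMDl divzMDl; last by rewrite eqz_nat; lia.
by rewrite intrD; ring.
Qed.

Lemma unroll_small xs i : (i < size xs)%N -> unroll xs i%:Z = nth 0 xs i.
Proof.
by move=> hi; rewrite /unroll modz_nat divz_nat modn_small // divn_small // addr0.
Qed.

Lemma unroll_nat xs (i : nat) :
  unroll xs i%:Z = nth 0 xs (i %% size xs) + (i %/ size xs)%:R.
Proof. by rewrite /unroll modz_nat divz_nat. Qed.

Lemma necklace_nth n xs i : necklace_input n xs -> (i < n)%N -> 0 <= nth 0 xs i < 1.
Proof. by move=> [sz [_ /(all_nthP 0)h]] hi; apply: h; rewrite sz. Qed.

Lemma unroll_homo n xs : (0 < n)%N -> necklace_input n xs ->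
  {homo unroll xs : x y / x <= y}.
Proof.
move=> n0 hxs; have [sz [srt _]] := hxs => z w zw; rewrite /unroll sz.
have n0' : n%:Z != 0 by rewrite eqz_nat; lia.
have bound v : (`|(v %% n%:Z)%Z| < n)%N.
  by have := ltz_pmod v (_ : 0 < n%:Z); have := modz_ge0 v n0'; lia.
have ez := divz_eq z n; have ew := divz_eq w n.
have := necklace_nth hxs (bound z); have := necklace_nth hxs (bound w).
have rz := modz_ge0 z n0'; have rw := modz_ge0 w n0'; have bz := bound z; have bw := bound w.
have [lt|ge] := ltP (z %/ n%:Z)%Z (w %/ n%:Z)%Z.
  have : ((z %/ n%:Z)%Z + 1)%:~R <= (w %/ n%:Z)%Z%:~R :> R by rewrite ler_int; lia.
  by rewrite intrD; lra.
have e : (z %/ n%:Z)%Z = (w %/ n%:Z)%Z by nia.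
move=> _ _; rewrite e lerD2r; apply: sorted_leq_nth => //.
- exact: le_trans.
- by rewrite inE sz.
- by rewrite inE sz.
- by move: ez ew; rewrite e; lia.
Qed.

Variables (p n : nat) (xs ys : seq R).
Hypotheses (evp : ~~ odd p) (n0 : (0 < n)%N).
Hypotheses (hxs : necklace_input n xs) (hys : necklace_input n ys).

Lemma size_xs : size xs = n. Proof. by case: hxs. Qed.
Lemma size_ys : size ys = n. Proof. by case: hys. Qed.

(** Termwise, a circular distance is at most the distance of any two lifts; the integer [k] collects
    the two floors and the full turns of [unroll]. *)
Lemma circular_le_linear c s : necklace_cost p xs ys (mod1 c) s <= linear_cost p xs ys s%:Z c.
Proof.
apply: ler_sum => i _; rewrite unroll_nat (_ : size ys = size xs) ?size_xs ?size_ys //.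
have hm : ((i + s) %% size xs < n)%N by rewrite -[X in (_ < X)%N]size_xs ltn_mod size_xs.
have hy := necklace_nth hys hm; have hx := mod1_itv (nth 0 xs i + mod1 c).
rewrite -(even_norm_exp _ evp) -[leRHS](even_norm_exp _ evp).
apply: lerXn2r; rewrite ?nnegrE ?normr_ge0 //.
rewrite ger0_norm ?dcirc_ge0 //.
pose k := Num.floor (nth 0 xs i + mod1 c) + Num.floor c - ((i + s) %/ size xs)%:Z.
apply: le_trans (dcirc_le k hx hy) _; rewrite /k !(intrD, intrN) /mod1.
by rewrite le_eqVlt; apply/orP; left; apply/eqP; congr `|_|; ring.
Qed.

Lemma unroll_xsMD (k z : int) : unroll xs (z + k * n%:Z) = unroll xs z + k%:~R.
Proof. by rewrite -size_xs unrollMD ?size_xs. Qed.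

Lemma unroll_ysMD (k z : int) : unroll ys (z + k * n%:Z) = unroll ys z + k%:~R.
Proof. by rewrite -size_ys unrollMD ?size_ys. Qed.

(** Each circular distance is attained by some lift of the partner bead. These lifts have distinct
    indices modulo n, so [uncross] replaces them by a shift. *)
Lemma linear_le_circular c s : exists (s' : nat) (c' : R),
  (s' < n)%N /\ linear_cost p xs ys s'%:Z c' <= necklace_cost p xs ys c s.
Proof.
have hy (i : 'I_n) : 0 <= nth 0 ys ((i + s) %% n) < 1.
  by apply: necklace_nth hys _; rewrite ltn_mod.
have att (i : 'I_n) : exists k : int,
    dcirc (mod1 (nth 0 xs i + c)) (nth 0 ys ((i + s) %% n)) =
    `|nth 0 xs i + c - unroll ys (((i + s) %% n)%N%:Z + k * n%:Z)|.
  have [k ->] := dcirc_attained (mod1_itv (nth 0 xs i + c)) (hy i).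
  exists (k + Num.floor (nth 0 xs i + c)); rewrite unroll_ysMD unroll_small ?size_ys ?ltn_mod // intrD /mod1.
  by congr `|_|; ring.
have [k hk] := fin_all_exists att.
pose b (i : 'I_n) := ((i + s) %% n)%N%:Z + k i * n%:Z.
have inj (i j : 'I_n) : (b i = b j %[mod n%:Z])%Z -> i = j.
  rewrite /b ![_ + k _ * _]addrC !modzMDl !modz_nat !modn_mod => -[e].
  apply: val_inj => /=; have /eqP := e; rewrite eqn_modDr.
  by rewrite !modn_small // => /eqP.
have [||||||S hS] := @uncross R p n (fun z => unroll xs z + c) (unroll ys) _ _ _ _ _ _ b inj.
- exact: evp.
- exact: n0.
- by move=> z w /(unroll_homo n0 hxs) h; rewrite lerD2r.
- exact: unroll_homo hys.
- by move=> z; rewrite -[X in z + X]mul1r unroll_xsMD; ring.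
- by move=> z; rewrite -[X in z + X]mul1r unroll_ysMD.
have n0' : n%:Z != 0 by rewrite eqz_nat; lia.
(* Shifting by n beads is one full turn, so the quotient of [S] by n moves into the offset. *)
exists `|(S %% n%:Z)%Z|%N, (c - (S %/ n%:Z)%Z%:~R); split.
  by have := ltz_pmod S (_ : 0 < n%:Z); have := modz_ge0 S n0'; lia.
rewrite /linear_cost /necklace_cost size_xs.
move: hS; congr (_ <= _); apply: eq_bigr => i _; rewrite unroll_small ?size_xs //.
  rewrite gez0_abs ?modz_ge0 // {1}(divz_eq S n) addrCA addrC unroll_ysMD.
  by congr (_ ^+ _); rewrite [i%:Z + _]addrC; ring.
by rewrite hk even_norm_exp.
Qed.

(** The linear minimum bounds every circular cost from below, and the circular cost of its own
    offset is no larger than it: the two agree. *)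
Lemma linear_min_optimal c s v :
  (s < n)%N -> linear_cost p xs ys s%:Z c = v ->
  (forall s' c', (s' < n)%N -> v <= linear_cost p xs ys s'%:Z c') ->
  necklace_optimal p xs ys (mod1 c) s v.
Proof.
move=> hs hv hmin.
have low c' s' : v <= necklace_cost p xs ys c' s'.
  by have [s1 [c1 [h1 h2]]] := linear_le_circular c' s'; apply: le_trans (hmin s1 c1 h1) h2.
split; rewrite ?mod1_itv ?size_xs //.
by apply/eqP; rewrite eq_le low andbT -hv circular_le_linear.
Qed.

End Unrolling.

(** * The cost of a fixed shift as a polynomial in the offset *)

Section DividedPowers.
Variable R : numFieldType.

Definition dpow (x : R) (m : nat) : R := x ^+ m / m`!%:R.

Lemma fact_neq0 m : m`!%:R != 0 :> R.
Proof. by rewrite pnatr_eq0 -lt0n fact_gt0. Qed.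

Lemma dpow0 x : dpow x 0 = 1.
Proof. by rewrite /dpow expr0 divr1. Qed.

Lemma dpowS x m : dpow x m.+1 = dpow x m * x / m.+1%:R.
Proof.
by rewrite /dpow factS natrM exprSr invfM; move: (_^-1) (_^-1) => u v; ring.
Qed.

Lemma dpowD x y m : \sum_(i < m.+1) dpow x (m - i) * dpow y i = dpow (x + y) m.
Proof.
rewrite /dpow exprDn mulr_suml; apply: eq_bigr => i _.
have im : (i <= m)%N by rewrite -ltnS.
rewrite -(bin_fact im) !natrM -mulr_natr; field.
by rewrite !fact_neq0 pnatr_eq0 -lt0n bin_gt0 im.
Qed.

End DividedPowers.

(** * Moments as coefficients of convolutions *)

Section Moments.
Variables (R : realType) (n : nat) (xs ys : seq R).

Definition gap (s i : nat) : R := nth 0 xs i - unroll ys (i + s)%N%:Z.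

Definition moment (s m : nat) : R := \sum_(i < n) dpow (gap s i) m.

(** The same moments serve twice: m = p gives the cost of a shift and m = p - 1 its derivative. *)
Lemma sum_moment s c m :
  \sum_(i < m.+1) moment s (m - i) * dpow c i = \sum_(i < n) dpow (gap s i + c) m.
Proof.
under eq_bigr do rewrite mulr_suml.
by rewrite exchange_big /=; apply: eq_bigr => i _; rewrite dpowD.
Qed.

Definition pow_array (len : nat) (B : nat -> R) (a u : nat) : R :=
  if (u < len)%N then dpow (B u) a else 0.

Lemma size_pow_poly len B a N : (size (\poly_(i < N) pow_array len B a i) <= len)%N.
Proof.
apply/leq_sizeP => j hj; rewrite coef_poly /pow_array; case: ifP => // _.
by rewrite ltnNge hj.
Qed.

Lemma size_conv (m N : nat) (B1 B2 : nat -> R) :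
  (size (\sum_(a < m) (\poly_(i < N) pow_array n B1 a i *
     \poly_(i < N) pow_array (2 * n) B2 (m.-1 - a) i))%R <= 4 * n)%N.
Proof.
apply: leq_trans (size_sum _ _ _) _; apply/bigmax_leqP => a _.
apply: leq_trans (size_polyMleq _ _) _.
by have := size_pow_poly n B1 a N; have := size_pow_poly (2 * n) B2 (m.-1 - a) N; lia.
Qed.

(** Reversing x turns correlation into convolution: coefficient n - 1 + s pairs x_i with y_(i+s).
    Two periods of y make every shift below n available. *)
Lemma conv_moment (s m N : nat) (B1 B2 : nat -> R) :
  (s < n)%N -> (4 * n <= N)%N ->
  (forall i, (i < n)%N -> B1 i = nth 0 xs (n.-1 - i)) ->
  (forall i, (i < 2 * n)%N -> B2 i = - unroll ys i%:Z) ->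
  (\sum_(a < m.+1) (\poly_(i < N) pow_array n B1 a i *
     \poly_(i < N) pow_array (2 * n) B2 (m - a) i))`_(n.-1 + s) = moment s m.
Proof.
move=> hs hN h1 h2; rewrite coef_sum /moment.
transitivity (\sum_(a < m.+1) \sum_(i < n)
    dpow (- unroll ys (i + s)%N%:Z) (m - a) * dpow (nth 0 xs i) a).
  apply: eq_bigr => a _; rewrite coefM (reindex_inj rev_ord_inj) /=.
  have -> : (n.-1 + s).+1 = (s + n)%N by lia.
  (* After the reversal, the first s indices lie beyond the n entries of the first factor and
     contribute 0. *)
  rewrite big_split_ord /= big1 ?add0r => [|i _]; last first.
    have hi := ltn_ord i; rewrite coef_poly /pow_array [X in X * _](_ : _ = 0) ?mul0r //.
    by case: ifP => // _; rewrite ifF //; lia.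
  apply: eq_bigr => i _; have hi := ltn_ord i; rewrite !coef_poly /pow_array.
  have -> : (s + n - (s + i).+1 = n.-1 - i)%N by lia.
  have -> : (n.-1 + s - (n.-1 - i) = i + s)%N by lia.
  rewrite !ifT; try lia.
  by rewrite h1 ?h2; try lia; rewrite subKn; [ring | lia].
rewrite exchange_big /=; apply: eq_bigr => i _.
by rewrite dpowD /gap addrC.
Qed.

End Moments.

(** * The derivative of the cost of one shift and its roots *)

Section ShiftCost.
Variables (R : realType) (p n : nat) (xs ys : seq R).
Hypotheses (evp : ~~ odd p) (p0 : (0 < p)%N) (n0 : (0 < n)%N).
Hypotheses (hxs : necklace_input n xs) (hys : necklace_input n ys).

Local Notation gap := (gap xs ys).
Local Notation moment := (moment n xs ys).

Lemma linear_costE s c :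
  linear_cost p xs ys s%:Z c = \sum_(i < n) (gap s i + c) ^+ p.
Proof.
rewrite /linear_cost (size_xs hxs); apply: eq_bigr => i _; rewrite /gap PoszD.
by congr (_ ^+ _); ring.
Qed.

Lemma gap_itv s i : (s < n)%N -> (i < n)%N -> -2 < gap s i < 1.
Proof.
move=> hs hi; have hx := necklace_nth hxs hi.
have hm : ((i + s) %% n < n)%N by rewrite ltn_mod.
have hy := necklace_nth hys hm; rewrite /gap unroll_nat (size_ys hys).
have d1 : ((i + s) %/ n <= 1)%N by rewrite -ltnS ltn_divLR //; lia.
have d2 := ler0n R ((i + s) %/ n).
have d3 : ((i + s) %/ n)%:R <= 1%:R :> R by rewrite ler_nat.
lra.
Qed.

(** Coefficients of the derivative divided by p!. The zero in degree p is stored because the root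
    finder always receives p + 1 coefficients. *)
Definition slope_coef (s m : nat) : R :=
  if (m < p)%N then moment s (p.-1 - m) / m`!%:R else 0.

Definition slope (s : nat) : {poly R} := \poly_(m < p.+1) slope_coef s m.

Lemma slopeE s c : (slope s).[c] = \sum_(i < n) dpow (gap s i + c) p.-1.
Proof.
rewrite horner_poly big_ord_recr /= /slope_coef ltnn mul0r addr0.
rewrite -sum_moment prednK //; apply: eq_bigr => i _.
by rewrite ltn_ord /dpow; ring.
Qed.

Lemma odd_pred : odd p.-1.
Proof. by case: p evp p0 => //= p'; rewrite negbK. Qed.

Lemma dpow_odd_gt0 (x : R) m : odd m -> (0 < dpow x m) = (0 < x).
Proof.
move=> om; rewrite /dpow pmulr_lgt0 ?invr_gt0 ?ltr0n ?fact_gt0 //.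
by rewrite exprn_odd_gt0.
Qed.

Lemma dpow_odd_lt0 (x : R) m : odd m -> (dpow x m < 0) = (x < 0).
Proof.
move=> om; rewrite /dpow pmulr_llt0 ?invr_gt0 ?ltr0n ?fact_gt0 //.
by rewrite exprn_odd_lt0.
Qed.

Lemma slope_pos s c : (s < n)%N -> 2 <= c -> 0 < (slope s).[c].
Proof.
move=> hs hc; rewrite slopeE.
have pos (i : 'I_n) : 0 < dpow (gap s i + c) p.-1.
  by rewrite dpow_odd_gt0 ?odd_pred //; have := gap_itv hs (ltn_ord i); lra.
rewrite (bigD1 (Ordinal n0)) //=; apply: ltr_pwDl; first exact: (pos (Ordinal n0)).
by apply: sumr_ge0 => i _; apply: ltW.
Qed.

Lemma slope_neg s c : (s < n)%N -> c <= -1 -> (slope s).[c] < 0.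
Proof.
move=> hs hc; rewrite slopeE.
have neg (i : 'I_n) : dpow (gap s i + c) p.-1 < 0.
  by rewrite dpow_odd_lt0 ?odd_pred //; have := gap_itv hs (ltn_ord i); lra.
rewrite (bigD1 (Ordinal n0)) //=; apply: ltr_nwDl; first exact: (neg (Ordinal n0)).
by apply: sumr_le0 => i _; apply: ltW.
Qed.

Lemma head_rootsR (P : {poly R}) (x y : R) :
  P != 0 -> root P x -> root P (head y (rootsR P)).
Proof.
move=> P0 rx; have ro := roots_on_rootsR P0.
have : x \in rootsR P by rewrite -ro rx andbT in_itv.
case E : (rootsR P) => [//|r rs] _ /=.
have : r \in rootsR P by rewrite E mem_head.
by rewrite -ro => /andP[].
Qed.

(** All gaps lie in (-2, 1), so the slope is negative up to -1 and positive from 2 on. The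
    intermediate value theorem provides a root, so the default [y] is never returned, and every root
    lies in (-1, 2). *)
Lemma slope_root s y : (s < n)%N ->
  let c := head y (rootsR (slope s)) in root (slope s) c /\ -1 < c < 2.
Proof.
move=> hs c; have hp := slope_pos hs (lexx 2); have hn := slope_neg hs (lexx (-1)).
have D0 : slope s != 0 by apply/eqP => e; move: hp; rewrite e horner0 ltxx.
have ab : (-1 : R) <= 2 by lra.
have hnp : (slope s).[-1] <= 0 <= (slope s).[2] by rewrite (ltW hp) (ltW hn).
have [x _ rx] := poly_ivt ab hnp.
have rc : root (slope s) c := head_rootsR y D0 rx.
split=> //; apply/andP; split; rewrite ltNge; apply/negP => h.
- by have := slope_neg hs h; rewrite (rootP rc) ltxx.
- by have := slope_pos hs h; rewrite (rootP rc) ltxx.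
Qed.

(** In the sum of the tangent inequalities at c the linear terms add up to a multiple of the slope,
    which is 0. *)
Lemma slope_root_min s c c' : root (slope s) c ->
  linear_cost p xs ys s%:Z c <= linear_cost p xs ys s%:Z c'.
Proof.
move=> /rootP; rewrite slopeE !linear_costE => h0.
have h1 : \sum_(i < n) (gap s i + c) ^+ p.-1 = 0.
  have /eqP := h0; rewrite /dpow -mulr_suml mulf_eq0 invr_eq0 (negbTE (fact_neq0 _ _)).
  by rewrite orbF => /eqP.
apply: (@le_trans _ _ (\sum_(i < n)
    ((gap s i + c) ^+ p + p%:R * (gap s i + c) ^+ p.-1 * (c' - c)))).
  by rewrite big_split /= -mulr_suml -mulr_sumr h1 mulr0 mul0r addr0.
apply: ler_sum => i _; have := even_tangent evp (gap s i + c') (gap s i + c).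
by rewrite opprD addrACA subrr add0r.
Qed.

Lemma linear_cost_moment s c :
  linear_cost p xs ys s%:Z c = p`!%:R * \sum_(i < p.+1) moment s i * dpow c (p - i).
Proof.
rewrite (reindex_inj rev_ord_inj) /=.
under eq_bigr do rewrite subSS subKn -1?ltnS //.
rewrite sum_moment linear_costE mulr_sumr; apply: eq_bigr => i _.
by rewrite /dpow; field; apply: fact_neq0.
Qed.

End ShiftCost.

(** * The program *)

Declare Scope iexp_scope.
Declare Scope rexp_scope.
Declare Scope cmd_scope.
Delimit Scope iexp_scope with ie.
Delimit Scope rexp_scope with re.
Delimit Scope cmd_scope with cmd.
Bind Scope iexp_scope with iexp.
Bind Scope rexp_scope with rexp.
Bind Scope cmd_scope with cmd.
(** In programs a bare number denotes a variable; constants are marked by [ENat] and [XNat]. *)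
Coercion EVar : nat >-> iexp.
Coercion XVar : nat >-> rexp.
Notation "x + y" := (EAdd x y) : iexp_scope.
Notation "x - y" := (ESub x y) : iexp_scope.
Notation "x + y" := (XOp OAdd x y) : rexp_scope.
Notation "x - y" := (XOp OSub x y) : rexp_scope.
Notation "x * y" := (XOp OMul x y) : rexp_scope.
Notation "x / y" := (XOp ODiv x y) : rexp_scope.
Notation "c1 ;; c2" := (Seq c1 c2) (at level 90, right associativity) : cmd_scope.

(* Integer variables; on entry [vn] and [vp] hold n and p. *)
Notation vn := 0%N.
Notation vp := 1%N.
Notation vQ := 2%N.
Notation vH := 3%N.
Notation vN := 4%N.
Notation vk := 5%N.
Notation vi := 6%N.
Notation vr := 7%N.
Notation vv := 8%N.
Notation vG := 9%N.
Notation vm := 10%N.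
Notation vt := 11%N.
Notation va := 12%N.
Notation vq := 13%N.
Notation vaN := 14%N.
Notation vqN := 15%N.
Notation vs := 16%N.
Notation vx := 17%N.
Notation vbest := 18%N.

(* Arrays: input, parameter tree, transform buffers, current powers and their
   base values, transforms of the powers of x and y, moments, coefficients of
   the polynomial passed to the root finder, inverse factorials. *)
Notation aIN := 0%N.
Notation aTW := 1%N.
Notation aU := 2%N.
Notation aV := 3%N.
Notation aP := 4%N.
Notation aB := 5%N.
Notation aX := 6%N.
Notation aY := 7%N.
Notation aM := 8%N.
Notation aR := 9%N.
Notation aF := 10%N.

Local Open Scope cmd_scope.

Definition pow2_cmd : cmd :=
  SetI vG (ENat 1) ;; For vt vm (SetI vG (vG + vG)).

Definition copy_cmd : cmd := For vi vN (SetA aU vi (XArr aV vi)).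

(* Cycles [vv] through the nodes [vG], ..., 2 [vG] - 1. *)
Definition next_cmd : cmd :=
  SetI vv (vv + ENat 1) ;; IfI vv (vG + vG) Skip (SetI vv vG).

(** [fstage] in push form: turn i reads the entries at distance q once and writes the four outputs
    that share the parameter b. The shuffle does not work in place, so they go to [aV]. *)
Definition fwd_calc : cmd :=
  SetR 2 (XArr aTW (vv + vv)) ;;
  SetR 3 (XArr aU vi) ;;
  SetR 4 (XArr aU (vi + vQ)) ;;
  SetR 5 (XArr aU (vi + vH)) ;;
  SetR 6 (XArr aU (vi + vH + vQ)) ;;
  SetA aV (vi + vi) (3%N - 5%N + 2%N * 6%N) ;;
  SetA aV (vi + vi + ENat 1) (3%N - 5%N - 2%N * 6%N) ;;
  SetA aV (vi + vi + vH) (4%N - 2%N * 5%N + (2%N * 2%N - XNat 1) * 6%N) ;;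
  SetA aV (vi + vi + ENat 1 + vH) (4%N + 2%N * 5%N + (2%N * 2%N - XNat 1) * 6%N).

Definition fwd_body : cmd := fwd_calc ;; next_cmd.

Definition fwd_stage : cmd :=
  SetI vm vr ;; pow2_cmd ;; SetI vv vG ;; For vi vQ fwd_body ;; copy_cmd.

Definition fwd_cmd : cmd := For vr vk fwd_stage.

Definition inv_load : cmd :=
  SetR 2 (XArr aTW (vv + vv)) ;;
  SetR 3 (XArr aU (vi + vi)) ;;
  SetR 4 (XArr aU (vi + vi + ENat 1)) ;;
  SetR 5 (XArr aU (vi + vi + vH)) ;;
  SetR 6 (XArr aU (vi + vi + ENat 1 + vH)) ;;
  SetR 7 ((3%N - 4%N) / (XNat 2 * 2%N)) ;;
  SetR 8 ((6%N - 5%N) / (XNat 2 * 2%N)).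

Definition inv_store : cmd :=
  SetA aV vi ((3%N + 4%N) / XNat 2 + 8%N) ;;
  SetA aV (vi + vQ) ((5%N + 6%N) / XNat 2 - (2%N * 2%N - XNat 1) * 7%N) ;;
  SetA aV (vi + vH) 8%N ;;
  SetA aV (vi + vH + vQ) 7%N.

Definition inv_calc : cmd := inv_load ;; inv_store.

Definition inv_body : cmd := inv_calc ;; next_cmd.

(** Loops only count upwards, so turn r undoes stage k - 1 - r. *)
Definition inv_stage : cmd :=
  SetI vm (vk - ENat 1 - vr) ;; pow2_cmd ;; SetI vv vG ;;
  For vi vQ inv_body ;; copy_cmd.

Definition inv_cmd : cmd := For vr vk inv_stage.

(** * Correctness and cost of the transforms *)

Section Specifications.
Variable R : realType.
Implicit Types s : state R.

Lemma sem_seq c1 c2 s : sem (c1 ;; c2) s = sem c2 (sem c1 s).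
Proof. by []. Qed.

Lemma cost_seq c1 c2 s : cost (c1 ;; c2) s = (cost c1 s + cost c2 (sem c1 s))%N.
Proof. by []. Qed.

Lemma pow2_ok s :
  iv (sem pow2_cmd s) vG = (2 ^ iv s vm)%N /\
  (cost pow2_cmd s <= 14 * iv s vm + 10)%N.
Proof.
rewrite /pow2_cmd; set s1 := sem (SetI vG (ENat 1)) s.
have [h1 h2] := @for_ind R vt vm (SetI vG (vG + vG)) s1
  (fun t s' => iv s' vG = (2 ^ t)%N) 7 erefl
  (fun t s' _ _ _ _ _ h => ltac:(rewrite /= !updE /= h expnS; split; [lia|by []])).
have e : evI s1 vm = iv s vm by [].
rewrite e in h1 h2; split; first exact: h1.
rewrite cost_seq -/s1 [cost (SetI _ _) s]/=; move: h2; rewrite [lenI _]/=.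
move: (cost _ _) => ?; lia.
Qed.

Lemma copy_ok s :
  (forall u, (u < iv s vN)%N -> ar (sem copy_cmd s) aU u = ar s aV u) /\
  (cost copy_cmd s <= 26 * iv s vN + 5)%N.
Proof.
have [||h1 h2] := @for_ind R vi vN (SetA aU vi (XArr aV vi)) s
  (fun t s' => forall u, (u < t)%N -> ar s' aU u = ar s aV u) 20 _ _.
- by [].
- move=> t s' ht hi _ hA _ hs /=; split=> // u hu.
  rewrite !updE /= updE hi; case: eqP => [->|ne]; first by rewrite hA.
  by apply: hs; lia.
- split; first exact: h1.
  by move: h2; rewrite /=; lia.
Qed.

Lemma stage_index q u : (u < 4 * q)%N ->
  exists i (e e' : bool), (i < q)%N /\ u = (2 * i + e + e' * (2 * q))%N.
Proof.
move=> hu; exists ((u %% (2 * q))./2), (odd (u %% (2 * q))), (2 * q <= u)%N.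
have [lt|ge] := ltnP u (2 * q).
  by rewrite modn_small //; lia.
have -> : (u %% (2 * q) = u - 2 * q)%N by rewrite -{1}(subnK ge) modnDr modn_small //; lia.
lia.
Qed.

Lemma next_node r t g v : g = (2 ^ r)%N -> v = node r t ->
  (if (v + 1 < g + g)%N then v + 1 else g)%N = node r t.+1.
Proof.
move=> -> ->; rewrite /node; have p0 : (0 < 2 ^ r)%N by rewrite expn_gt0.
have h := ltn_pmod t p0; rewrite -[t.+1]addn1 -modnDml.
case: ltnP => h1; first by rewrite [in RHS]modn_small; lia.
have -> : (t %% 2 ^ r + 1 = 2 ^ r)%N by lia.
by rewrite modnn addn0.
Qed.

Definition fft_dims (q k : nat) s : Prop :=
  [/\ iv s vQ = q, iv s vH = (2 * q)%N, iv s vN = (4 * q)%N & iv s vk = k].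

Lemma next_ok s r t : iv s vG = (2 ^ r)%N -> iv s vv = node r t ->
  iv (sem next_cmd s) vv = node r t.+1.
Proof.
move=> hG hv; rewrite -(next_node hG hv) /= !updE /= hG hv.
by case: ifP; rewrite /= !updE /= ?hv ?hG.
Qed.

Lemma fwd_calc_ok s q k r t i (e e' : bool) : fft_dims q k s ->
  iv s vi = t -> iv s vv = node r t -> (t < q)%N -> (i < q)%N ->
  let u := (2 * i + e + e' * (2 * q))%N in
  ar (sem fwd_calc s) aV u =
    if i == t then fstage (ar s aTW) q r (ar s aU) u else ar s aV u.
Proof.
move=> [dQ dH dN dk] hi hn tq iq u.
rewrite /= !updE /= dQ dH hi hn.
have -> : (t + t = 2 * t)%N by lia.
have -> : (t + 2 * q + q = t + 3 * q)%N by lia.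
have -> : (node r t + node r t = 2 * node r t)%N by lia.
rewrite !updE; case: (eqVneq i t) => [it|ne]; last first.
  have h4 : [&& u != 2 * t, u != 2 * t + 1, u != 2 * t + 2 * q & u != 2 * t + 1 + 2 * q]%N.
    by rewrite /u; case: (e); case: (e'); apply/and4P; split; apply/eqP; lia.
  by case/and4P: h4 => /negbTE-> /negbTE-> /negbTE-> /negbTE->.
rewrite /u it; clear u; case: e'; rewrite ?mul1n ?mul0n ?addn0.
  rewrite fstage_hi //; case: e; rewrite ?addn0.
    by rewrite eqxx mulNr opprK.
  rewrite eqxx; case: eqP => [?|_ //]; lia.
rewrite fstage_lo //; case: e; rewrite ?addn0.
  case: eqP => [?|_]; first lia.
  by case: eqP => [?|_]; [lia | rewrite eqxx mulNr].
by do 3?[case: eqP => [?|_]; first lia]; rewrite eqxx.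
Qed.

Lemma fwd_loop_ok s q k r : fft_dims q k s -> iv s vG = (2 ^ r)%N -> iv s vv = (2 ^ r)%N ->
  (forall u, (u < 4 * q)%N ->
     ar (sem (For vi vQ fwd_body) s) aV u = fstage (ar s aTW) q r (ar s aU) u) /\
  (cost (For vi vQ fwd_body) s <= 400 * q + 5)%N.
Proof.
move=> dims hG hv; have [dQ dH dN dk] := dims.
have [||h1 h2] := @for_ind R vi vQ fwd_body s (fun t s' => iv s' vv = node r t /\
  forall i (e e' : bool), (i < t)%N ->
    let u := (2 * i + e + e' * (2 * q))%N in
    ar s' aV u = fstage (ar s aTW) q r (ar s aU) u) 300 _ _.
- by split=> //; rewrite /= updE /= hv /node mod0n addn0.
- move=> t s' ht hi hI hA hS [hn hV]; rewrite [evI _ _]/= dQ in ht.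
  have iG : iv s' vG = (2 ^ r)%N by rewrite hI.
  have dims' : fft_dims q k s' by split; rewrite hI.
  split; last by [].
  split; first by rewrite [iv _ _]/= updE /= (@next_ok (sem fwd_calc s') r t).
  move=> i e e' hit u; rewrite [ar _ _]/= -/(sem fwd_calc s') (sem_ar (c := next_cmd)) //.
  rewrite (fwd_calc_ok e e' dims' hi hn) //; last by lia.
  rewrite (hA aTW) // (hA aU) //; case: (eqVneq i t) => // ne.
  by apply: hV; lia.
- split; last by move: h2; rewrite [evI _ _]/= dQ [lenI _]/=; lia.
  move=> u /stage_index[i [e [e' [iq ->]]]].
  by case: h1 => _; apply; rewrite [evI _ _]/= dQ.
Qed.

Lemma inv_calc_ok s q k r t i e : fft_dims q k s ->
  iv s vi = t -> iv s vv = node r t -> (t < q)%N -> (i < q)%N -> (e < 4)%N ->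
  let u := (i + e * q)%N in
  ar (sem inv_calc s) aV u =
    if i == t then istage (ar s aTW) q r (ar s aU) u else ar s aV u.
Proof.
move=> [dQ dH dN dk] hi hn tq iq e4 u.
rewrite /inv_calc sem_seq; set s1 := sem inv_load s.
pose b := ar s aTW (2 * node r t); pose e0 := ar s aU (2 * t).
pose e1 := ar s aU (2 * t + 1); pose g0 := ar s aU (2 * t + 2 * q).
pose g1 := ar s aU (2 * t + 1 + 2 * q).
have t2 : (t + t = 2 * t)%N by lia.
have n2 : (node r t + node r t = 2 * node r t)%N by lia.
have [i1 a1] : iv s1 = iv s /\ ar s1 = ar s by [].
have c2 : sc s1 2 = b by rewrite /= !updE /= hn n2.
have c3 : sc s1 3 = e0 by rewrite /= !updE /= hi t2.
have c4 : sc s1 4 = e1 by rewrite /= !updE /= hi t2.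
have c5 : sc s1 5 = g0 by rewrite /= !updE /= hi t2 dH.
have c6 : sc s1 6 = g1 by rewrite /= !updE /= hi t2 dH.
have c7 : sc s1 7 = (e0 - e1) / (2 * b) by rewrite -c2 -c3 -c4.
have c8 : sc s1 8 = (g1 - g0) / (2 * b) by rewrite -c2 -c5 -c6.
clearbody s1; rewrite /= !updE /= i1 a1 dQ dH hi c2 c3 c4 c5 c6 c7 c8.
have -> : (t + 2 * q + q = t + 3 * q)%N by lia.
clear c2 c3 c4 c5 c6 c7 c8; rewrite {}/b {}/e0 {}/e1 {}/g0 {}/g1.
have um : (u %% q = i)%N by rewrite /u addnC modnMDl modn_small.
have ud : (u %/ q = e)%N by rewrite /u addnC divnMDl ?divn_small ?addn0 //; lia.
have nodeE : node r (u %% q) = node r i by rewrite um.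
rewrite /istage ud um !updE; case: (eqVneq i t) => [it|ne]; last first.
  have h4 : [&& u != t, u != t + q, u != t + 2 * q & u != t + 3 * q]%N.
    by move: e4; rewrite /u; case: (e) => [|[|[|[|//]]]] _; apply/and4P; split; apply/eqP; lia.
  by case/and4P: h4 => /negbTE-> /negbTE-> /negbTE-> /negbTE->.
move: e4; rewrite /u it; clear u um ud nodeE; case: e => [|[|[|[|//]]]] _.
- by do 3?[case: eqP => [?|_]; first lia]; rewrite mul0n addn0 eqxx.
- by do 2?[case: eqP => [?|_]; first lia]; rewrite mul1n eqxx.
- by case: eqP => [?|_]; [lia | rewrite eqxx].
- by rewrite eqxx.
Qed.

Lemma inv_loop_ok s q k r : fft_dims q k s -> iv s vG = (2 ^ r)%N -> iv s vv = (2 ^ r)%N ->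
  (forall u, (u < 4 * q)%N ->
     ar (sem (For vi vQ inv_body) s) aV u = istage (ar s aTW) q r (ar s aU) u) /\
  (cost (For vi vQ inv_body) s <= 400 * q + 5)%N.
Proof.
move=> dims hG hv; have [dQ dH dN dk] := dims.
have [||h1 h2] := @for_ind R vi vQ inv_body s (fun t s' => iv s' vv = node r t /\
  forall i e, (i < t)%N -> (e < 4)%N ->
    ar s' aV (i + e * q)%N = istage (ar s aTW) q r (ar s aU) (i + e * q)) 350 _ _.
- by split=> //; rewrite /= updE /= hv /node mod0n addn0.
- move=> t s' ht hi hI hA hS [hn hV]; rewrite [evI _ _]/= dQ in ht.
  have iG : iv s' vG = (2 ^ r)%N by rewrite hI.
  have dims' : fft_dims q k s' by split; rewrite hI.
  split; last by [].
  split; first by rewrite [iv _ _]/= updE /= (@next_ok (sem inv_calc s') r t).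
  move=> i e hit e4; rewrite [ar _ _]/= -/(sem inv_calc s') (sem_ar (c := next_cmd)) //.
  rewrite (inv_calc_ok dims' hi hn) //; last by lia.
  rewrite (hA aTW) // (hA aU) //; case: (eqVneq i t) => // ne.
  by apply: hV; lia.
- split; last by move: h2; rewrite [evI _ _]/= dQ [lenI _]/=; lia.
  move=> u hu; rewrite (divn_eq u q) addnC.
  case: h1 => _; rewrite [evI _ _]/= dQ; apply; first by apply: ltn_pmod; lia.
  by rewrite ltn_divLR //; lia.
Qed.

(** Every stage recomputes 2^r by r doublings; r < q hides this in the linear cost. *)
Lemma fwd_stage_ok s q k r : fft_dims q k s -> iv s vr = r -> (r < q)%N ->
  (forall u, (u < 4 * q)%N ->
     ar (sem fwd_stage s) aU u = fstage (ar s aTW) q r (ar s aU) u) /\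
  (cost fwd_stage s <= 600 * q)%N.
Proof.
move=> dims hr rq; rewrite /fwd_stage 4!sem_seq 4!cost_seq.
set s1 := sem (SetI vm vr) s; set s2 := sem pow2_cmd s1; set s3 := sem (SetI vv vG) s2.
have [p1 p2] := pow2_ok s1; rewrite -/s2 in p1.
have m1 : iv s1 vm = r by rewrite -hr.
have i2 v : v \notin [:: vm; vG; vt] -> iv s2 v = iv s v.
  move=> hv; rewrite (sem_iv (c := SetI vm vr ;; pow2_cmd)) //.
  by move: hv; rewrite /= !inE !negb_or => /and3P[-> -> ->].
have dims3 : fft_dims q k s3.
  by case: dims => *; split; rewrite [iv _ _]/= -/s2 updE /= i2.
have g3 : iv s3 vG = (2 ^ r)%N by rewrite [iv _ _]/= -/s2 updE /= p1 m1.
have v3 : iv s3 vv = (2 ^ r)%N by rewrite [iv _ _]/= -/s2 updE /= p1 m1.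
have [h1 h2] := fwd_loop_ok dims3 g3 v3.
set s4 := sem (For _ _ _) s3 in h1 *.
have [c1 c2] := copy_ok s4.
have n4 : iv s4 vN = (4 * q)%N by rewrite sem_iv //; case: dims3.
rewrite n4 in c1 c2; split.
  have a3 j : ar s3 j = ar s j by exact: (@sem_ar _ (SetI vm vr ;; pow2_cmd ;; SetI vv vG)).
  by move=> u hu; rewrite c1 // h1 // !a3.
have k1 : cost (SetI vm vr) s = 4 by [].
have k2 : cost (SetI vv vG) s2 = 4 by [].
move: p2; rewrite m1 k1 k2.
move: (cost _ _) (cost _ _) (cost _ _) h2 c2 => ? ? ?; lia.
Qed.

Lemma inv_stage_ok s q k r : fft_dims q k s -> iv s vr = (k - 1 - r)%N -> (r < k <= q)%N ->
  (forall u, (u < 4 * q)%N ->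
     ar (sem inv_stage s) aU u = istage (ar s aTW) q r (ar s aU) u) /\
  (cost inv_stage s <= 600 * q)%N.
Proof.
move=> dims hr rq; rewrite /inv_stage 4!sem_seq 4!cost_seq.
set s1 := sem (SetI vm _) s; set s2 := sem pow2_cmd s1; set s3 := sem (SetI vv vG) s2.
have [p1 p2] := pow2_ok s1; rewrite -/s2 in p1.
have m1 : iv s1 vm = r.
  by case: dims => _ _ _ dk; rewrite [iv _ _]/= updE /= dk hr; lia.
have i2 v : v \notin [:: vm; vG; vt] -> iv s2 v = iv s v.
  move=> hv; rewrite (sem_iv (c := SetI vm (vk - ENat 1 - vr) ;; pow2_cmd)) //.
  by move: hv; rewrite /= !inE !negb_or => /and3P[-> -> ->].
have dims3 : fft_dims q k s3.
  by case: dims => *; split; rewrite [iv _ _]/= -/s2 updE /= i2.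
have g3 : iv s3 vG = (2 ^ r)%N by rewrite [iv _ _]/= -/s2 updE /= p1 m1.
have v3 : iv s3 vv = (2 ^ r)%N by rewrite [iv _ _]/= -/s2 updE /= p1 m1.
have [h1 h2] := inv_loop_ok dims3 g3 v3.
set s4 := sem (For _ _ _) s3 in h1 *.
have [c1 c2] := copy_ok s4.
have n4 : iv s4 vN = (4 * q)%N by rewrite sem_iv //; case: dims3.
rewrite n4 in c1 c2; split.
  have a3 j : ar s3 j = ar s j.
    exact: (@sem_ar _ (SetI vm (vk - ENat 1 - vr) ;; pow2_cmd ;; SetI vv vG)).
  by move=> u hu; rewrite c1 // h1 // !a3.
have k1 : cost (SetI vm (vk - ENat 1 - vr)) s = 15 by [].
have k2 : cost (SetI vv vG) s2 = 4 by [].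
move: p2; rewrite m1 k1 k2.
move: (cost _ _) (cost _ _) (cost _ _) h2 c2 => ? ? ?; lia.
Qed.

Lemma fwd_ok s q k : fft_dims q k s -> (k <= q)%N ->
  (forall u, (u < 4 * q)%N ->
     ar (sem fwd_cmd s) aU u = fft (ar s aTW) q k (ar s aU) u) /\
  (cost fwd_cmd s <= k * (600 * q + 6) + 5)%N.
Proof.
move=> dims kq; have [dQ dH dN dk] := dims.
have [||h1 h2] := @for_ind R vr vk fwd_stage s (fun t s' => forall u, (u < 4 * q)%N ->
    ar s' aU u = fft (ar s aTW) q t (ar s aU) u) (600 * q) _ _; first by [].
  move=> t s' ht hr hI hA hS hU; rewrite [evI _ _]/= dk in ht.
  have dims' : fft_dims q k s' by split; rewrite hI.
  have [a1 a2] := fwd_stage_ok dims' hr (leq_trans ht kq); split=> // u hu.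
  rewrite [ar _ _]/= a1 // (hA aTW) // [RHS]/=; exact: eq_fstage.
rewrite [evI _ _]/= dk in h1 h2; split; first exact: h1.
by move: h2; rewrite [lenI _]/=; move: (cost _ _) => ?; lia.
Qed.

Lemma inv_ok s q k : fft_dims q k s -> (k <= q)%N ->
  (forall u, (u < 4 * q)%N ->
     ar (sem inv_cmd s) aU u = ifft (ar s aTW) q k (ar s aU) u) /\
  (cost inv_cmd s <= k * (600 * q + 6) + 5)%N.
Proof.
move=> dims kq; have [dQ dH dN dk] := dims.
(* Invariant: the k - t inverse stages still to come, applied to the buffer, give the final
   result. *)
have [||h1 h2] := @for_ind R vr vk inv_stage s (fun t s' => forall u, (u < 4 * q)%N ->
    ifft (ar s aTW) q (k - t) (ar s' aU) u = ifft (ar s aTW) q k (ar s aU) u) (600 * q) _ _.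
- by rewrite subn0.
- move=> t s' ht hr hI hA hS hU; rewrite [evI _ _]/= dk in ht.
  have dims' : fft_dims q k s' by split; rewrite hI.
  have hr' : iv s' vr = (k - 1 - (k - t.+1))%N by rewrite hr; lia.
  have [|a1 a2] := inv_stage_ok dims' hr'; first by lia.
  split=> // u hu; rewrite -hU // (_ : (k - t = (k - t.+1).+1)%N); last by lia.
  rewrite [in RHS]/=; apply: eq_ifft => // w hw.
  by rewrite [ar _ _]/= a1 // (hA aTW).
rewrite [evI _ _]/= dk subnn in h1 h2; split; first exact: h1.
by move: h2; rewrite [lenI _]/=; move: (cost _ _) => ?; lia.
Qed.

End Specifications.

(** * Sizes, parameter tree, factorials and base values *)

Definition dims_cmd : cmd :=
  SetI vQ (ENat 1) ;; SetI vk (ENat 1) ;;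
  For vi vn (IfI vQ vn (SetI vQ (vQ + vQ) ;; SetI vk (vk + ENat 1)) Skip) ;;
  SetI vH (vQ + vQ) ;; SetI vN (vH + vH).

(** The polynomial is X^2 + a - 2; only its constant term changes from node to node. Whichever
    square root is returned, the sibling receives its negative. *)
Definition tree_body : cmd :=
  SetA aR (ENat 0) (XArr aTW (vi + ENat 1) - XNat 2) ;;
  SetRoot 2 aR ;;
  SetA aTW (vi + ENat 1 + (vi + ENat 1)) 2%N ;;
  SetA aTW (vi + ENat 1 + (vi + ENat 1) + ENat 1) (XNat 0 - 2%N).

Definition zero_cmd : cmd := For vi (vp + ENat 1) (SetA aR vi (XNat 0)).

Definition tree_cmd : cmd :=
  zero_cmd ;; SetA aR (ENat 2) (XNat 1) ;; SetA aTW (ENat 1) (XNat 0) ;;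
  For vi (vH - ENat 1) tree_body.

Definition fact_cmd : cmd :=
  SetA aF (ENat 0) (XNat 1) ;;
  For vi vp (SetA aF (vi + ENat 1) (XArr aF vi / XOfI (vi + ENat 1))).

(** x is stored reversed, and y below is stored negated over two periods, as [conv_moment]
    requires. *)
Definition basex_cmd : cmd := For vi vn (SetA aB vi (XArr aIN (vn - ENat 1 - vi))).

Definition basey_cmd : cmd :=
  For vi vn (SetA aB vi (XNat 0 - XArr aIN (vn + vi)) ;;
             SetA aB (vn + vi) (XNat 0 - XArr aIN (vn + vi) - XNat 1)).

Section SetupSpecifications.
Variable R : realType.
Implicit Types s : state R.

(** K + 1 stages lead from degree 4 * 2^K down to the quadratic leaves. *)
Lemma dims_ok s n : iv s vn = n -> (0 < n)%N ->
  (exists K, [/\ fft_dims (2 ^ K) K.+1 (sem dims_cmd s), n <= 2 ^ K & 2 ^ K < 2 * n]%N) /\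
  (cost dims_cmd s <= 50 * n + 50)%N.
Proof.
move=> hn n0; rewrite /dims_cmd 4!sem_seq 4!cost_seq.
set s1 := sem (SetI vk _) _.
have n1 : iv s1 vn = n by rewrite -hn.
(* A size that has not yet reached n exceeds the number of turns made, as it doubled in each; hence
   n turns suffice. *)
have [||h1 h2] := @for_ind R vi vn (IfI vQ vn (SetI vQ (vQ + vQ) ;; SetI vk (vk + ENat 1)) Skip) s1
  (fun t s' => exists K, [/\ iv s' vQ = 2 ^ K, iv s' vk = K.+1, 2 ^ K < 2 * n
     & (n <= 2 ^ K) || (t < 2 ^ K)]%N) 30 _ _.
- by exists 0%N; split=> //; rewrite expn0; lia.
- move=> t s' ht hi hI hA hS [K [hQ hk lt2 hor]].
  have n' : iv s' vn = n by rewrite hI.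
  split=> //; rewrite /= !updE /= n' hQ.
  case: ltnP => cmp; last by exists K; rewrite /= cmp hQ hk.
  exists K.+1; rewrite /= !updE /= hk addn1 expnS; split=> //; lia.
have e1 : evI s1 vn = n := n1.
set s2 := sem (For _ _ _) s1 in h1 *; rewrite e1 in h1 h2.
split; last first.
  have k1 : cost (SetI vQ (ENat 1)) s = 3 by [].
  have k2 : cost (SetI vk (ENat 1)) (sem (SetI vQ (ENat 1)) s) = 3 by [].
  have k3 : cost (SetI vH (vQ + vQ)) s2 = 7 by [].
  have k4 : cost (SetI vN (vH + vH)) (sem (SetI vH (vQ + vQ)) s2) = 7 by [].
  rewrite k1 k2 k3 k4.
  by move: h2; rewrite [lenI _]/=; move: (cost _ s1) => ?; lia.
have [K [hQ hk lt2 hor]] := h1; exists K; split=> //; last by move: hor; lia.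
by split; rewrite [iv _ _]/= !updE /= ?updE /= ?hQ ?hk //; lia.
Qed.

Lemma zero_ok s p : iv s vp = p ->
  (forall u, (u < p.+1)%N -> ar (sem zero_cmd s) aR u = 0) /\
  (cost zero_cmd s <= 30 * p.+1 + 10)%N.
Proof.
move=> hp.
have [||h1 h2] := @for_ind R vi (vp + ENat 1) (SetA aR vi (XNat 0)) s
  (fun t s' => forall u, (u < t)%N -> ar s' aR u = 0) 11 _ _; first by [].
  move=> t s' ht hi hI hA hS hU; split=> // u hu /=.
  by rewrite !updE /= updE hi; case: eqP => // ne; apply: hU; lia.
have e : evI s (vp + ENat 1)%ie = p.+1 by rewrite /= hp addn1.
rewrite e in h1 h2; split; first exact: h1.
by move: h2; rewrite [lenI _]/= /zero_cmd; move: (cost _ _) => ?; lia.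
Qed.

(** p >= 2 makes room for a quadratic among the p + 1 coefficients, and a < 2 gives it a real root,
    so [y] is not returned. *)
Lemma quad_root (y a : R) (P : nat -> R) p : (2 <= p)%N -> a * a < 4 ->
  (forall u, (u < p.+1)%N -> P u = if u == 0%N then a - 2 else if u == 2%N then 1 else 0) ->
  let b := head y (rootsR (\poly_(m < p.+1) P m)) in b * b = 2 - a.
Proof.
move=> p2 ha hP b.
have PE : \poly_(m < p.+1) P m = 'X^2 + (a - 2)%:P.
  apply/polyP => i; rewrite coef_poly coefD coefXn coefC; case: ltnP => hi.
    rewrite hP //; case: eqP => [->|_]; first by rewrite add0r.
    by rewrite addr0; case: eqP.
  by case: eqP => [?|_]; [lia | case: eqP => [?|_]; [lia | rewrite addr0]].
have P0 : 'X^2 + (a - 2)%:P != 0 :> {poly R}.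
  by apply/eqP => /(congr1 (fun q : {poly R} => q`_2)); rewrite coefD coefXn coefC coef0 /= addr0 => /eqP; rewrite oner_eq0.
have a2 : 0 <= 2 - a by rewrite subr_ge0 leNgt; apply/negP => h; nra.
have rx : root ('X^2 + (a - 2)%:P) (Num.sqrt (2 - a)).
  by rewrite /root hornerD hornerXn hornerC sqr_sqrtr //; apply/eqP; ring.
have := head_rootsR y P0 rx; rewrite -PE -/b => /rootP.
by rewrite PE hornerD hornerXn hornerC expr2 => /eqP; rewrite addr_eq0 => /eqP->; ring.
Qed.

Lemma tree_body_ok s p i : iv s vp = p -> iv s vi = i ->
  let r := root_val (sem (SetA aR (ENat 0) (XArr aTW (vi + ENat 1) - XNat 2)) s) aR in
  (forall u, ar (sem tree_body s) aTW u =
     if u == (2 * i + 3)%N then - r else if u == (2 * i + 2)%N then r else ar s aTW u) /\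
  (forall u, (u != 0)%N -> ar (sem tree_body s) aR u = ar s aR u).
Proof.
move=> hp <- r; split=> [u|u u0]; rewrite /= !updE /= !updE /=.
  have -> : (iv s vi + 1 + (iv s vi + 1) + 1 = 2 * iv s vi + 3)%N by lia.
  have -> : (iv s vi + 1 + (iv s vi + 1) = 2 * iv s vi + 2)%N by lia.
  by rewrite sub0r.
by rewrite (negbTE u0).
Qed.

Lemma tree_ok_cmd s p q : iv s vp = p -> (2 <= p)%N -> iv s vH = (2 * q)%N -> (0 < q)%N ->
  tree_ok (2 * q) (ar (sem tree_cmd s) aTW) /\
  (cost tree_cmd s <= 400 * (q * p.+1))%N.
Proof.
move=> hp p2 hH q0; rewrite /tree_cmd 3!sem_seq 3!cost_seq.
set s1 := sem zero_cmd s; set s2 := sem _ s1; set s3 := sem _ s2.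
have [z1 z2] := zero_ok hp; rewrite -/s1 in z1.
have hp3 : iv s3 vp = p by rewrite -hp; exact: (@sem_iv _ zero_cmd).
have hH3 : iv s3 vH = (2 * q)%N by rewrite -hH; exact: (@sem_iv _ zero_cmd).
have e3 : evI s3 (vH - ENat 1)%ie = (2 * q - 1)%N by rewrite /= -/s3 hH3.
pose Inv t s' := [/\ forall u, (0 < u < p.+1)%N -> ar s' aR u = if u == 2%N then 1 else 0,
    ar s' aTW 1%N = 0,
    forall v, (0 < v <= t)%N -> ar s' aTW (2 * v)%N * ar s' aTW (2 * v)%N = 2 - ar s' aTW v
       /\ ar s' aTW (2 * v).+1 = - ar s' aTW (2 * v)%N
  & forall v, (0 < v < 2 * t + 2)%N -> ar s' aTW v * ar s' aTW v < 4].
have [||h1 h2] := @for_ind R vi (vH - ENat 1) tree_body s3 Inv (10 * p.+1 + 100) _ _.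
- split.
  + move=> u /andP[u0 up]; transitivity (if u == 2%N then 1 else ar s1 aR u) => //.
    by case: eqP => // _; rewrite z1.
  + by [].
  + by move=> v; lia.
  + move=> v hv; have -> : v = 1%N by lia.
    by rewrite (_ : ar _ _ _ = 0) // mul0r.
- move=> t s' ht hi hI hA hS [i1 i2 i3 i4].
  have hp' : iv s' vp = p by rewrite hI.
  split; last by rewrite /= hp'; lia.
  have [b1 b2] := tree_body_ok hp' hi; set r := root_val _ _ in b1.
  have bt u : ar (set_iv (sem tree_body s') vi t.+1) aTW u =
    if u == (2 * t + 3)%N then - r else if u == (2 * t + 2)%N then r else ar s' aTW u.
    by rewrite -b1.
  have old u : (u < 2 * t + 2)%N -> ar (set_iv (sem tree_body s') vi t.+1) aTW u = ar s' aTW u.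
    by move=> hu; rewrite bt !ltn_eqF //; lia.
  have rr : r * r = 2 - ar s' aTW t.+1.
    rewrite /r /root_val; set y := ar _ _ 0%N.
    rewrite [iv _ _]/= hp'; apply: (@quad_root y (ar s' aTW t.+1)) => //.
      by apply: i4; lia.
    move=> u hu; rewrite /= !updE /= updE hi addn1; case: eqP => // ne.
    by apply: i1; lia.
  have a4 : ar s' aTW t.+1 * ar s' aTW t.+1 < 4 by apply: i4; lia.
  (* r^2 = 2 - a with a > -2, so the strict bound passes to the children. *)
  have r4 : r * r < 4 by nra.
  split.
  + by move=> u hu; rewrite -i1 // -(b2 u) //; lia.
  + by rewrite old //; lia.
  + move=> v hv; have [vt|vt] := eqVneq v t.+1.
      rewrite vt !bt; have -> : (t.+1 == 2 * t + 3)%N = false by apply/eqP; lia.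
      have -> : (t.+1 == 2 * t + 2)%N = false by apply/eqP; lia.
      have -> : (2 * t.+1 == 2 * t + 3)%N = false by apply/eqP; lia.
      have -> : (2 * t.+1 == 2 * t + 2)%N = true by apply/eqP; lia.
      have -> : ((2 * t.+1).+1 == 2 * t + 3)%N = true by apply/eqP; lia.
      by rewrite rr.
    by rewrite !old; try lia; apply: i3; lia.
  + move=> v hv; rewrite bt; case: eqP => ne'; first by rewrite mulrNN.
    by case: eqP => // ne; apply: i4; lia.
set s4 := sem (For _ _ _) s3 in h1 *; rewrite e3 in h1 h2; split.
  have [i1 i2 i3 i4] := h1; split=> //.
    by move=> v hv; apply: i3; lia.
  by move=> v hv; apply: i4; lia.
have k1 : cost (SetA aR (ENat 2) (XNat 1)) s1 = 10 by [].
have k2 : cost (SetA aTW (ENat 1) (XNat 0)) s2 = 10 by [].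
rewrite k1 k2; move: h2 z2; rewrite [lenI _]/=; move: (cost _ _) (cost _ _) => c1 c2.
have := leq_mul (leqnn p.+1) q0; nia.
Qed.

Lemma fact_ok s p : iv s vp = p ->
  (forall j, (j < p.+1)%N -> ar (sem fact_cmd s) aF j = j`!%:R^-1) /\
  (cost fact_cmd s <= 60 * p.+1)%N.
Proof.
move=> hp; rewrite /fact_cmd sem_seq cost_seq; set s1 := sem _ s.
have e : evI s1 vp = p by rewrite -hp.
have [||h1 h2] := @for_ind R vi vp (SetA aF (vi + ENat 1) (XArr aF vi / XOfI (vi + ENat 1))) s1
  (fun t s' => forall j, (j < t.+1)%N -> ar s' aF j = j`!%:R^-1) 40 _ _.
- by move=> [|j] // _; rewrite /= !updE /= fact0 invr1.
- move=> t s' ht hi hI hA hS hF; split=> // j hj /=.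
  rewrite !updE /= updE hi; case: eqP => [->|ne]; last by apply: hF; lia.
  by rewrite hF // addn1 factS natrM invfM mulrC.
rewrite e in h1 h2; split; first exact: h1.
by move: h2; rewrite [lenI _]/= [cost (SetA _ _ _) s]/=; move: (cost _ _) => ?; lia.
Qed.

Lemma basex_ok s n : iv s vn = n ->
  (forall u, (u < n)%N -> ar (sem basex_cmd s) aB u = ar s aIN (n.-1 - u)%N) /\
  (cost basex_cmd s <= 60 * n + 10)%N.
Proof.
move=> hn.
have [||h1 h2] := @for_ind R vi vn (SetA aB vi (XArr aIN (vn - ENat 1 - vi))) s
  (fun t s' => forall u, (u < t)%N -> ar s' aB u = ar s aIN (n.-1 - u)%N) 40 _ _; first by [].
  move=> t s' ht hi hI hA hS hU; split=> // u hu /=.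
  have n' : iv s' vn = n by rewrite hI.
  rewrite !updE /= updE hi n'; case: eqP => [->|ne]; first by rewrite hA // subn1.
  by apply: hU; lia.
rewrite [evI _ _]/= hn in h1 h2; split; first exact: h1.
by move: h2; rewrite [lenI _]/= /basex_cmd; move: (cost _ _) => ?; lia.
Qed.

Lemma basey_ok s n : iv s vn = n ->
  (forall u, (u < n)%N -> ar (sem basey_cmd s) aB u = - ar s aIN (n + u)%N /\
     ar (sem basey_cmd s) aB (n + u)%N = - ar s aIN (n + u)%N - 1) /\
  (cost basey_cmd s <= 100 * n + 10)%N.
Proof.
move=> hn.
have [||h1 h2] := @for_ind R vi vn (SetA aB vi (XNat 0 - XArr aIN (vn + vi)) ;;
             SetA aB (vn + vi) (XNat 0 - XArr aIN (vn + vi) - XNat 1)) s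
  (fun t s' => forall u, (u < t)%N -> ar s' aB u = - ar s aIN (n + u)%N /\
     ar s' aB (n + u)%N = - ar s aIN (n + u)%N - 1) 80 _ _; first by [].
  move=> t s' ht hi hI hA hS hU; split=> // u hu /=.
  have n' : iv s' vn = n by rewrite hI.
  rewrite [evI _ _]/= hn in ht.
  rewrite !updE /= ?updE /= ?updE hi n' hA // eqn_add2l !sub0r.
  have -> : (u == n + t)%N = false by apply/eqP; lia.
  have -> : (n + u == t)%N = false by apply/eqP; lia.
  by case: eqP => [->//|ne]; apply: hU; lia.
rewrite [evI _ _]/= hn in h1 h2; split; first exact: h1.
by move: h2; rewrite [lenI _]/= /basey_cmd; move: (cost _ _) => ?; lia.
Qed.

End SetupSpecifications.

(** * Transforms of all divided powers *)

Definition powers_body (F : nat) : cmd :=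
  For vi vN (SetA aU vi (XArr aP vi)) ;;
  fwd_cmd ;;
  For vi vN (SetA F (vaN + vi) (XArr aU vi)) ;;
  For vi vN (SetA aP vi (XArr aP vi * XArr aB vi / XOfI (va + ENat 1))) ;;
  SetI vaN (vaN + vN).

(** Power 0 is 1 on the first [len] entries and 0 beyond; the zeros survive every multiplication,
    whatever [aB] holds there. [vaN] follows a * 4 q by repeated addition. *)
Definition powers_cmd (len : iexp) (F : nat) : cmd :=
  For vi vN (SetA aP vi (XNat 0)) ;;
  For vi len (SetA aP vi (XNat 1)) ;;
  SetI vaN (ENat 0) ;;
  For va (vp + ENat 1) (powers_body F).

Lemma lenE :
  (forall v, lenI (EVar v) = 2) * (forall m, lenI (ENat m) = 1) *
  (forall e e', lenI (EAdd e e') = lenI e + lenI e' + 1) *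
  (forall e e', lenI (ESub e e') = lenI e + lenI e' + 4) *
  (forall v, lenR (XVar v) = 2) * (forall m, lenR (XNat m) = 1) *
  (forall k e, lenR (XArr k e) = lenI e + 8) *
  (forall e, lenR (XOfI e) = lenI e + 1) *
  (forall o e e', lenR (XOp o e e') = lenR e + lenR e' + 1)%N.
Proof. by []. Qed.

Section PowersSpecifications.
Variable R : realType.
Implicit Types s : state R.

Lemma ar_set_iv s v m : ar (set_iv s v m) = ar s.
Proof. by []. Qed.

Lemma sc_set_iv s v m : sc (set_iv s v m) = sc s.
Proof. by []. Qed.

Lemma iv_set_iv s v m w : iv (set_iv s v m) w = if w == v then m else iv s w.
Proof. by []. Qed.

(** Rule for a loop that fills a block of one array. At turn t the entries from base + t on are
    still the initial ones, which is what an update in place needs. *)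
Lemma store_ok s k (b ie : iexp) (e : rexp) (base m : nat) (g : nat -> R) :
  evI s b = m ->
  (forall t s', (t < m)%N -> iv s' vi = t ->
     (forall w, w != vi -> iv s' w = iv s w) ->
     (forall j, j != k -> ar s' j = ar s j) ->
     sc s' =1 sc s ->
     (forall u, (base + t <= u)%N -> ar s' k u = ar s k u) ->
     evI s' ie = (base + t)%N /\ evR s' e = g t) ->
  let c := For vi b (SetA k ie e) in
  (forall u, ar (sem c s) k u =
     if (base <= u < base + m)%N then g (u - base)%N else ar s k u) /\
  (cost c s <= m * (lenR e + lenI ie + lenI b + 12) + lenI b + 3)%N.
Proof.
move=> hm hstep c.
have [||h1 h2] := @for_ind R vi b (SetA k ie e) s (fun t s' => forall u,
    ar s' k u = if (base <= u < base + t)%N then g (u - base)%N else ar s k u)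
    (lenR e + lenI ie + 8) _ _.
- by move=> u; rewrite addn0; case: ifP => //; lia.
- move=> t s' ht hi hI hA hS hU; rewrite hm in ht.
  have [||||i1 r1] := hstep t s' ht hi => //.
  + by move=> w hw; rewrite hI // inE.
  + by move=> j hj; rewrite hA // inE.
  + by move=> j; rewrite hS.
  + by move=> u hu; rewrite hU; case: ifP => //; lia.
  split=> // u; rewrite /= updE eqxx updE i1 r1; case: eqP => [->|ne].
    by rewrite ifT ?addKn //; lia.
  by rewrite hU; case: ifP; case: ifP => //; lia.
by rewrite hm in h1 h2; split=> //; move: h2; rewrite -/c; move: (cost _ _) => ?; lia.
Qed.

Lemma powers_body_ok s F q k p a base B :
  fft_dims q k s -> (0 < k <= q)%N -> iv s vp = p ->
  iv s va = a -> iv s vaN = base -> F \notin [:: aTW; aU; aV; aP; aB] ->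
  ar s aB = B ->
  [/\ forall u, ar (sem (powers_body F) s) F u =
       if (base <= u < base + 4 * q)%N
       then fft (ar s aTW) q k (ar s aP) (u - base) else ar s F u,
     forall u, (u < 4 * q)%N -> ar (sem (powers_body F) s) aP u = ar s aP u * B u / a.+1%:R,
     iv (sem (powers_body F) s) vaN = (base + 4 * q)%N
   & (cost (powers_body F) s <= 1400 * (k * q))%N].
Proof.
move=> dims kq hp ha hb hF hB; have [dQ dH dN dk] := dims.
have [k0 kq'] := andP kq; have q0 : (0 < q)%N by apply: leq_trans kq'.
rewrite !inE !negb_or in hF; case/and5P: hF => F1 F2 F3 F4 F5.
rewrite /powers_body 4!sem_seq 4!cost_seq.
set c1 := For _ _ (SetA aU _ _).
have [|u1 l1] := @store_ok s aU vN vi (XArr aP vi) 0 (4 * q) (ar s aP) dN.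
  by move=> t s' ht hi hI hA hS hU; rewrite /= hi hA.
set s1 := sem c1 s in u1 *.
have dims1 : fft_dims q k s1 by split; rewrite (sem_iv (c := c1)).
have [u2 l2] := fwd_ok dims1 kq'.
set s2 := sem fwd_cmd s1 in u2 *.
have i2 v : v \notin modI (c1 ;; fwd_cmd) -> iv s2 v = iv s v by exact: sem_iv.
have r2 j : j \notin [:: aU; aV] -> ar s2 j = ar s j.
  rewrite !inE negb_or => /andP[j1 j2].
  by rewrite (@sem_ar _ (c1 ;; fwd_cmd)) //= !inE !negb_or j1 j2.
set c3 := For _ _ (SetA F _ _).
have N2 : iv s2 vN = (4 * q)%N by rewrite i2.
have b2 : iv s2 vaN = base by rewrite i2.
have [|u3 l3] := @store_ok s2 F vN (vaN + vi) (XArr aU vi) base (4 * q) (ar s2 aU) N2.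
  move=> t s' ht hi hI hA hS hU; rewrite /= hi hI // b2; split=> //.
  by rewrite hA // eq_sym.
set s3 := sem c3 s2 in u3 *.
have i3 v : v != vi -> iv s3 v = iv s2 v by move=> hv; rewrite (sem_iv (c := c3)) //= inE.
have r3 j : j != F -> ar s3 j = ar s2 j by move=> hj; rewrite (sem_ar (c := c3)) //= inE.
have N3 : iv s3 vN = (4 * q)%N by rewrite i3.
have a3 : iv s3 va = a by rewrite i3 // i2.
set c4 := For _ _ (SetA aP _ _).
have [|u4 l4] := @store_ok s3 aP vN vi (XArr aP vi * XArr aB vi / XOfI (va + ENat 1))
   0 (4 * q) (fun u => ar s aP u * B u / a.+1%:R) N3.
  move=> t s' ht hi hI hA hS hU; rewrite /= hi hI // a3 addn1; split=> //.
  rewrite hU ?add0n // (hA aB) // (r3 aP) 1?eq_sym // (r3 aB) 1?eq_sym //.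
  by rewrite !r2 // hB.
set s4 := sem c4 s3 in u4 *.
have r4 j : j != aP -> ar s4 j = ar s3 j by move=> hj; rewrite (sem_ar (c := c4)) //= inE.
have i4 v : v != vi -> iv s4 v = iv s3 v by move=> hv; rewrite (sem_iv (c := c4)) //= inE.
split.
- move=> u; rewrite [ar _ _]/= -/s4 r4 // u3; case: ifP => hu; last first.
    by rewrite r2 // !inE negb_or F2 F3.
  rewrite u2; last by lia.
  rewrite (sem_ar (c := c1)) //; apply: eq_fft; first by lia.
  by move=> w hw; rewrite u1 ifT ?subn0.
- by move=> u hu; rewrite [ar _ _]/= -/s4 u4 ifT ?subn0.
- by rewrite [iv _ _]/= -/s4 updE /= !i4 // !i3 // b2 N2.
- have k5 : cost (SetI vaN (vaN + vN)) s4 = 7 by [].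
  rewrite k5; move: l1 l2 l3 l4; rewrite -/c1 -/c3 -/c4 !lenE.
  move: (cost c1 _) (cost fwd_cmd _) (cost c3 _) (cost c4 _) => x1 x2 x3 x4.
  have h1 : (q <= k * q)%N by rewrite -{1}[q]mul1n leq_mul2r k0 orbT.
  have h2 : (k <= k * q)%N by rewrite -{1}[k]muln1 leq_mul2l q0 orbT.
  lia.
Qed.

Lemma powers_ok s F q k p len (le : iexp) B :
  fft_dims q k s -> (0 < k <= q)%N -> iv s vp = p ->
  F \notin [:: aTW; aU; aV; aP; aB] -> ar s aB = B ->
  (len <= 4 * q)%N -> (lenI le <= 5)%N ->
  (forall s', (forall v, v != vi -> iv s' v = iv s v) -> evI s' le = len) ->
  (forall a u, (a < p.+1)%N -> (u < 4 * q)%N ->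
     ar (sem (powers_cmd le F) s) F (a * (4 * q) + u) =
       fft (ar s aTW) q k (pow_array len B a) u) /\
  (cost (powers_cmd le F) s <= 2000 * (p.+1 * (k * q)))%N.
Proof.
move=> dims kq hp hF hB hlen hle hev; have [dQ dH dN dk] := dims.
have [k0 kq'] := andP kq; have q0 : (0 < q)%N by apply: leq_trans kq'.
rewrite /powers_cmd 3!sem_seq 3!cost_seq.
set c1 := For vi vN _.
have [|u1 l1] := @store_ok s aP vN vi (XNat 0) 0 (4 * q) (fun=> 0) dN.
  by move=> t s' ht hi hI hA hS hU; rewrite /= hi.
set s1 := sem c1 s in u1 *.
have i1 v : v != vi -> iv s1 v = iv s v by move=> hv; rewrite (sem_iv (c := c1)) //= inE.
have [|u2 l2] := @store_ok s1 aP le vi (XNat 1) 0 len (fun=> 1) (hev s1 i1).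
  by move=> t s' ht hi hI hA hS hU; rewrite /= hi.
set c2 := For _ le _ in u2 l2 *; set s2 := sem c2 s1 in u2 *.
set s3 := sem (SetI vaN _) s2.
have i3 v : v \notin [:: vi; vaN] -> iv s3 v = iv s v.
  rewrite !inE negb_or => /andP[v1 v2].
  by rewrite (@sem_iv _ (c1 ;; c2 ;; SetI vaN (ENat 0))) //= !inE !negb_or v1 v2.
have r3 j : j != aP -> ar s3 j = ar s j.
  by move=> hj; rewrite (@sem_ar _ (c1 ;; c2 ;; SetI vaN (ENat 0))) //= !inE !negb_or hj.
have P3 u : (u < 4 * q)%N -> ar s3 aP u = pow_array len B 0 u.
  move=> hu; rewrite /pow_array dpow0 [ar _ _]/= -/s2 u2 add0n leq0n /=.
  by case: ifP => // _; rewrite u1 leq0n add0n hu.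
have e3 : evI s3 (vp + ENat 1)%ie = p.+1 by transitivity (iv s3 vp + 1)%N => //; rewrite i3 // hp addn1.
have [||h1 h2] := @for_ind R va (vp + ENat 1) (powers_body F) s3 (fun t s' =>
  [/\ iv s' vaN = (t * (4 * q))%N,
      forall u, (u < 4 * q)%N -> ar s' aP u = pow_array len B t u
    & forall a u, (a < t)%N -> (u < 4 * q)%N ->
     ar s' F (a * (4 * q) + u)%N = fft (ar s aTW) q k (pow_array len B a) u])
  (1400 * (k * q)) _ _.
- by split.
- move=> t s' ht hi hI hA hS [hb hP hT]; rewrite e3 in ht.
  have dims' : fft_dims q k s' by split; rewrite hI // i3.
  have hp' : iv s' vp = p by rewrite hI // i3.
  have nF j : j \in [:: aTW; aB] -> ar s' j = ar s j.
    move=> hj; rewrite hA ?r3 //; first by move: hj; rewrite !inE => /orP[]/eqP->.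
    move: hF hj; rewrite /= !inE !negb_or => /and5P[F1 F2 F3 F4 F5].
    by case/orP => /eqP->; rewrite /= eq_sym ?F1 ?F5.
  have hB' : ar s' aB = B by rewrite nF.
  have [b1 b2 b3 b4] := powers_body_ok dims' kq hp' hi hb hF hB'.
  split=> //; split.
  + by rewrite iv_set_iv b3 mulSn addnC.
  + move=> u hu; rewrite ar_set_iv b2 // hP // /pow_array; case: ifP => _.
      by rewrite dpowS.
    by rewrite !mul0r.
  + move=> a u hat hu; rewrite ar_set_iv b1 nF //.
    have [at'|ne] := eqVneq a t.
      rewrite at' leq_addr ltn_add2l hu addKn /=.
      by apply: eq_fft.
    have lt : (a < t)%N by lia.
    (* Earlier blocks end before the current one begins. *)
    rewrite ifF; first exact: hT.
    have : (a.+1 * (4 * q) <= t * (4 * q))%N by rewrite leq_mul2r lt orbT.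
    rewrite mulSn; lia.
rewrite e3 in h1 h2; case: h1 => _ _ h1; split; first exact: h1.
have k3 : cost (SetI vaN (ENat 0)) s2 = 3 by [].
rewrite k3; move: l1 l2 h2; rewrite -/c1 -/c2 !lenE.
move: (cost c1 _) (cost c2 _) (cost _ s3) => x1 x2 x3 l1 l2 h2.
have g1 : (k * q <= p.+1 * (k * q))%N by rewrite -{1}[(k * q)%N]mul1n leq_mul2r orbT.
have g2 : (p.+1 <= p.+1 * (k * q))%N by rewrite -{1}[p.+1]muln1 leq_mul2l muln_gt0 k0 q0.
have g3 : (q <= k * q)%N by rewrite -{1}[q]mul1n leq_mul2r k0 orbT.
have g4 : (len * (1 + 2 + lenI le + 12) <= 4 * q * 20)%N by apply: leq_mul => //; lia.
lia.
Qed.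

End PowersSpecifications.

(** * Moments of all shifts from the transformed powers *)

Definition mul_body : cmd :=
  SetR 3 (XArr aX (vaN + vi)) ;;
  SetR 4 (XArr aX (vaN + vi + vH)) ;;
  SetR 5 (XArr aY (vqN - vaN + vi)) ;;
  SetR 6 (XArr aY (vqN - vaN + vi + vH)) ;;
  SetA aU vi (XArr aU vi + (3%N * 5%N - 4%N * 6%N)) ;;
  SetA aU (vi + vH)
    (XArr aU (vi + vH) + (3%N * 6%N + 4%N * 5%N - XArr aTW (vH + vi) * 4%N * 6%N)).

Definition mul_cmd : cmd := For vi vH mul_body ;; SetI vaN (vaN + vN).

(** The products are summed before transforming back, so each moment index needs a single inverse
    transform. *)
Definition combine_body : cmd :=
  For vi vN (SetA aU vi (XNat 0)) ;;
  SetI vaN (ENat 0) ;;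
  For va (vq + ENat 1) mul_cmd ;;
  inv_cmd ;;
  For vi vn (SetA aM (vqN + vi) (XArr aU (vn - ENat 1 + vi))) ;;
  SetI vqN (vqN + vN).

Definition combine_cmd : cmd :=
  SetI vqN (ENat 0) ;; For vq (vp + ENat 1) combine_body.

Section CombineSpecifications.
Variable R : realType.
Implicit Types s : state R.

(** Multiplication of linear residues: (p0 + p1 z) (r0 + r1 z) modulo z^2 + w z + 1 is p0 r0 - p1 r1
    + (p0 r1 + p1 r0 - w p1 r1) z. Leaf j is node 2 q + j, and its two coefficients lie 2 q
    apart. *)
Lemma mul_loop_ok s q k a b : fft_dims q k s -> iv s vaN = a -> (iv s vqN - iv s vaN = b)%N ->
  let c := For vi vH mul_body in
  let X := ar s aX in let Y := ar s aY in
  (forall j, (j < 2 * q)%N ->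
    ar (sem c s) aU j = ar s aU j +
      (X (a + j)%N * Y (b + j)%N - X (a + j + 2 * q)%N * Y (b + j + 2 * q)%N) /\
    ar (sem c s) aU (j + 2 * q)%N = ar s aU (j + 2 * q)%N +
      (X (a + j)%N * Y (b + j + 2 * q)%N + X (a + j + 2 * q)%N * Y (b + j)%N
       - ar s aTW (2 * q + j)%N * X (a + j + 2 * q)%N * Y (b + j + 2 * q)%N)) /\
  (cost c s <= 600 * q + 5)%N.
Proof.
move=> [dQ dH dN dk] ha hb c X Y.
have [||h1 h2] := @for_ind R vi vH mul_body s (fun t s' => forall j, (j < 2 * q)%N ->
    ar s' aU j = ar s aU j + (if (j < t)%N then
      (X (a + j)%N * Y (b + j)%N - X (a + j + 2 * q)%N * Y (b + j + 2 * q)%N) else 0) /\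
    ar s' aU (j + 2 * q)%N = ar s aU (j + 2 * q)%N + (if (j < t)%N then
      (X (a + j)%N * Y (b + j + 2 * q)%N + X (a + j + 2 * q)%N * Y (b + j)%N
       - ar s aTW (2 * q + j)%N * X (a + j + 2 * q)%N * Y (b + j + 2 * q)%N) else 0)) 200 _ _.
- by move=> j hj; rewrite !addr0.
- move=> t s' ht hi hI hA hS hU; rewrite [evI _ _]/= dH in ht.
  split; last by [].
  have H' : iv s' vH = (2 * q)%N by rewrite hI.
  have a' : iv s' vaN = a by rewrite hI.
  have b' : (iv s' vqN - a)%N = b by rewrite hI // -ha.
  have X' : ar s' aX = X by rewrite hA.
  have Y' : ar s' aY = Y by rewrite hA.
  have T' : ar s' aTW = ar s aTW by rewrite hA.
  have [U1 U2] := hU t ht; rewrite ltnn !addr0 in U1 U2.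
  have E : ar (sem mul_body s') aU = upd (upd (ar s' aU) t
      (ar s' aU t + (X (a + t)%N * Y (b + t)%N - X (a + t + 2 * q)%N * Y (b + t + 2 * q)%N)))
      (t + 2 * q)%N (upd (ar s' aU) t
      (ar s' aU t + (X (a + t)%N * Y (b + t)%N - X (a + t + 2 * q)%N * Y (b + t + 2 * q)%N))
         (t + 2 * q)%N + (X (a + t)%N * Y (b + t + 2 * q)%N + X (a + t + 2 * q)%N * Y (b + t)%N
       - ar s aTW (2 * q + t)%N * X (a + t + 2 * q)%N * Y (b + t + 2 * q)%N)).
    by rewrite /= ?updE /= ?updE /= hi H' a' b' X' Y' T'.
  move=> j hj; rewrite ar_set_iv E !updE.
  have -> : (t + 2 * q == t)%N = false by apply/eqP; lia.
  have -> : (j == t + 2 * q)%N = false by apply/eqP; lia.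
  have -> : (j + 2 * q == t)%N = false by apply/eqP; lia.
  rewrite eqn_add2r ltnS; have [->|ne] := eqVneq j t.
    by rewrite leqnn U1 U2.
  by rewrite leq_eqVlt (negbTE ne) /=; apply: hU.
- rewrite [evI _ _]/= dH in h1 h2; split.
    by move=> j hj; have := h1 j hj; rewrite hj.
  by move: h2; rewrite !lenE -/c; move: (cost _ _) => ?; lia.
Qed.

Variables (p n q k : nat) (BX BY : nat -> R).

Definition tables_ok s : Prop :=
  forall a u, (a < p.+1)%N -> (u < 4 * q)%N ->
    ar s aX (a * (4 * q) + u) = fft (ar s aTW) q k (pow_array n BX a) u /\
    ar s aY (a * (4 * q) + u) = fft (ar s aTW) q k (pow_array (2 * n) BY a) u.

(** The m + 1 pointwise products take O(q) steps each and the inverse transform O(k q); both stay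
    within O(p k q). *)
Lemma combine_body_ok s m K : k = K.+1 -> q = (2 ^ K)%N -> (n <= q)%N -> (0 < n)%N ->
  fft_dims q k s -> (0 < k <= q)%N ->
  tree_ok (2 * q) (ar s aTW) -> tables_ok s -> iv s vn = n ->
  iv s vq = m -> iv s vqN = (m * (4 * q))%N -> (m < p.+1)%N ->
  let s' := sem combine_body s in
  [/\ forall u, ar s' aM u = if (m * (4 * q) <= u < m * (4 * q) + n)%N then
        (\sum_(a < m.+1) (\poly_(i < 4 * q) pow_array n BX a i *
          \poly_(i < 4 * q) pow_array (2 * n) BY (m - a) i))`_(n.-1 + (u - m * (4 * q)))
        else ar s aM u,
      iv s' vqN = (m.+1 * (4 * q))%N
    & (cost combine_body s <= 2500 * (p.+1 * (k * q)))%N].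
Proof.
move=> kK qK nq n0 dims kq tok tabs hn hm hqN mp s'; have [dQ dH dN dk] := dims.
have [k0 kq'] := andP kq; have q0 : (0 < q)%N by apply: leq_trans kq'.
rewrite {}/s' /combine_body 5!sem_seq 5!cost_seq.
set c1 := For vi vN _.
have [|u1 l1] := @store_ok R s aU vN vi (XNat 0) 0 (4 * q) (fun=> 0) dN.
  by move=> t s' ht hi hI hA hS hU; rewrite /= hi.
set s1 := sem c1 s in u1 *.
set s2 := sem (SetI vaN _) s1.
have i2 v : v \notin [:: vi; vaN] -> iv s2 v = iv s v.
  rewrite !inE negb_or => /andP[v1 v2].
  by rewrite (@sem_iv _ (c1 ;; SetI vaN (ENat 0))) //= !inE !negb_or v1 v2.
have r2 j : j != aU -> ar s2 j = ar s j.
  by move=> hj; rewrite (@sem_ar _ (c1 ;; SetI vaN (ENat 0))) //= !inE hj.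
have e2 : evI s2 (vq + ENat 1)%ie = m.+1.
  by transitivity (iv s2 vq + 1)%N => //; rewrite i2 // hm addn1.
pose tw := ar s aTW.
pose FX a := fft tw q k (pow_array n BX a).
pose FY a := fft tw q k (pow_array (2 * n) BY a).
have [||h1 h2] := @for_ind R va (vq + ENat 1) mul_cmd s2 (fun t s' =>
  iv s' vaN = (t * (4 * q))%N /\
  forall j, (j < 2 * q)%N ->
    ar s' aU j = \sum_(a < t) (FX a j * FY (m - a)%N j
                   - FX a (j + 2 * q)%N * FY (m - a)%N (j + 2 * q)%N)
    /\ ar s' aU (j + 2 * q)%N =
      \sum_(a < t) (FX a j * FY (m - a)%N (j + 2 * q)%N
        + FX a (j + 2 * q)%N * FY (m - a)%N j
        - tw (2 * q + j)%N * FX a (j + 2 * q)%N * FY (m - a)%N (j + 2 * q)%N))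
  (600 * q + 12) _ _.
- split=> // j hj; rewrite !big_ord0 ar_set_iv.
  have U0 u : (u < 4 * q)%N -> ar s2 aU u = 0.
    by move=> hu; rewrite (_ : ar s2 aU u = ar s1 aU u) // u1 ifT.
  by rewrite !U0 //; lia.
- move=> t s' ht hi hI hA hS [hb hU]; rewrite e2 in ht.
  have dims' : fft_dims q k s' by split; rewrite hI // i2.
  have qN' : (iv s' vqN - iv s' vaN = (m - t) * (4 * q))%N.
    by rewrite hb hI // i2 // hqN mulnBl.
  have [m1 m2] := mul_loop_ok dims' hb qN'.
  rewrite /mul_cmd sem_seq cost_seq; set s'' := sem (For _ _ _) s' in m1 *.
  have k7 : cost (SetI vaN (vaN + vN)) s'' = 7 by [].
  split; last by rewrite k7; lia.
  have iv'' v : v != vi -> iv s'' v = iv s' v.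
    by move=> hv; rewrite (sem_iv (c := For vi vH mul_body)) //= inE.
  split.
    rewrite iv_set_iv; transitivity (iv s'' vaN + iv s'' vN)%N => //.
    by rewrite !iv'' // hb; case: dims' => _ _ -> _; rewrite mulSn addnC.
  have X' : ar s' aX = ar s aX by rewrite hA // r2.
  have Y' : ar s' aY = ar s aY by rewrite hA // r2.
  have T' : ar s' aTW = tw by rewrite hA // r2.
  move=> j hj; have [v1 v2] := m1 j hj; have [w1 w2] := hU j hj.
  have ar'' : ar (set_iv (sem (SetI vaN (vaN + vN)) s'') va t.+1) aU = ar s'' aU by [].
  have tp : (t < p.+1)%N by lia.
  have mp' : (m - t < p.+1)%N by lia.
  have j4 : (j < 4 * q)%N by lia.
  have j24 : (j + 2 * q < 4 * q)%N by lia.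
  rewrite ar'' v1 v2 w1 w2 !big_ord_recr /= X' Y' T' -!addnA.
  have [x1 _] := tabs t j tp j4; have [x2 _] := tabs t _ tp j24.
  have [_ y1] := tabs (m - t)%N j mp' j4; have [_ y2] := tabs (m - t)%N _ mp' j24.
  by rewrite x1 x2 y1 y2.
set c3 := For va _ _ in h1 h2 *; set s3 := sem c3 s2 in h1 *; rewrite e2 in h1 h2.
have i3 v : v \notin [:: vi; vaN; va] -> iv s3 v = iv s v.
  rewrite !inE !negb_or => /and3P[v1 v2 v3].
  by rewrite (sem_iv (c := c3)) ?i2 //= !inE ?negb_or ?v1 ?v2 ?v3.
have r3 j : j != aU -> ar s3 j = ar s j.
  by move=> hj; rewrite (sem_ar (c := c3)) ?r2 //= !inE negb_or hj.
have dims3 : fft_dims q k s3 by split; rewrite i3.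
have [u4 l4] := inv_ok dims3 kq'.
set s4 := sem inv_cmd s3 in u4 *.
have r4 j : j \notin [:: aU; aV] -> ar s4 j = ar s j.
  rewrite !inE negb_or => /andP[j1 j2].
  by rewrite (sem_ar (c := inv_cmd)) ?r3 //= !inE !negb_or j1 j2.
have i4 v : v \notin modI combine_body -> iv s4 v = iv s v.
  move=> hv; rewrite (sem_iv (c := inv_cmd)).
    by rewrite i3 //; move: hv; rewrite !inE !negb_or; do ![case/andP => ?]; move=> *; apply/and3P.
  by move: hv; rewrite !inE !negb_or; do ![case/andP => ?]; move=> *; do ![apply/andP; split].
have n4 : iv s4 vn = n by rewrite i4.
have qN4 : iv s4 vqN = (m * (4 * q))%N.
  by rewrite (sem_iv (c := inv_cmd)) // i3.
set S := \sum_(a < m.+1) _.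
have sS : (size S <= 4 * n)%N by exact: (@size_conv R n m.+1 (4 * q) BX BY).
have U4 u : (u < 4 * q)%N -> ar s4 aU u = S`_u.
  move=> hu; rewrite u4 // r3 // -/tw kK qK.
  have tok' : tree_ok (2 ^ K.+1) tw by rewrite expnS -qK.
  case: h1 => _ hL.
  have := @fft_convolution R tw K tok' 'I_m.+1 xpredT (fun a => pow_array n BX a)
    (fun a => pow_array (2 * n) BY (m - a)) (ar s3 aU) u.
  rewrite -!qK => -> //; first by apply: leq_trans sS _; lia.
  by move=> j; rewrite expnS -qK => hj; have := hL j hj; rewrite /FX /FY kK.
set c5 := For vi vn _.
have [|u5 l5] := @store_ok R s4 aM vn (vqN + vi) (XArr aU (vn - ENat 1 + vi)) (m * (4 * q)) n
    (fun u => S`_(n.-1 + u)) n4.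
  move=> t s' ht hi hI hA hS hU; rewrite /= hi (hI vqN) // (hI vn) // qN4 n4 hA //; split=> //.
  by rewrite U4 subn1 //; lia.
set s5 := sem c5 s4 in u5 *.
split.
- move=> u; rewrite (_ : ar _ aM u = ar s5 aM u) // u5; case: ifP => // _.
  by rewrite r4.
- transitivity (iv s5 vqN + iv s5 vN)%N => //.
  rewrite !(sem_iv (c := c5)) // qN4 (sem_iv (c := inv_cmd)) // i3 // dN.
  by rewrite mulSn addnC.
have k2 : cost (SetI vaN (ENat 0)) s1 = 3 by [].
have k6 : cost (SetI vqN (vqN + vN)) s5 = 7 by [].
rewrite k2 k6; move: l1 h2 l4 l5; rewrite -/c1 -/c3 -/c5 !lenE.
move: (cost c1 _) (cost c3 _) (cost inv_cmd _) (cost c5 _) => x1 x2 x3 x4 l1 l2 l3 l4.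
have g0 : (q <= k * q)%N by rewrite -{1}[q]mul1n leq_mul2r k0 orbT.
have g1 : (k * q <= p.+1 * (k * q))%N by rewrite -{1}[(k * q)%N]mul1n leq_mul2r orbT.
have g2 : (p.+1 <= p.+1 * (k * q))%N by rewrite -{1}[p.+1]muln1 leq_mul2l muln_gt0 k0 q0.
have g3 : (k <= k * q)%N by rewrite -{1}[k]muln1 leq_mul2l q0 orbT.
have g4 : (p.+1 * q <= p.+1 * (k * q))%N by rewrite leq_mul2l g0.
have g5 : (m.+1 * (600 * q + 12 + 9) <= p.+1 * (600 * q + 12 + 9))%N by rewrite leq_mul2r mp orbT.
have g6 : (p.+1 * (600 * q + 12 + 9) = 600 * (p.+1 * q) + 21 * p.+1)%N by lia.
lia.
Qed.

Lemma combine_ok s K : k = K.+1 -> q = (2 ^ K)%N -> (n <= q)%N -> (0 < n)%N ->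
  fft_dims q k s -> (0 < k <= q)%N ->
  tree_ok (2 * q) (ar s aTW) -> tables_ok s -> iv s vn = n -> iv s vp = p ->
  (forall m u, (m < p.+1)%N -> (u < n)%N -> ar (sem combine_cmd s) aM (m * (4 * q) + u)%N =
     (\sum_(a < m.+1) (\poly_(i < 4 * q) pow_array n BX a i *
          \poly_(i < 4 * q) pow_array (2 * n) BY (m - a) i))`_(n.-1 + u)) /\
  (cost combine_cmd s <= 2600 * (p.+1 * (p.+1 * (k * q))))%N.
Proof.
move=> kK qK nq n0 dims kq tok tabs hn hp; have [dQ dH dN dk] := dims.
have [k0 kq'] := andP kq; have q0 : (0 < q)%N by apply: leq_trans kq'.
rewrite /combine_cmd sem_seq cost_seq; set s1 := sem _ s.
have e1 : evI s1 (vp + ENat 1)%ie = p.+1 by transitivity (iv s vp + 1)%N => //; rewrite hp addn1.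
have [||h1 h2] := @for_ind R vq (vp + ENat 1) combine_body s1 (fun t s' =>
  iv s' vqN = (t * (4 * q))%N /\
  forall m u, (m < t)%N -> (u < n)%N -> ar s' aM (m * (4 * q) + u)%N =
     (\sum_(a < m.+1) (\poly_(i < 4 * q) pow_array n BX a i *
          \poly_(i < 4 * q) pow_array (2 * n) BY (m - a) i))`_(n.-1 + u))
  (2500 * (p.+1 * (k * q))) _ _.
- by [].
- move=> t s' ht hi hI hA hS [hb hM]; rewrite e1 in ht.
  have dims' : fft_dims q k s' by split; rewrite hI.
  have tok' : tree_ok (2 * q) (ar s' aTW) by rewrite hA.
  have tabs' : tables_ok s' by move=> a u ha hu; rewrite !hA //; apply: tabs.
  have hn' : iv s' vn = n by rewrite hI.
  have [b1 b2 b3] := combine_body_ok kK qK nq n0 dims' kq tok' tabs' hn' hi hb ht.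
  split=> //; split; first by rewrite iv_set_iv b2.
  move=> m u hm hu; rewrite ar_set_iv b1.
  have [->|ne] := eqVneq m t; first by rewrite leq_addr ltn_add2l hu addKn.
  have lt : (m < t)%N by lia.
  rewrite ifF; first exact: hM.
  have : (m.+1 * (4 * q) <= t * (4 * q))%N by rewrite leq_mul2r lt orbT.
  by rewrite mulSn; lia.
rewrite e1 in h1 h2; split; first by case: h1.
have k1 : cost (SetI vqN (ENat 0)) s = 3 by [].
rewrite k1; move: h2; rewrite !lenE; move: (cost _ _) => x1 h2.
have g2 : (0 < p.+1 * (k * q))%N by rewrite !muln_gt0 k0 q0.
have g3 : (p.+1 <= p.+1 * (p.+1 * (k * q)))%N by rewrite -{1}[p.+1]muln1 leq_mul2l g2.
have g4 : (0 < p.+1 * (p.+1 * (k * q)))%N by rewrite muln_gt0.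
have g5 : (p.+1 * (2500 * (p.+1 * (k * q)) + 9) = 2500 * (p.+1 * (p.+1 * (k * q))) + 9 * p.+1)%N by lia.
lia.
Qed.

End CombineSpecifications.

(** * Minimisation over offsets and shifts *)

Definition slope_cmd : cmd :=
  SetI vx vs ;;
  For vi vp (SetA aR (vp - ENat 1 - vi) (XArr aM vx * XArr aF (vp - ENat 1 - vi)) ;;
             SetI vx (vx + vN)).

(** Moment i goes with c^(p-i), so the moments come in the order of Horner's scheme. The value is
    the cost divided by p!, which is good enough for comparisons. *)
Definition horner_cmd : cmd :=
  SetR 8 (XNat 0) ;; SetI vx vs ;;
  For vi (vp + ENat 1) (SetR 8 (8%N * 7%N + XArr aM vx * XArr aF (vp - vi)) ;;
                        SetI vx (vx + vN)).

Definition take_cmd : cmd := SetR 9 8%N ;; SetR 10 7%N ;; SetI vbest vs.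

(** The test s < 1 always accepts the first shift, so the running minimum needs no initial value. *)
Definition scan_body : cmd :=
  slope_cmd ;; SetRoot 7 aR ;; horner_cmd ;;
  IfI vs (ENat 1) take_cmd (IfR 8%N 9%N take_cmd Skip).

Definition scan_cmd : cmd := SetA aR vp (XNat 0) ;; For vs vn scan_body.

(** Dividing by the stored 1 / p! restores the true cost. Variable 0, which held n, receives the
    shift last. *)
Definition output_cmd : cmd :=
  SetR 1 (9%N / XArr aF vp) ;;
  IfR 10%N (XNat 0) (SetR 0 (10%N + XNat 1))
    (IfR 10%N (XNat 1) (SetR 0 10%N) (SetR 0 (10%N - XNat 1))) ;;
  SetI vn vbest.

Definition main_cmd : cmd :=
  dims_cmd ;; tree_cmd ;; fact_cmd ;;
  basex_cmd ;; powers_cmd vn aX ;;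
  basey_cmd ;; powers_cmd (vn + vn) aY ;;
  combine_cmd ;; scan_cmd ;; output_cmd.

Section ScanSpecifications.
Variables (R : realType) (p n N : nat) (xs ys : seq R).
Hypotheses (evp : ~~ odd p) (p0 : (0 < p)%N) (n0 : (0 < n)%N).
Hypotheses (hxs : necklace_input n xs) (hys : necklace_input n ys).
Implicit Types st : state R.

Definition moments_ok st : Prop :=
  [/\ iv st vp = p, iv st vn = n, iv st vN = N,
      forall m s, (m < p.+1)%N -> (s < n)%N -> ar st aM (m * N + s)%N = moment n xs ys s m
    & forall j, (j < p.+1)%N -> ar st aF j = j`!%:R^-1].

(** Moments of one shift lie [N] apart, and moment i yields coefficient p - 1 - i, so the polynomial
    is filled downwards; its zero in degree p is set once, before the scan. *)
Lemma slope_cmd_ok st s : moments_ok st -> iv st vs = s -> (s < n)%N -> ar st aR p = 0 ->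
  (forall m, (m < p.+1)%N -> ar (sem slope_cmd st) aR m = slope_coef p n xs ys s m) /\
  (cost slope_cmd st <= 100 * p.+1)%N.
Proof.
move=> [hp hn hN hM hF] hs sn hR; rewrite /slope_cmd sem_seq cost_seq.
set st1 := sem _ st.
set body := Seq (SetA _ _ _) _.
have e1 : evI st1 vp = p by rewrite -hp.
have [||h1 h2] := @for_ind R vi vp body st1 (fun t st' =>
  iv st' vx = (t * N + s)%N /\
  forall m, (m < p.+1)%N -> (p - t <= m)%N -> ar st' aR m = slope_coef p n xs ys s m) 80 _ _.
- split; first by rewrite -hs.
  move=> m mp; rewrite subn0 => pm; have -> : m = p by lia.
  by rewrite /slope_coef ltnn -hR.
- move=> t st' ht hi hI hA hS [hx hU]; rewrite e1 in ht.
  have hp' : iv st' vp = p by rewrite hI.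
  have hN' : iv st' vN = N by rewrite hI.
  have hM' : ar st' aM = ar st aM by rewrite hA.
  have hF' : ar st' aF = ar st aF by rewrite hA.
  split; last by [].
  split; first by rewrite /= !updE /= ?updE /= hx hN' mulSn; lia.
  move=> m mp pm; rewrite /= !updE /= !updE hp' hi hx hM' hF'.
  case: eqP => [em|ne]; last by apply: hU; lia.
  rewrite hM ?hF; try lia; rewrite /slope_coef ifT; last by lia.
  by rewrite em; congr (moment _ _ _ _ _ * _); lia.
rewrite e1 in h1 h2; split; first by move=> m mp; case: h1 => _; apply=> //; lia.
have k1 : cost (SetI vx vs) st = 4 by [].
by rewrite k1; move: h2; rewrite !lenE; move: (cost _ st1) => ?; lia.
Qed.

Lemma horner_cmd_ok st s : moments_ok st -> iv st vs = s -> (s < n)%N ->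
  sc (sem horner_cmd st) 8 = linear_cost p xs ys s%:Z (sc st 7) / p`!%:R /\
  (cost horner_cmd st <= 100 * p.+1)%N.
Proof.
move=> [hp hn hN hM hF] hs sn; rewrite /horner_cmd 2!sem_seq 2!cost_seq.
set st1 := sem (SetI vx vs) _; set c := sc st 7.
set body := Seq (SetR 8 _) _.
have e1 : evI st1 (vp + ENat 1)%ie = p.+1.
  by transitivity (iv st vp + 1)%N => //; rewrite hp addn1.
have [||h1 h2] := @for_ind R vi (vp + ENat 1) body st1 (fun t st' =>
  iv st' vx = (t * N + s)%N /\
  sc st' 8 = \sum_(i < t) moment n xs ys s i * ((p - i)`!%:R^-1 * c ^+ (t.-1 - i))) 80 _ _.
- by split; [rewrite -hs | rewrite big_ord0].
- move=> t st' ht hi hI hA hS [hx hU]; rewrite e1 in ht.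
  have hp' : iv st' vp = p by rewrite hI.
  have hN' : iv st' vN = N by rewrite hI.
  have hM' : ar st' aM = ar st aM by rewrite hA.
  have hF' : ar st' aF = ar st aF by rewrite hA.
  have hc' : sc st' 7 = c by rewrite hS.
  split; last by [].
  split; first by rewrite /= !updE /= ?updE /= hx hN' mulSn; lia.
  rewrite /= ?updE /= ?updE /= hU hc' hx hp' hi hM' hF' hM ?hF //; last by lia.
  rewrite big_ord_recr /= subnn expr0 mulr1 mulr_suml; congr (_ + _).
  apply: eq_bigr => i _; rewrite -!mulrA -exprSr; congr (_ * (_ * _ ^+ _)).
  by have := ltn_ord i; lia.
rewrite e1 in h1 h2; split.
  case: h1 => _ ->; rewrite (linear_cost_moment p ys hxs) mulrAC divff ?fact_neq0 // mul1r.
  by apply: eq_bigr => i _; rewrite /dpow [_ / _]mulrC.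
have k1 : cost (SetR 8 (XNat 0)) st = 3 by [].
have k2 : cost (SetI vx vs) (sem (SetR 8 (XNat 0)) st) = 4 by [].
by rewrite k1 k2; move: h2; rewrite !lenE; move: (cost _ st1) => ?; lia.
Qed.

Lemma scan_body_ok st s : moments_ok st -> iv st vs = s -> (s < n)%N -> ar st aR p = 0 ->
  let st' := sem scan_body st in
  ar st' aR p = 0 /\ (cost scan_body st <= 400 * p.+1)%N /\
  exists c, let v := linear_cost p xs ys s%:Z c / p`!%:R in
  [/\ root (slope p n xs ys s) c, -1 < c < 2 &
    if (s == 0)%N || (v < sc st 9)
    then [/\ sc st' 9 = v, sc st' 10 = c & iv st' vbest = s]
    else [/\ sc st' 9 = sc st 9, sc st' 10 = sc st 10 & iv st' vbest = iv st vbest]].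
Proof.
move=> mom hs sn hR st'; have [hp hn hN hM hF] := mom.
have [u1 l1] := slope_cmd_ok mom hs sn hR.
rewrite {}/st' /scan_body 3!sem_seq 3!cost_seq.
set st1 := sem slope_cmd st in u1 *; set st2 := sem (SetRoot 7 aR) st1.
have p1 : iv st1 vp = p by rewrite (sem_iv (c := slope_cmd)).
pose y := ar st1 aR 0.
have rE : sc st2 7 = head y (rootsR (slope p n xs ys s)).
  rewrite [LHS]/= /root_val -/st1 p1; congr (head _ (rootsR _)).
  by apply/polyP => i; rewrite !coef_poly; case: ifP => // /u1.
have [rr rb] := slope_root evp p0 n0 hxs hys y sn; rewrite -rE in rr rb.
have ar2 j : j != aR -> ar st2 j = ar st j.
  by move=> hj; rewrite (@sem_ar _ (slope_cmd ;; SetRoot 7 aR)) //= inE.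
have iv2 v : v \notin [:: vi; vx] -> iv st2 v = iv st v.
  rewrite !inE negb_or => /andP[v1 v2].
  by rewrite (@sem_iv _ (slope_cmd ;; SetRoot 7 aR)) //= !inE !negb_or v1 v2.
have sc2 v : v != 7 -> sc st2 v = sc st v.
  by move=> hv; rewrite (@sem_sc _ (slope_cmd ;; SetRoot 7 aR)) //= !inE.
have mom2 : moments_ok st2 by split; rewrite ?iv2 ?ar2.
have hs2 : iv st2 vs = s by rewrite iv2.
have [v8 l2] := horner_cmd_ok mom2 hs2 sn.
set st3 := sem horner_cmd st2 in v8 *.
have sc3 v : v != 8 -> sc st3 v = sc st2 v.
  by move=> hv; rewrite (sem_sc (c := horner_cmd)) //= !inE orbb.
have hs3 : iv st3 vs = s by rewrite (sem_iv (c := horner_cmd)).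
have b3 : iv st3 vbest = iv st vbest by rewrite (sem_iv (c := horner_cmd)) // iv2.
have R3 : ar st3 aR p = 0.
  rewrite (sem_ar (c := horner_cmd)) //; transitivity (ar st1 aR p) => //.
  by rewrite u1 // /slope_coef ltnn.
set c := sc st2 7 in rE rr rb v8 *.
have hc3 : sc st3 7 = c by rewrite sc3.
have h9 : sc st3 9 = sc st 9 by rewrite sc3 // sc2.
have h10 : sc st3 10 = sc st 10 by rewrite sc3 // sc2.
set last := IfI _ _ _ _.
split; first by rewrite (sem_ar (c := last)).
split.
  have k1 : cost (SetRoot 7 aR) st1 = (9 * p.+1 + 20)%N by rewrite /= p1; lia.
  have k2 : (cost last st3 <= 60)%N by [].
  by rewrite k1; move: l1 l2 k2; lia.
exists c; split=> //.
clearbody st3; rewrite {}/last /= hs3 v8 h9.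
case: s {hs sn u1 rE rr hs2 l2} hs3 v8 => [|s] hs3 v8 /=.
  by rewrite !updE /= ?v8 ?hs3 ?hc3.
by case: (_ / _ < sc st 9); split; rewrite /= ?updE /= ?v8 ?hs3 ?hc3.
Qed.

Lemma scan_ok st : moments_ok st ->
  (cost scan_cmd st <= 500 * (n * p.+1) + 40)%N /\
  exists s c, [/\ iv (sem scan_cmd st) vbest = s, sc (sem scan_cmd st) 10 = c,
    sc (sem scan_cmd st) 9 = linear_cost p xs ys s%:Z c / p`!%:R &
    [/\ (s < n)%N, -1 < c < 2 & forall s' c', (s' < n)%N ->
      linear_cost p xs ys s%:Z c <= linear_cost p xs ys s'%:Z c']].
Proof.
move=> mom; have [hp hn hN hM hF] := mom.
rewrite /scan_cmd sem_seq cost_seq; set st1 := sem _ st.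
have e1 : evI st1 vn = n by rewrite -hn.
have fpos : 0 < p`!%:R^-1 :> R by rewrite invr_gt0 ltr0n fact_gt0.
have [||h1 h2] := @for_ind R vs vn scan_body st1 (fun t st' => ar st' aR p = 0 /\
  ((0 < t)%N -> exists s c, [/\ iv st' vbest = s, sc st' 10 = c,
    sc st' 9 = linear_cost p xs ys s%:Z c / p`!%:R &
    [/\ (s < t)%N, -1 < c < 2 & forall s' c', (s' < t)%N ->
      linear_cost p xs ys s%:Z c <= linear_cost p xs ys s'%:Z c']])) (400 * p.+1) _ _.
- by split=> //; rewrite /= !updE /= hp updE eqxx.
- move=> t st' ht hi hI hA hS [hR hbest]; rewrite e1 in ht.
  have mom' : moments_ok st' by split; rewrite ?hI ?hA.
  have [b1 [b2 [c [b3 b4 b5]]]] := scan_body_ok mom' hi ht hR.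
  split; last exact: b2.
  split; first exact: b1.
  move=> _; have low c' := slope_root_min evp p0 hxs c' b3.
  move: b5; rewrite !sc_set_iv iv_set_iv; case: ifP => [better|/negbT worse] [w1 w2 w3].
    exists t, c; split=> //; split=> // s' c' hs'.
    have [->|ne] := eqVneq s' t; first exact: low.
    have s't : (s' < t)%N by lia.
    have t0 : (0 < t)%N by lia.
    have [s2 [c2 [x1 x2 x3 [x4 x5 x6]]]] := hbest t0.
    apply: le_trans (x6 s' c' s't); move: better; rewrite gtn_eqF // x3 /=.
    by rewrite ltr_pM2r // => /ltW.
  move: worse; rewrite negb_or -lt0n -leNgt => /andP[t0 worse].
  have [s2 [c2 [x1 x2 x3 [x4 x5 x6]]]] := hbest t0.
  exists s2, c2; rewrite w1 w2 w3; split=> //; split=> //; first exact: leqW.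
  move=> s' c' hs'; have [->|ne] := eqVneq s' t; last by apply: x6; lia.
  by apply: le_trans (low c'); move: worse; rewrite x3 ler_pM2r.
rewrite e1 in h1 h2; split; last by case: h1 => _; apply.
have k1 : cost (SetA aR vp (XNat 0)) st = 11 by [].
rewrite k1; move: h2; rewrite !lenE; move: (cost _ st1) => ?.
by have := leq_mul n0 (leqnn p.+1); nia.
Qed.

End ScanSpecifications.

(** Stands in for the floor: the window of [slope_root] meets only three unit intervals. *)
Lemma mod1_window (R : realType) (c : R) : -1 < c < 2 ->
  mod1 c = if c < 0 then c + 1 else if c < 1 then c else c - 1.
Proof.
move=> hc; rewrite /mod1; case: ltP => h0.
  by rewrite (@floor_def _ _ (-1)) ?opprK // ; lra.
case: ltP => h1; first by rewrite (@floor_def _ _ 0) ?subr0 //; lra.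
by rewrite (@floor_def _ _ 1) //; lra.
Qed.

(** * The whole program *)

Section Main.
Variables (R : realType) (p n : nat) (xs ys : seq R).
Hypotheses (evp : ~~ odd p) (p0 : (0 < p)%N) (n0 : (0 < n)%N).
Hypotheses (hxs : necklace_input n xs) (hys : necklace_input n ys).
Implicit Types st : state R.

(** Variables 0 to 5 hold n, p and the transform sizes, which stay fixed between [dims_cmd] and
    [output_cmd]. *)
Lemma sem_iv_low (c : cmd) st v : all (leq 6) (modI c) -> (v < 6)%N ->
  iv (sem c st) v = iv st v.
Proof.
by move=> /allP h hv; rewrite sem_iv //; apply/negP => /h; rewrite leqNgt hv.
Qed.

Lemma output_ok st c w s : iv st vp = p -> ar st aF p = p`!%:R^-1 ->
  sc st 10 = c -> sc st 9 = w / p`!%:R -> iv st vbest = s -> -1 < c < 2 ->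
  [/\ sc (sem output_cmd st) 0 = mod1 c, sc (sem output_cmd st) 1 = w,
      iv (sem output_cmd st) 0 = s & (cost output_cmd st <= 60)%N].
Proof.
move=> hp hF hc hw hs hcw.
have hv : w / p`!%:R / p`!%:R^-1 = w by rewrite invrK divfK ?fact_neq0.
rewrite mod1_window //; split; last by [].
- rewrite /= !updE /= hc; case: (c < 0); rewrite /= ?updE /= ?hc //.
  by case: (c < 1); rewrite /= ?updE /= ?hc.
- rewrite /= ?updE /= hc; case: (c < 0); rewrite /= ?updE /= ?hp ?hF ?hw ?hv //.
  by case: (c < 1); rewrite /= ?updE /= ?hp ?hF ?hw ?hv.
- rewrite /= ?updE /= hc; case: (c < 0); rewrite /= ?updE /= ?hs //.
  by case: (c < 1); rewrite /= ?updE /= ?hs.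
Qed.

Lemma main_ok st : iv st vn = n -> iv st vp = p ->
  (forall u, (u < n.*2)%N ->
     ar st aIN u = if (u < n)%N then nth 0 xs u else nth 0 ys (u - n)) ->
  let st' := sem main_cmd st in
  (exists c s, [/\ sc st' 0 = mod1 c, iv st' 0 = s, (s < n)%N,
     sc st' 1 = linear_cost p xs ys s%:Z c & forall s' c', (s' < n)%N ->
      linear_cost p xs ys s%:Z c <= linear_cost p xs ys s'%:Z c']) /\
  (cost main_cmd st <= 1000 * (150 * (p ^ 2 * n * (trunc_log 2 n).+1)))%N.
Proof.
move=> hn hp hin st'; rewrite {}/st' /main_cmd 9!sem_seq 9!cost_seq.
have p2 : (2 <= p)%N by case: p evp p0 => [|[]].
have [[K [d1 d2 d3]] l1] := dims_ok hn n0.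
set st1 := sem dims_cmd st in d1 *.
set q := (2 ^ K)%N in d1 d2 d3; have q0 : (0 < q)%N by rewrite expn_gt0.
have kq : (0 < K.+1 <= q)%N by rewrite /= ltn_expl.
have hp1 : iv st1 vp = p by rewrite (sem_iv (c := dims_cmd)).
have hn1 : iv st1 vn = n by rewrite (sem_iv (c := dims_cmd)).
have hH1 : iv st1 vH = (2 * q)%N by case: d1.
have [t2 l2] := tree_ok_cmd hp1 p2 hH1 q0.
set st2 := sem tree_cmd st1 in t2 *.
have i2 v : (v < 6)%N -> iv st2 v = iv st1 v by exact: sem_iv_low.
have hp2 : iv st2 vp = p by rewrite i2.
have [f3 l3] := fact_ok hp2.
set st3 := sem fact_cmd st2 in f3 *.
have i3 v : (v < 6)%N -> iv st3 v = iv st1 v by move=> hv; rewrite sem_iv_low ?i2.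
have hn3 : iv st3 vn = n by rewrite i3.
have [x4 l4] := basex_ok hn3.
set st4 := sem basex_cmd st3 in x4 *.
pose BX := ar st4 aB.
have i4 v : (v < 6)%N -> iv st4 v = iv st1 v by move=> hv; rewrite sem_iv_low ?i3.
have d4 : fft_dims q K.+1 st4 by case: d1 => *; split; rewrite i4.
have hp4 : iv st4 vp = p by rewrite i4.
have n4 : (n <= 4 * q)%N by lia.
have [|X5 l5] := @powers_ok R st4 aX q K.+1 p n vn BX d4 kq hp4 isT erefl n4 isT.
  by move=> s' h; rewrite [LHS]h // i4.
set st5 := sem (powers_cmd vn aX) st4 in X5 *.
have i5 v : (v < 6)%N -> iv st5 v = iv st1 v by move=> hv; rewrite sem_iv_low ?i4.
have hn5 : iv st5 vn = n by rewrite i5.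
have [y6 l6] := basey_ok hn5.
set st6 := sem basey_cmd st5 in y6 *.
pose BY := ar st6 aB.
have i6 v : (v < 6)%N -> iv st6 v = iv st1 v by move=> hv; rewrite sem_iv_low ?i5.
have d6 : fft_dims q K.+1 st6 by case: d1 => *; split; rewrite i6.
have hp6 : iv st6 vp = p by rewrite i6.
have n6 : (2 * n <= 4 * q)%N by lia.
have [|Y7 l7] := @powers_ok R st6 aY q K.+1 p (2 * n) (vn + vn) BY d6 kq hp6 isT erefl n6 isT.
  by move=> s' h; rewrite /= !h // i6 // hn1; lia.
set st7 := sem (powers_cmd (vn + vn) aY) st6 in Y7 *.
have i7 v : (v < 6)%N -> iv st7 v = iv st1 v by move=> hv; rewrite sem_iv_low ?i6.
have d7 : fft_dims q K.+1 st7 by case: d1 => *; split; rewrite i7.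
have hp7 : iv st7 vp = p by rewrite i7.
have hn7 : iv st7 vn = n by rewrite i7.
have tw4 : ar st4 aTW = ar st2 aTW.
  by rewrite (sem_ar (c := basex_cmd)) // (sem_ar (c := fact_cmd)).
have tw6 : ar st6 aTW = ar st2 aTW.
  by rewrite (sem_ar (c := basey_cmd)) // (sem_ar (c := powers_cmd vn aX)).
have tw7 : ar st7 aTW = ar st2 aTW by rewrite (sem_ar (c := powers_cmd (vn + vn) aY)).
have x7 : ar st7 aX = ar st5 aX.
  by rewrite (sem_ar (c := powers_cmd (vn + vn) aY)) // (sem_ar (c := basey_cmd)).
have tabs : tables_ok p n q K.+1 BX BY st7.
  by move=> a u ha hu; rewrite x7 tw7 X5 // tw4 Y7 // tw6.
have t7 : tree_ok (2 * q) (ar st7 aTW) by rewrite tw7.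
have [M8 l8] := combine_ok erefl erefl d2 n0 d7 kq t7 tabs hn7 hp7.
set st8 := sem combine_cmd st7 in M8 *.
have in3 : ar st3 aIN = ar st aIN.
  by rewrite (sem_ar (c := fact_cmd)) // (sem_ar (c := tree_cmd)) // (sem_ar (c := dims_cmd)).
have in5 : ar st5 aIN = ar st aIN.
  by rewrite (sem_ar (c := powers_cmd vn aX)) // (sem_ar (c := basex_cmd)).
have hBX i : (i < n)%N -> BX i = nth 0 xs (n.-1 - i).
  by move=> hi; rewrite /BX x4 // in3 hin ?ifT //; lia.
have hBY i : (i < 2 * n)%N -> BY i = - unroll ys i%:Z.
  move=> hi; rewrite /BY unroll_nat (size_ys hys); have [lt|ge] := ltnP i n.
    have [-> _] := y6 i lt; rewrite in5 hin; last by lia.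
    by rewrite ifF ?addKn ?modn_small ?divn_small ?addr0 //; lia.
  have lt : (i - n < n)%N by lia.
  have [_] := y6 _ lt; rewrite subnKC // => ->; rewrite in5 hin; last by lia.
  rewrite ifF; last by lia.
  have -> : (i = 1 * n + (i - n))%N by lia.
  rewrite modnMDl divnMDl // modn_small // divn_small //.
  have -> : (1 * n + (i - n) - n = i - n)%N by lia.
  by rewrite addn0; ring.
have F8 : ar st8 aF = ar st3 aF.
  rewrite (sem_ar (c := combine_cmd)) // (sem_ar (c := powers_cmd (vn + vn) aY)) //.
  rewrite (sem_ar (c := basey_cmd)) // (sem_ar (c := powers_cmd vn aX)) //.
  by rewrite (sem_ar (c := basex_cmd)).
have i8 v : (v < 6)%N -> iv st8 v = iv st1 v by move=> hv; rewrite sem_iv_low ?i7.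
have mom : moments_ok p n (4 * q) xs ys st8.
  split; rewrite ?i8 //; first by case: d1.
    move=> m s hm hs; rewrite M8 // (@conv_moment R n xs ys s m (4 * q) BX BY) //; lia.
  by move=> j hj; rewrite F8 f3.
have [l9 [s [c [b1 b2 b3 [b4 b5 b6]]]]] := scan_ok evp p0 n0 hxs hys mom.
set st9 := sem scan_cmd st8 in b1 b2 b3 *.
have hp9 : iv st9 vp = p by rewrite (sem_iv (c := scan_cmd)) // i8.
have hF9 : ar st9 aF p = p`!%:R^-1 by rewrite (sem_ar (c := scan_cmd)) // F8 f3.
have [o1 o2 o3 l10] := output_ok hp9 hF9 b2 b3 b1 b5.
split; first by exists c, s.
(* 2^K < 2 n gives K - 1 <= lg n for K > 0. *)
have hK : (K.+1 <= 2 * (trunc_log 2 n).+1)%N.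
  case: K @q d1 d2 d3 q0 kq {d4 X5 l5 d6 n4 n6 l7 Y7 d7 tabs M8 l8 mom l9 l2 t2 hH1 t7} => [|K'] q _ _ d3 _ _; first by lia.
  have : (2 ^ K' <= n)%N by move: d3; rewrite /q expnS; lia.
  by move=> /trunc_log_max -/(_ isT); lia.
clear - l1 l2 l3 l4 l5 l6 l7 l8 l9 l10 hK d2 d3 p2 n0 kq q0.
move: (cost _ _) l1 => z1 l1.
move: (cost _ _) l2 => z2 l2; move: (cost _ _) l3 => z3 l3; move: (cost _ _) l4 => z4 l4.
move: (cost _ _) l5 => z5 l5; move: (cost _ _) l6 => z6 l6; move: (cost _ _) l7 => z7 l7.
move: (cost _ _) l8 => z8 l8; move: (cost _ _) l9 => z9 l9; move: (cost _ _) l10 => z10 l10.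
move: (trunc_log 2 n).+1 hK => L hK; set k := K.+1 in kq hK l5 l7 l8.
case/andP: kq => k0 _; set P := p.+1 in l2 l3 l5 l7 l8 l9.
have hP : (P <= 2 * p)%N by rewrite /P; lia.
(* Each of the four factors at most doubles: p + 1 <= 2 p twice, k <= 2 L and q <= 2 n. *)
have W : (P * (P * (k * q)) <= 16 * (p ^ 2 * n * L))%N.
  have -> : (16 * (p ^ 2 * n * L) = 2 * p * (2 * p * (2 * L * (2 * n))))%N.
    by rewrite expnS expn1; lia.
  by rewrite !leq_mul // ltnW.
have P0 : (0 < P)%N by [].
have g1 : (q <= k * q)%N by rewrite -{1}[q]mul1n leq_mul2r k0 orbT.
have kq0 : (0 < k * q)%N by rewrite muln_gt0 k0.
have g2 : (k * q <= P * (k * q))%N by rewrite -{1}[(k * q)%N]mul1n leq_mul2r orbT.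
have g3 : (P * (k * q) <= P * (P * (k * q)))%N by rewrite leq_mul2l g2 orbT.
have g4 : (P <= P * (k * q))%N by rewrite -{1}[P]muln1 leq_mul2l kq0.
have g5 : (q * P <= P * (k * q))%N by rewrite mulnC leq_mul2l g1 orbT.
have g6 : (n * P <= P * (k * q))%N.
  by rewrite [(n * P)%N]mulnC leq_mul2l (leq_trans d2 g1) orbT.
have g7 : (n <= k * q)%N by apply: leq_trans d2 g1.
move: (P * (P * (k * q)))%N (P * (k * q))%N (k * q)%N (q * P)%N (n * P)%N
  W g1 g2 g3 g4 g5 g6 g7 kq0 l2 l5 l7 l8 l9 => M1 M2 M3 M4 M5.
move: (p ^ 2 * n * L)%N => W0; lia.
Qed.

End Main.

Lemma wf_main : wf main_cmd.
Proof. by []. Qed.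

(* There is a single real-RAM program and a constant C such that, for every
   even positive p and every instance with n >= 1 beads, the program halts
   with an optimal (c, s) and the optimal value, using at most
   C * p^2 * n * (lg n + 1) steps (i.e. O(p^2 n lg n)). *)
Theorem theorem2 (R : realType) :
  exists (prog : seq instr) (C : nat),
    forall (p n : nat) (xs ys : seq R),
      (0 < p)%N -> ~~ odd p -> (0 < n)%N ->
      necklace_input n xs -> necklace_input n ys ->
      exists (fuel : nat) (fin : ram_state R) (T : nat),
        exec prog fuel (necklace_init p xs ys) = Some (fin, T) /\
        (T <= C * p ^ 2 * n * (trunc_log 2 n).+1)%N /\
        necklace_output_ok p xs ys fin.
Proof.
(* 1000 * 150 pays for [main_cmd]; the rest absorbs the 10 + 10 n steps that copy the input. *)
exists (program main_cmd), (1000 * 170)%N => p n xs ys p0 evp n0 hxs hys.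
have [st [fuel [fin [T [[hn hp hin] hexec hT [f0 f1 f2]]]]]] :=
  @program_ok R main_cmd p n xs ys wf_main n0 (size_xs hxs).
have [[c [s [m0 m1 m2 m3 m4]]] hcost] := main_ok evp p0 n0 hxs hys hn hp hin.
exists fuel, fin, T; split; first exact: hexec.
split.
  have h1 : (n <= p ^ 2 * n * (trunc_log 2 n).+1)%N.
    by rewrite -{1}[n]mul1n -{1}[(1 * n)%N]muln1 !leq_mul // expn_gt0 p0.
  have -> : (1000 * 170 * p ^ 2 * n * (trunc_log 2 n).+1 =
      1000 * 170 * (p ^ 2 * n * (trunc_log 2 n).+1))%N by rewrite -!mulnA.
  by move: hT hcost h1; move: (p ^ 2 * n * _)%N (cost _ _) => W z; lia.
exists s; split; first by rewrite f2 m1.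
rewrite f0 f1 m0 m3; apply: (linear_min_optimal evp n0 hxs hys) => //.
Qed.
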